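(* For every $n\ge1$ and $\sigma\in S_n$, the graded character $\mathfrak{pvb}_{n,\sigma}(z)$ is given in terms of $\mathfrak{pvb}^!_{n,\sigma}(z)$ by the Koszul formula (as formal power series) $$\mathfrak{pvb}_{n,\sigma}(z)=\frac{1}{\mathfrak{pvb}_{n,\sigma}^!(-z)}.$$
   Context: $\mathfrak{pvb}_n$ is the graded associative unital $\mathbb{Q}$-algebra generated by degree-1 elements $r_{ij}$, $1\le i\ne j\le n$, with relations $[r_{ij},r_{ik}+r_{jk}]+[r_{ik},r_{jk}]=0$ and $[r_{ij},r_{kl}]=0$ for distinct $i,j,k,l$ (it is the associated graded of the rational group algebra of the pure virtual braid group, filtered by powers of the augmentation ideal). Its quadratic dual $\mathfrak{pvb}_n^!$ is the exterior algebra over $\mathbb{Q}$ on degree-1 generators $r_{ij}$, $1\le i\neq j\le n$, modulo the relations, for distinct $i,j,k$: $r_{ij}\wedge r_{ik}=r_{ij}\wedge r_{jk}-r_{ik}\wedge r_{kj}$, $r_{ik}\wedge r_{jk}=r_{ij}\wedge r_{jk}-r_{ji}\wedge r_{ik}$, $r_{ij}\wedge r_{ji}=0$. Both algebras are known to be Koszul. $S_n$ acts on both by $\sigma(r_{ij})=r_{\sigma(i)\sigma(j)}$. $\mathfrak{pvb}_{n,\sigma}(z)$ and $\mathfrak{pvb}_{n,\sigma}^!(z)$ are the generating series $\sum_{k\ge0}(\text{trace of }\sigma\text{ on the degree-}k\text{ component})\,z^k$ of the respective algebras. *)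

(* Defs.v *)
From HB Require Import structures.
From mathcomp Require Import all_boot all_order all_algebra.
From mathcomp Require Import finmap monalg.
From mathcomp Require Import generic_quotient perm boolp.

Set Implicit Arguments.
Unset Strict Implicit.
Unset Printing Implicit Defensive.

Import GRing.Theory.
Local Open Scope ring_scope.
Local Open Scope quotient_scope.

(* Two-sided ideal generated by S. *)
Definition ideal_gen (A : pzRingType) (S : A -> Prop) (a : A) : Prop :=
  exists (m : nat) (u r v : 'I_m -> A),
    (forall i, S (r i)) /\ a = \sum_(i < m) u i * r i * v i.

Section Ideal.
Variables (A : nzRingType) (S : A -> Prop).
Local Notation I := (ideal_gen S).

Lemma ideal_gen_in a : S a -> I a.
Proof.
move=> Sa; exists 1%N, (fun=> 1), (fun=> a), (fun=> 1); split=> //.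
by rewrite big_ord1 mul1r mulr1.
Qed.

Lemma ideal_gen0 : I 0.
Proof.
exists 0%N, (fun=> 0), (fun=> 0), (fun=> 0); split; first by case.
by rewrite big_ord0.
Qed.

Lemma ideal_genD a b : I a -> I b -> I (a + b).
Proof.
move=> [m [u [r [v [Sr ->]]]]] [m' [u' [r' [v' [Sr' ->]]]]].
pose glue (f : 'I_m -> A) (g : 'I_m' -> A) i :=
  match split i with inl j => f j | inr j => g j end.
exists (m + m')%N, (glue u u'), (glue r r'), (glue v v'); split.
  by move=> i; rewrite /glue; case: split.
have glL f g i : glue f g (lshift m' i) = f i.
  by rewrite /glue (unsplitK (inl i)).
have glR f g i : glue f g (rshift m i) = g i.
  by rewrite /glue (unsplitK (inr i)).
rewrite big_split_ord.
under [X in _ = X + _]eq_bigr do rewrite !glL.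
by under [X in _ = _ + X]eq_bigr do rewrite !glR.
Qed.

Lemma ideal_genMl a b : I b -> I (a * b).
Proof.
move=> [m [u [r [v [Sr ->]]]]].
exists m, (fun i => a * u i), r, v; split=> //.
by rewrite mulr_sumr; apply: eq_bigr => i _; rewrite !mulrA.
Qed.

Lemma ideal_genMr a b : I a -> I (a * b).
Proof.
move=> [m [u [r [v [Sr ->]]]]].
exists m, u, r, (fun i => v i * b); split=> //.
by rewrite mulr_suml; apply: eq_bigr => i _; rewrite !mulrA.
Qed.

Lemma ideal_genN a : I a -> I (- a).
Proof. by move=> Ia; rewrite -mulN1r; apply: ideal_genMl. Qed.

Lemma ideal_gen_map (f : {rmorphism A -> A}) :
  (forall a, S a -> S (f a)) -> forall a, I a -> I (f a).
Proof.
move=> hf _ [m [u [r [v [Sr ->]]]]].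
exists m, (f \o u), (f \o r), (f \o v); split; first by move=> i; exact: hf.
by rewrite rmorph_sum; apply: eq_bigr => i _; rewrite !rmorphM.
Qed.
End Ideal.

Section Quotient.
Variables (F : fieldType) (A : algType F) (S : A -> Prop).
Local Notation I := (ideal_gen S).

Definition ideal_eq (a b : A) : bool := `[< I (a - b) >].

Lemma ideal_eq_equiv : equiv_class_of ideal_eq.
Proof.
split=> [a|a b|b a c]; rewrite /ideal_eq.
- by apply/asboolP; rewrite subrr; apply: ideal_gen0.
- by apply/asboolP/asboolP => /ideal_genN; rewrite opprB.
- move=> /asboolP hab /asboolP hbc; apply/asboolP.
  by rewrite -(subrK b a) -addrA; apply: ideal_genD.
Qed.

Canonical ideal_eq_equivRel := EquivRelPack ideal_eq_equiv.

Variable proper : ~ I 1.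

(* Quotient of A by the two-sided ideal generated by S; properness is required
   only because algType excludes the zero ring. *)
Definition quotalg of ~ I 1 := {eq_quot ideal_eq}.
Local Notation Q := (quotalg proper).
HB.instance Definition _ := Choice.on Q.
HB.instance Definition _ := EqQuotient.on Q.

Definition qclass (a : A) : Q := \pi_Q a.

Lemma qclassP (a b : A) : qclass a = qclass b <-> I (a - b).
Proof.
split=> [/eqP|h]; first by rewrite eqmodE => /asboolP.
by apply/eqP; rewrite eqmodE; apply/asboolP.
Qed.

Lemma qclassK : cancel (fun x : Q => repr x) qclass.
Proof. exact: reprK. Qed.

Lemma qclassW (P : Q -> Prop) : (forall a, P (qclass a)) -> forall x, P x.
Proof. by move=> hP x; rewrite -[x]qclassK. Qed.

Lemma repr_qclass (a : A) : I (repr (qclass a) - a).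
Proof. by apply/qclassP; rewrite qclassK. Qed.

Definition qopp (x : Q) : Q := qclass (- repr x).
Definition qadd (x y : Q) : Q := qclass (repr x + repr y).
Definition qmul (x y : Q) : Q := qclass (repr x * repr y).
Definition qscale (c : F) (x : Q) : Q := qclass (c *: repr x).

Lemma qoppE a : qopp (qclass a) = qclass (- a).
Proof.
apply/qclassP; rewrite -opprD; apply: ideal_genN; exact: repr_qclass.
Qed.

Lemma qaddE a b : qadd (qclass a) (qclass b) = qclass (a + b).
Proof.
apply/qclassP; rewrite opprD addrACA.
by apply: ideal_genD; exact: repr_qclass.
Qed.

Lemma qmulE a b : qmul (qclass a) (qclass b) = qclass (a * b).
Proof.
apply/qclassP; set a' := repr _; set b' := repr _.
have -> : a' * b' - a * b = (a' - a) * b' + a * (b' - b).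
  by rewrite mulrBl mulrBr addrA subrK.
by apply: ideal_genD; [apply: ideal_genMr | apply: ideal_genMl];
  exact: repr_qclass.
Qed.

Lemma qscaleE c a : qscale c (qclass a) = qclass (c *: a).
Proof.
apply/qclassP; rewrite -scalerBr -[X in I X]mul1r -scalerAr scalerAl.
by apply: ideal_genMl; exact: repr_qclass.
Qed.

Fact qaddA : associative qadd.
Proof.
elim/qclassW=> a; elim/qclassW=> b; elim/qclassW=> c.
by rewrite (qaddE b) (qaddE a) (qaddE a) (qaddE (a + b)) addrA.
Qed.

Fact qaddC : commutative qadd.
Proof. by move=> x y; rewrite /qadd addrC. Qed.

Fact qadd0 : left_id (qclass 0) qadd.
Proof. by elim/qclassW=> a; rewrite qaddE add0r. Qed.

Fact qaddN : left_inverse (qclass 0) qopp qadd.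
Proof. by elim/qclassW=> a; rewrite (qoppE a) (qaddE (- a)) addNr. Qed.

HB.instance Definition _ := GRing.isZmodule.Build Q qaddA qaddC qadd0 qaddN.

Fact qmulA : associative qmul.
Proof.
elim/qclassW=> a; elim/qclassW=> b; elim/qclassW=> c.
by rewrite (qmulE b) (qmulE a) (qmulE a) (qmulE (a * b)) mulrA.
Qed.

Fact qmul1 : left_id (qclass 1) qmul.
Proof. by elim/qclassW=> a; rewrite qmulE mul1r. Qed.

Fact qmulr1 : right_id (qclass 1) qmul.
Proof. by elim/qclassW=> a; rewrite qmulE mulr1. Qed.

Fact qmulDl : left_distributive qmul qadd.
Proof.
elim/qclassW=> a; elim/qclassW=> b; elim/qclassW=> c.
by rewrite (qaddE a) (qmulE (a + b)) !qmulE (qaddE (a * c)) mulrDl.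
Qed.

Fact qmulDr : right_distributive qmul qadd.
Proof.
elim/qclassW=> a; elim/qclassW=> b; elim/qclassW=> c.
by rewrite (qaddE b) !qmulE (qaddE (a * b)) mulrDr.
Qed.

Fact qone_neq0 : qclass 1 != qclass 0.
Proof. by apply/eqP => /qclassP; rewrite subr0. Qed.

HB.instance Definition _ := GRing.Zmodule_isNzRing.Build Q
  qmulA qmul1 qmulr1 qmulDl qmulDr qone_neq0.

Fact qscaleA c d x : qscale c (qscale d x) = qscale (c * d) x.
Proof. by elim/qclassW: x => a; rewrite !qscaleE scalerA. Qed.

Fact qscale1 : left_id 1 qscale.
Proof. by elim/qclassW=> a; rewrite qscaleE scale1r. Qed.

Fact qscaleDr : right_distributive qscale +%R.
Proof.
move=> c; elim/qclassW=> a; elim/qclassW=> b; change (+%R) with qadd.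
by rewrite (qaddE a) !qscaleE (qaddE (c *: a)) scalerDr.
Qed.

Fact qscaleDl x : {morph qscale^~ x : c d / c + d}.
Proof.
move=> c d; elim/qclassW: x => a; rewrite -[RHS]/(qadd (qscale c _) _).
by rewrite !qscaleE (qaddE (c *: a)) scalerDl.
Qed.

HB.instance Definition _ := GRing.Zmodule_isLmodule.Build F Q
  qscaleA qscale1 qscaleDr qscaleDl.

Fact qscaleAl c (x y : Q) : c *: (x * y) = (c *: x) * y.
Proof.
elim/qclassW: x => a; elim/qclassW: y => b.
rewrite -[LHS]/(qscale c (qmul _ _)) -[RHS]/(qmul (qscale c _) _).
by rewrite (qmulE a) !qscaleE (qmulE (c *: a)) scalerAl.
Qed.

HB.instance Definition _ := GRing.Lmodule_isLalgebra.Build F Q qscaleAl.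

Fact qscaleAr c (x y : Q) : c *: (x * y) = x * (c *: y).
Proof.
elim/qclassW: x => a; elim/qclassW: y => b.
rewrite -[LHS]/(qscale c (qmul _ _)) -[RHS]/(qmul _ (qscale c _)).
by rewrite (qmulE a) !qscaleE (qmulE a) scalerAr.
Qed.

HB.instance Definition _ := GRing.Lalgebra_isAlgebra.Build F Q qscaleAr.

Fact qclass_is_zmod_morphism : zmod_morphism qclass.
Proof. by move=> a b; rewrite -qaddE -qoppE. Qed.

Fact qclass_is_monoid_morphism : monoid_morphism qclass.
Proof. by split=> // a b; rewrite -qmulE. Qed.

Fact qclass_is_scalable : scalable qclass.
Proof. by move=> c a; rewrite -qscaleE. Qed.

HB.instance Definition _ :=
  GRing.isZmodMorphism.Build A Q qclass qclass_is_zmod_morphism.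
HB.instance Definition _ :=
  GRing.isMonoidMorphism.Build A Q qclass qclass_is_monoid_morphism.
HB.instance Definition _ :=
  GRing.isScalable.Build F A Q *:%R qclass qclass_is_scalable.

Lemma qclass_eq0 a : qclass a = 0 <-> I a.
Proof. by rewrite -[a in I a]subr0 -qclassP. Qed.

(* Map induced on the quotient by an algebra endomorphism f preserving S. *)
Definition qmap (f : A -> A) (x : Q) : Q := qclass (f (repr x)).

Section QMap.
Variable f : {lrmorphism A -> A}.
Hypothesis hf : forall a, S a -> S (f a).

Lemma qmapE a : qmap f (qclass a) = qclass (f a).
Proof.
apply/qclassP; rewrite -rmorphB; apply: ideal_gen_map => //.
exact: repr_qclass.
Qed.

Lemma qmap_is_zmod_morphism : zmod_morphism (qmap f).
Proof.
elim/qclassW=> a; elim/qclassW=> b.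
by rewrite -(rmorphB qclass) !qmapE !rmorphB.
Qed.

Lemma qmap_is_monoid_morphism : monoid_morphism (qmap f).
Proof.
split; first by rewrite -[in LHS](rmorph1 qclass) qmapE !rmorph1.
elim/qclassW=> a; elim/qclassW=> b.
by rewrite -(rmorphM qclass) !qmapE !rmorphM.
Qed.

Lemma qmap_is_scalable : scalable (qmap f).
Proof.
move=> c; elim/qclassW=> a.
have -> : c *: qclass a = qclass (c *: a) by rewrite linearZ.
by rewrite !qmapE !linearZ.
Qed.
End QMap.
End Quotient.

(* Free associative unital algebra over Q: the monoid algebra of the free
   monoid of words in X. *)
Definition freealg (X : choiceType) := {malg rat[{fmonom X}]}.

Section FreeAlgebra.
Variable X : choiceType.

HB.instance Definition _ := GRing.Lalgebra.on (freealg X).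

Fact freealg_mulC (a : freealg X) c : a * c%:MP = c *: a.
Proof.
rewrite malgM_def fgmulgU malgZ_def; apply: eq_bigr => w _.
by rewrite mulrC mulm1.
Qed.

Fact freealg_scaleAr c (a b : freealg X) : c *: (a * b) = a * (c *: b).
Proof. by rewrite -[LHS]freealg_mulC -[c *: b]freealg_mulC mulrA. Qed.

HB.instance Definition _ :=
  GRing.Lalgebra_isAlgebra.Build rat (freealg X) freealg_scaleAr.

Definition letter (x : X) : freealg X := << fmu x >>.

Definition homog (k : nat) (a : freealg X) : Prop :=
  forall w : {fmonom X}, w \in msupp a -> fdeg w = k.

Lemma homog_coef k a :
  homog k a <-> forall w : {fmonom X}, fdeg w <> k -> a@_w = 0.
Proof.
split=> [ha w nw|ha w].
  by apply: mcoeff_outdom; apply/negP => /ha.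
rewrite -mcoeff_neq0 => /eqP nz; apply: contrapT => nw; exact/nz/ha.
Qed.

Lemma homogD k a b : homog k a -> homog k b -> homog k (a + b).
Proof.
move=> /homog_coef ha /homog_coef hb; apply/homog_coef => w nw.
by rewrite mcoeffD ha ?hb ?addr0.
Qed.

Lemma homogN k a : homog k a -> homog k (- a).
Proof.
by move=> /homog_coef ha; apply/homog_coef => w nw; rewrite mcoeffN ha ?oppr0.
Qed.

Lemma homogB k a b : homog k a -> homog k b -> homog k (a - b).
Proof. by move=> ha hb; apply/homogD/homogN. Qed.

Lemma homog0 k : homog k 0.
Proof. by apply/homog_coef => w _; rewrite mcoeff0. Qed.

Lemma homogZ k c a : homog k a -> homog k (c *: a).
Proof.
by move=> /homog_coef ha; apply/homog_coef => w nw; rewrite mcoeffZ ha ?mulr0.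
Qed.

Lemma homog_sum (I : Type) (r : seq I) (P : pred I) (E : I -> freealg X) k :
  (forall i, P i -> homog k (E i)) -> homog k (\sum_(i <- r | P i) E i).
Proof.
by move=> hE; elim/big_ind: _ => //; [exact: homog0 | exact: homogD].
Qed.

Lemma homogM k l a b : homog k a -> homog l b -> homog (k + l) (a * b).
Proof.
move=> ha hb w /msuppM_le[u [v [/ha <- /hb <- ->]]]; exact: fdegM.
Qed.

Lemma homog_letter x : homog 1 (letter x).
Proof. by move=> w; rewrite msuppU1 inE => /eqP ->; rewrite fdegU. Qed.

Lemma quadratic_ideal_proper (S : freealg X -> Prop) :
  (forall a, S a -> homog 2 a) -> ~ ideal_gen S 1.
Proof.
move=> h2 [m [u [r [v [Sr e]]]]].
have : (1 : freealg X)@_(mone : {fmonom X}) = 0.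
  rewrite e raddf_sum big1 //= => i _.
  have /homog_coef hr := h2 _ (Sr i).
  have [cM _] := @mcoeff1g_is_multiplicative {fmonom X} rat.
  by rewrite !cM (hr mone) ?fdeg1 // mulr0 mul0r.
by rewrite mcoeff1 eqxx => /eqP; rewrite oner_eq0.
Qed.
End FreeAlgebra.

(* relabel s is the algebra endomorphism sending letter x to letter (s x). *)
Section Relabel.
Variables (X : choiceType) (s : X -> X).

Definition relabel_word (w : {fmonom X}) : freealg X :=
  << FMonom (map s w) >>.

Fact relabel_word_mmorphism : mmorphism relabel_word.
Proof.
split=> [u v|]; last by rewrite /relabel_word fm1 /= -fmoneE.
rewrite /relabel_word fmM map_cat malgM_def fgmulUU mulr1; congr (<< _ >>).
by apply/eqP; rewrite -val_eqE /= fmM.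
Qed.

HB.instance Definition _ :=
  isMultiplicative.Build {fmonom X} (freealg X) relabel_word
    relabel_word_mmorphism.

Definition relabel (a : freealg X) : freealg X :=
  mmap (@malgC {fmonom X} rat) relabel_word a.

Fact relabel_is_zmod_morphism : zmod_morphism relabel.
Proof. exact: mmapB. Qed.

Fact relabel_is_monoid_morphism : monoid_morphism relabel.
Proof.
have cf (g : freealg X) m m' :
  GRing.comm (@malgC {fmonom X} rat g@_m) (relabel_word m').
  by rewrite /GRing.comm mul_malgC freealg_mulC.
have [hM h1] := commr_mmap_is_multiplicative cf.
by split.
Qed.

HB.instance Definition _ := GRing.isZmodMorphism.Build
  (freealg X) (freealg X) relabel relabel_is_zmod_morphism.
HB.instance Definition _ := GRing.isMonoidMorphism.Build
  (freealg X) (freealg X) relabel relabel_is_monoid_morphism.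

Fact relabel_is_scalable : scalable relabel.
Proof.
move=> c a; rewrite -[c *: a]mul_malgC rmorphM /= -mul_malgC; congr (_ * _).
exact: mmapC.
Qed.

HB.instance Definition _ := GRing.isScalable.Build rat
  (freealg X) (freealg X) *:%R relabel relabel_is_scalable.

Lemma relabel_letter x : relabel (letter x) = letter (s x).
Proof.
by rewrite /relabel /letter mmapU mul_malgC scale1r /relabel_word fmU fmuE.
Qed.
End Relabel.

(* Trace of an endomorphism on a finite-dimensional stable subspace U of a
   possibly infinite-dimensional space. *)
Section Trace.
Variables (F : fieldType) (V : lmodType F).

Definition basis_of_subspace (U : V -> Prop) (m : nat) (b : 'I_m -> V) : Prop :=
  (forall c : 'I_m -> F, \sum_i c i *: b i = 0 -> forall i, c i = 0) /\
  (forall v, U v <-> exists c : 'I_m -> F, v = \sum_i c i *: b i).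

Definition is_trace (U : V -> Prop) (f : V -> V) (t : F) : Prop :=
  exists (m : nat) (b : 'I_m -> V) (M : 'M[F]_m),
    [/\ basis_of_subspace U b,
        forall j, f (b j) = \sum_i M i j *: b i
      & t = \tr M].

(* The value 0 is only a default for when U has no finite basis or is not
   stable under f. *)
Definition trace (U : V -> Prop) (f : V -> V) : F :=
  if pselect (exists t, is_trace U f t) is left e then projT1 (cid e) else 0.

Lemma is_trace_uniq (U : V -> Prop) (f : {linear V -> V}) (t t' : F) :
  is_trace U f t -> is_trace U f t' -> t = t'.
Proof.
move=> [m [b [M [[bf bU] bM ->]]]] [m' [b' [M' [[bf' bU'] bM' ->]]]].
have delta n (c : 'I_n -> V) j : c j = \sum_i (i == j)%:R *: c i.
  rewrite (bigD1 j) //= eqxx scale1r big1 ?addr0 // => i /negPf ->.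
  by rewrite scale0r.
have Ub j : U (b j) by apply/bU; exists (fun i => (i == j)%:R); exact: delta.
have Ub' j : U (b' j) by apply/bU'; exists (fun i => (i == j)%:R); exact: delta.
have [P hP] : exists P : 'M[F]_(m, m'), forall k, b' k = \sum_i P i k *: b i.
  have /fin_all_exists[c hc] k : exists c : 'I_m -> F, b' k = \sum_i c i *: b i.
    exact/bU.
  by exists (\matrix_(i, k) c k i) => k; rewrite hc; under [RHS]eq_bigr do rewrite mxE.
have [Q hQ] : exists Q : 'M[F]_(m', m), forall k, b k = \sum_i Q i k *: b' i.
  have /fin_all_exists[c hc] k : exists c : 'I_m' -> F, b k = \sum_i c i *: b' i.
    exact/bU'.
  by exists (\matrix_(i, k) c k i) => k; rewrite hc; under [RHS]eq_bigr do rewrite mxE.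
have inj n n' (c : 'I_n -> V) (A B : 'M[F]_(n, n')) :
    (forall d : 'I_n -> F, \sum_i d i *: c i = 0 -> forall i, d i = 0) ->
    (forall k, \sum_i A i k *: c i = \sum_i B i k *: c i) -> A = B.
  move=> cf AB; apply/matrixP => i k; apply/eqP; rewrite -subr_eq0.
  apply/eqP/(cf (fun i => A i k - B i k)).
  under eq_bigr do rewrite scalerBl.
  by rewrite sumrB AB subrr.
have comp n n' n'' (c : 'I_n -> V) (A : 'M[F]_(n, n')) (B : 'M[F]_(n', n'')) k :
    \sum_j B j k *: (\sum_i A i j *: c i) = \sum_i (A *m B) i k *: c i.
  under eq_bigr do rewrite scaler_sumr.
  rewrite exchange_big /=; apply: eq_bigr => i _; rewrite mxE scaler_suml.
  by apply: eq_bigr => j _; rewrite scalerA mulrC.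
have PQ : P *m Q = 1%:M.
  apply: (inj _ _ b) => // k; rewrite -comp.
  under eq_bigr do rewrite -hP.
  by rewrite -hQ [LHS]delta; apply: eq_bigr => i _; rewrite mxE.
have QP : Q *m P = 1%:M.
  apply: (inj _ _ b') => // k; rewrite -comp.
  under eq_bigr do rewrite -hQ.
  by rewrite -hP [LHS]delta; apply: eq_bigr => i _; rewrite mxE.
have MP : M *m P = P *m M'.
  apply: (inj _ _ b) => // k; rewrite -!comp.
  under eq_bigr do rewrite -bM.
  under [RHS]eq_bigr do rewrite -hP.
  rewrite -bM' hP linear_sum; apply: eq_bigr => i _.
  by rewrite linearZ.
by rewrite -[M']mul1mx -QP -mulmxA -MP mxtrace_mulC -mulmxA PQ mulmx1.
Qed.

Lemma traceE (U : V -> Prop) (f : {linear V -> V}) (t : F) :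
  is_trace U f t -> trace U f = t.
Proof.
move=> ht; rewrite /trace; case: pselect => [e|[]]; last by exists t.
by case: cid => t' /= ht'; exact: is_trace_uniq ht' ht.
Qed.
End Trace.

(* The letter (i, j) of gen n, with i != j, stands for the generator r_ij. *)
Definition gen (n : nat) := {p : 'I_n * 'I_n | p.1 != p.2}.

(* r i i is the junk value 0; the relations below only use r i j for i != j. *)
Definition r (n : nat) (i j : 'I_n) : freealg (gen n) :=
  if insub (i, j) is Some g then letter g else 0.

Definition bracket (R : pzRingType) (x y : R) : R := x * y - y * x.

Inductive pvb_rel (n : nat) : freealg (gen n) -> Prop :=
| pvb_rel_triple (i j k : 'I_n) of uniq [:: i; j; k] :
    pvb_rel (bracket (r i j) (r i k + r j k) + bracket (r i k) (r j k))
| pvb_rel_disjoint (i j k l : 'I_n) of uniq [:: i; j; k; l] :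
    pvb_rel (bracket (r i j) (r k l)).

(* The squares of the degree-1 elements present the exterior algebra on the
   span of the generators; the other relations are imposed in it. *)
Inductive pvbd_rel (n : nat) : freealg (gen n) -> Prop :=
| pvbd_rel_square (c : gen n -> rat) :
    pvbd_rel ((\sum_g c g *: letter g) * (\sum_g c g *: letter g))
| pvbd_rel_out (i j k : 'I_n) of uniq [:: i; j; k] :
    pvbd_rel (r i j * r i k - (r i j * r j k - r i k * r k j))
| pvbd_rel_in (i j k : 'I_n) of uniq [:: i; j; k] :
    pvbd_rel (r i k * r j k - (r i j * r j k - r j i * r i k))
| pvbd_rel_opp (i j : 'I_n) of i != j :
    pvbd_rel (r i j * r j i).

Section Relations.
Variable n : nat.

Lemma homog_r (i j : 'I_n) : homog 1 (r i j).
Proof.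
by rewrite /r; case: insub => [g|]; [exact: homog_letter | exact: homog0].
Qed.

Let homog_rr (i j k l : 'I_n) : homog 2 (r i j * r k l).
Proof. by apply: (@homogM _ 1 1); exact: homog_r. Qed.

Lemma pvb_rel_homog (a : freealg (gen n)) : pvb_rel a -> homog 2 a.
Proof.
have hb (i j k l : 'I_n) : homog 2 (bracket (r i j) (r k l)).
  exact: homogB.
case=> [i j k _|i j k l _]; last exact: hb.
apply: homogD; last exact: hb.
by rewrite /bracket mulrDr mulrDl; apply: homogB; apply: homogD.
Qed.

Lemma pvbd_rel_homog (a : freealg (gen n)) : pvbd_rel a -> homog 2 a.
Proof.
case=> [c|i j k _|i j k _|i j _].
- have hc : homog 1 (\sum_g c g *: letter g : freealg (gen n)).
    by apply: homog_sum => g _; apply: homogZ; exact: homog_letter.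
  exact: (@homogM _ 1 1).
- by apply: homogB => //; exact: homogB.
- by apply: homogB => //; exact: homogB.
- exact: homog_rr.
Qed.
End Relations.

Definition pvb (n : nat) : algType rat :=
  quotalg (quadratic_ideal_proper (@pvb_rel_homog n)).

(* The quadratic dual of pvb n. *)
Definition pvbd (n : nat) : algType rat :=
  quotalg (quadratic_ideal_proper (@pvbd_rel_homog n)).

Definition pvb_degree (n k : nat) (x : pvb n) : Prop :=
  exists2 a : freealg (gen n), homog k a & x = qclass _ a.

Definition pvbd_degree (n k : nat) (x : pvbd n) : Prop :=
  exists2 a : freealg (gen n), homog k a & x = qclass _ a.

Section RmorphRelations.
Variables (R R' : pzRingType) (f : {rmorphism R -> R'}).

Lemma rmorph_bracket x y : f (bracket x y) = bracket (f x) (f y).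
Proof. by rewrite /bracket rmorphB !rmorphM. Qed.

Lemma rmorph_triple x y z : f (bracket x (y + z) + bracket y z) =
  bracket (f x) (f y + f z) + bracket (f y) (f z).
Proof. by rewrite rmorphD !rmorph_bracket rmorphD. Qed.

Lemma rmorph_three x1 y1 x2 y2 x3 y3 :
  f (x1 * y1 - (x2 * y2 - x3 * y3)) =
  f x1 * f y1 - (f x2 * f y2 - f x3 * f y3).
Proof. by rewrite !rmorphB !rmorphM. Qed.
End RmorphRelations.

Section Action.
Variables (n : nat) (s : 'S_n).

Fact gen_act_subproof (g : gen n) : s (val g).1 != s (val g).2.
Proof. by rewrite (inj_eq perm_inj); exact: valP g. Qed.

Definition gen_act (g : gen n) : gen n :=
  exist _ (s (val g).1, s (val g).2) (gen_act_subproof g).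

Lemma gen_act_inj : injective gen_act.
Proof.
move=> g h /(congr1 val) [/perm_inj e1 /perm_inj e2]; apply: val_inj.
by rewrite [LHS]surjective_pairing e1 e2 -surjective_pairing.
Qed.

Definition pvb_act : pvb n -> pvb n := qmap (relabel gen_act).
Definition pvbd_act : pvbd n -> pvbd n := qmap (relabel gen_act).

Lemma relabel_r i j : relabel gen_act (r i j) = r (s i) (s j).
Proof.
rewrite /r; case: insubP => [g hg eg|].
  rewrite relabel_letter; case: insubP => [h _ eh|].
    by congr letter; apply: val_inj; rewrite eh /= eg.
  by rewrite /= (inj_eq perm_inj) => /negP[].
move=> /= /negPn /eqP ->; case: insubP => [h /=|_]; first by rewrite eqxx.
exact: rmorph0.
Qed.

Let uniq3 i j k : uniq [:: i; j; k] -> uniq [:: s i; s j; s k].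
Proof. by rewrite -(map_inj_uniq (@perm_inj _ s)). Qed.

Let uniq4 i j k l : uniq [:: i; j; k; l] -> uniq [:: s i; s j; s k; s l].
Proof. by rewrite -(map_inj_uniq (@perm_inj _ s)). Qed.

Lemma pvb_rel_act a : pvb_rel a -> pvb_rel (relabel gen_act a).
Proof.
suff H (f : {rmorphism freealg (gen n) -> freealg (gen n)}) :
    (forall i j, f (r i j) = r (s i) (s j)) -> pvb_rel a -> pvb_rel (f a).
  exact: (H (relabel gen_act) relabel_r).
move=> fr.
case=> [i j k h|i j k l h].
  rewrite (rmorph_triple f (r i j) (r i k) (r j k)) !fr.
  by apply: pvb_rel_triple; exact: uniq3.
rewrite (rmorph_bracket f (r i j) (r k l)) !fr.
by apply: pvb_rel_disjoint; exact: uniq4.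
Qed.

Lemma pvbd_rel_act a : pvbd_rel a -> pvbd_rel (relabel gen_act a).
Proof.
have fc (c : gen n -> rat) : relabel gen_act (\sum_g c g *: letter g) =
    \sum_g c (invF gen_act_inj g) *: letter g.
  rewrite linear_sum [RHS](reindex_inj gen_act_inj); apply: eq_bigr => g _.
  by rewrite linearZ invF_f; congr (_ *: _); exact: relabel_letter.
suff H (f : {rmorphism freealg (gen n) -> freealg (gen n)}) :
    (forall i j, f (r i j) = r (s i) (s j)) ->
    (forall c : gen n -> rat, f (\sum_g c g *: letter g) =
      \sum_g c (invF gen_act_inj g) *: letter g) ->
    pvbd_rel a -> pvbd_rel (f a).
  exact: (H (relabel gen_act) relabel_r fc).
move=> fr {}fc.
case=> [c|i j k h|i j k h|i j h].
- by rewrite (rmorphM f (\sum_g c g *: letter g)) fc; exact: pvbd_rel_square.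
- rewrite (rmorph_three f (r i j) (r i k) (r i j) (r j k) (r i k) (r k j)) !fr.
  by apply: pvbd_rel_out; exact: uniq3.
- rewrite (rmorph_three f (r i k) (r j k) (r i j) (r j k) (r j i) (r i k)) !fr.
  by apply: pvbd_rel_in; exact: uniq3.
- rewrite (rmorphM f (r i j) (r j i)) !fr; apply: pvbd_rel_opp.
  by rewrite (inj_eq perm_inj).
Qed.

HB.instance Definition _ := GRing.isZmodMorphism.Build (pvb n) (pvb n) pvb_act
  (qmap_is_zmod_morphism pvb_rel_act).
HB.instance Definition _ := GRing.isMonoidMorphism.Build (pvb n) (pvb n) pvb_act
  (qmap_is_monoid_morphism _ pvb_rel_act).
HB.instance Definition _ := GRing.isScalable.Build rat (pvb n) (pvb n) *:%R
  pvb_act (qmap_is_scalable pvb_rel_act).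

HB.instance Definition _ := GRing.isZmodMorphism.Build (pvbd n) (pvbd n)
  pvbd_act (qmap_is_zmod_morphism pvbd_rel_act).
HB.instance Definition _ := GRing.isMonoidMorphism.Build (pvbd n) (pvbd n)
  pvbd_act (qmap_is_monoid_morphism _ pvbd_rel_act).
HB.instance Definition _ := GRing.isScalable.Build rat (pvbd n) (pvbd n) *:%R
  pvbd_act (qmap_is_scalable pvbd_rel_act).

Lemma pvb_act_r i j : pvb_act (qclass _ (r i j)) = qclass _ (r (s i) (s j)).
Proof. by rewrite -relabel_r; apply: qmapE; exact: pvb_rel_act. Qed.

Lemma pvbd_act_r i j : pvbd_act (qclass _ (r i j)) = qclass _ (r (s i) (s j)).
Proof. by rewrite -relabel_r; apply: qmapE; exact: pvbd_rel_act. Qed.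
End Action.

(* Formal power series in z over Q: f k is the coefficient of z^k. *)
Definition fps := nat -> rat.

Definition fps_one : fps := fun k => (k == 0%N)%:R.

Definition fps_mul (f g : fps) : fps :=
  fun k => \sum_(i < k.+1) f i * g (k - i)%N.

(* The series f(-z). *)
Definition fps_negz (f : fps) : fps := fun k => (-1) ^+ k * f k.

(* The first m coefficients of 1 / f. *)
Fixpoint fps_inv_seq (f : fps) (m : nat) : seq rat :=
  if m is m'.+1 then
    let t := fps_inv_seq f m' in
    rcons t ((f 0%N)^-1 * (fps_one m' - \sum_(i < m') f (m' - i)%N * t`_i))
  else [::].

(* 1 / f, for f with nonzero constant term. *)
Definition fps_inv (f : fps) : fps := fun k => (fps_inv_seq f k.+1)`_k.

Lemma size_fps_inv_seq f m : size (fps_inv_seq f m) = m.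
Proof. by elim: m => //= m IHm; rewrite size_rcons IHm. Qed.

Lemma nth_fps_inv_seq f m k : (k < m)%N -> (fps_inv_seq f m)`_k = fps_inv f k.
Proof.
elim: m => // m IHm; rewrite ltnS leq_eqVlt => /predU1P[->//|km].
by rewrite /= nth_rcons size_fps_inv_seq km IHm.
Qed.

Lemma fps_mul_inv f : f 0%N != 0 -> fps_mul f (fps_inv f) =1 fps_one.
Proof.
move=> f0 k; rewrite /fps_mul (reindex_inj rev_ord_inj) big_ord_recr /=.
rewrite subSS subnn subn0.
have -> : fps_inv f k =
    (f 0%N)^-1 * (fps_one k - \sum_(i < k) f (k - i)%N * fps_inv f i).
  rewrite {1}/fps_inv /= nth_rcons size_fps_inv_seq ltnn eqxx.
  by congr (_ * (_ - _)); apply: eq_bigr => i _; rewrite nth_fps_inv_seq.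
rewrite mulVKf // addrC -[RHS]addr0 -addrA; congr (_ + _).
apply/eqP; rewrite addrC subr_eq0; apply/eqP/eq_bigr => i _.
by rewrite subSS subKn // ltnW.
Qed.

(* Generating series of the traces of s on the graded components. *)
Definition pvb_char (n : nat) (s : 'S_n) : fps :=
  fun k => trace (@pvb_degree n k) (pvb_act s).

Definition pvbd_char (n : nat) (s : 'S_n) : fps :=
  fun k => trace (@pvbd_degree n k) (pvbd_act s).

(* Main.v *)
(* Let A = pvb_n and B = pvb_n^!.  Order the generators by a weight in which
   those with the larger maximal index dominate.  Call two generators adjacent
   if the product of the two in B is not a combination of lighter products;
   then the monomials of the cliques of this graph are a basis of B.  They span
   by rewriting, and they are independent because B maps to exterior algebras,
   one for every total order and equivalence relation on the indices, which
   separate them.  So, up to terms of lower weight, the product of B is that of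
   the quadratic dual of a free partially commutative algebra.
     Let C_p be the annihilator of the relations of A in the dual of the words
   of length p.  The Koszul complex C_p (x) B_q has the differential
   (d F)(u) = sum_g F(g u) g.  Its top weight part has an explicit contracting
   homotopy, and descending on the weight proves exactness.  Everything is
   equivariant, and traces are additive, so that
   sum_q (-1)^q tr(C_(k-q)) tr(B_q) = 0 for k > 0.  Finally C_p and A_p have
   the same trace, as the permutation representation on words is self-dual. *)

From HB Require Import structures.
Require Import Defs.
From mathcomp Require Import all_boot all_order all_algebra.
From mathcomp Require Import fingroup finmap monalg perm boolp.
From mathcomp Require Import zify ring lra.

Set Implicit Arguments.
Unset Strict Implicit.
Unset Printing Implicit Defensive.

Import Order.TTheory GRing.Theory Num.Theory.
Local Open Scope ring_scope.

(** * Exactness of a filtered Koszul complex *)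

(** The obstacle is the factor C_p. The top weight part of a functional that vanishes on the
    relations is invariant under exchanging adjacent neighbours in a word, but subtracting
    boundaries needs the converse: each such invariant function is the top part of some functional
    in C_p. This lifting is not formal. Lifting in one length is deduced from an exactness statement
    that uses lifting in the length before, so that both come out of one induction on the length.
    The homotopy works because the letter that it divides by depends on the commutation class alone
    and hence is the same in all terms of a boundary. Weights, cliques and homotopy depend on the
    order of the indices and are not preserved by S_n; therefore the complex is described a second
    time, as functions from words to B, where the permutation acts, and only exactness is carried
    over. For independence, the coefficient read off in an exterior algebra is that of the product
    of all e_i with i not least in its class. Placing the largest index suitably in the order and in
    the classes then isolates one generator at a time. *)

Section TraceMonoid.
Variables (X : finType) (adj : rel X) (wt : X -> nat).
Hypothesis adj_sym : symmetric adj.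
Hypothesis adj_irr : irreflexive adj.

Definition clique (c : {set X}) :=
  [forall g in c, forall h in c, (g != h) ==> adj g h].

Definition wtw (w : seq X) : nat := (\sum_(g <- w) wt g)%N.
Definition wtc (c : {set X}) : nat := (\sum_(g in c) wt g)%N.

Lemma cliqueP (c : {set X}) : reflect {in c &, forall g h, g != h -> adj g h} (clique c).
Proof.
apply: (iffP forall_inP) => [H g h gc hc gh|H g gc].
  by have /forall_inP/(_ h hc)/implyP := H g gc; apply.
by apply/forall_inP => h hc; apply/implyP; exact: H.
Qed.

Lemma clique_sub (c c' : {set X}) : c \subset c' -> clique c' -> clique c.
Proof.
move=> /subsetP s /cliqueP H; apply/cliqueP => g h gc hc.
by apply: H; exact: s.
Qed.

Lemma cliqueU1 x (c : {set X}) : {in c, forall g, adj g x} -> clique c -> clique (x |: c).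
Proof.
move=> H /cliqueP cl; apply/cliqueP => g h.
case/setU1P=> [->|gc] /setU1P[->|hc] gh.
- by rewrite eqxx in gh.
- by rewrite adj_sym; exact: H.
- exact: H.
- exact: cl.
Qed.

Lemma wtcU1 x (c : {set X}) : x \notin c -> wtc (x |: c) = (wtc c + wt x)%N.
Proof. by move=> xc; rewrite /wtc big_setU1 //= addnC. Qed.

Lemma wtcD1 x (c : {set X}) : x \in c -> (wtc (c :\ x) + wt x)%N = wtc c.
Proof. by move=> xc; rewrite /wtc [RHS](big_setD1 x) //= addnC. Qed.

(** With [adj] read as commutation, the class of [v] under exchanges of adjacent neighbours is an
    element of a free partially commutative monoid, a trace. Here [x] is a left descent of that
    trace: some occurrence of it can be moved to the front. *)
Fixpoint desc (x : X) (v : seq X) :=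
  if v is g :: v' then (g == x) || (adj g x && desc x v') else false.

Lemma desc_mem x v : desc x v -> x \in v.
Proof.
elim: v => //= g v IHv; rewrite inE => /orP[/eqP->|/andP[_ /IHv->]].
  by rewrite eqxx.
by rewrite orbT.
Qed.

Lemma desc_swap x u g h v :
  adj g h -> desc x (u ++ g :: h :: v) = desc x (u ++ h :: g :: v).
Proof.
move=> gh; elim: u => [|a u IHu] /=; last by rewrite IHu.
have [<-|_] := eqVneq g x; first by rewrite [adj h g]adj_sym gh orbT.
have [<-|_] /= := eqVneq h x; first by rewrite gh.
by rewrite andbCA.
Qed.

Definition swapinv T (f : seq X -> T) := forall u v g h,
  adj g h -> f (u ++ g :: h :: v) = f (u ++ h :: g :: v).

Lemma desc_front T (f : seq X -> T) x pre u :
  swapinv f -> desc x u -> f (pre ++ x :: rem x u) = f (pre ++ u).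
Proof.
move=> fi; elim: u pre => //= g u IHu pre.
have [->//|gx /= /andP[ax dx]] := eqVneq g x.
rewrite fi 1?adj_sym //.
by have := IHu (rcons pre g) dx; rewrite !cat_rcons.
Qed.

(** If the deleted letter belongs to the exchanged pair, both deletions leave the same word;
    otherwise the pair survives. So deletion of a first occurrence respects traces, and [hgr]
    preserves [swapinv]. *)
Lemma rem_swap (x : X) u g h v : g != h ->
  rem x (u ++ g :: h :: v) = rem x (u ++ h :: g :: v) \/
  exists u' v', rem x (u ++ g :: h :: v) = u' ++ g :: h :: v' /\
                rem x (u ++ h :: g :: v) = u' ++ h :: g :: v'.
Proof.
move=> gh; elim: u => [|a u [e|[u' [v' [e1 e2]]]]] /=.
- have [gx|gx] := eqVneq g x; have [hx|hx] := eqVneq h x.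
  + by rewrite gx hx eqxx in gh.
  + by left.
  + by left.
  + by right; exists [::], (rem x v).
- by case: eqP => _; [right; exists u, v | left; rewrite e].
- case: eqP => _; right; first by exists u, v.
  by exists (a :: u'), v'; rewrite e1 e2.
Qed.

(** For a clique [c], these are the left descents of the product of [c] followed by [v]: members of
    [c] commute with each other, and any other letter has to pass through all of [c]. *)
Definition ldesc (c : {set X}) v : {set X} :=
  c :|: [set x | desc x v & [forall g in c, adj g x]].

(** Moving [g] from the clique to the front of the word leaves the trace unchanged. This is what
    makes all terms of a boundary of [hgr] pick the same letter. *)
Lemma ldesc_cons (c : {set X}) g u :
  clique c -> g \in c -> ldesc (c :\ g) (g :: u) = ldesc c u.
Proof.
move=> /cliqueP cl gc; apply/setP=> x; rewrite !inE /=.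
have [->|xg] := eqVneq x g.
  rewrite gc ?eqxx /=; apply/forall_inP => h.
  by rewrite !inE => /andP[hg hc]; exact: cl.
rewrite ?[g == x]eq_sym ?(negPf xg) /=; congr (_ || _).
rewrite -andbA andbCA; congr (_ && _).
apply/andP/forall_inP => [[gx /forall_inP H] h hc|H].
  by have [->//|hg] := eqVneq h g; apply: H; rewrite !inE hg.
by split; [exact: H | apply/forall_inP => h /setD1P[_]; exact: H].
Qed.

Lemma ldesc_swap c u g h v :
  adj g h -> ldesc c (u ++ g :: h :: v) = ldesc c (u ++ h :: g :: v).
Proof. by move=> gh; apply/setP=> x; rewrite !inE desc_swap. Qed.

Lemma wtw_rem (x : X) v : x \in v -> wtw v = (wtw (rem x v) + wt x)%N.
Proof.
by move=> xv; rewrite /wtw (perm_big _ (perm_to_rem xv)) big_cons addnC.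
Qed.

(** * The top weight complex and its contraction *)

Variable sgn : {set X} -> X -> rat.
Hypothesis sgn2 : forall (c : {set X}) g, g \notin c -> clique (g |: c) ->
  sgn c g * sgn c g = 1.
Hypothesis sgn_anti : forall (c : {set X}) g h, g != h -> g \notin c -> h \notin c ->
  clique (g |: (h |: c)) ->
  sgn c g * sgn (g |: c) h = - (sgn c h * sgn (h |: c) g).

(* [F w c] is the coefficient of the word [w] tensored with the clique
   monomial [c]. *)
Definition graded (p q : nat) (F : seq X -> {set X} -> rat) :=
  forall w c, F w c != 0 -> [/\ size w = p, clique c & #|c| = q].

Definition dgr (F : seq X -> {set X} -> rat) u (c : {set X}) :=
  \sum_(g in c) sgn (c :\ g) g * F (g :: u) (c :\ g).

(* Right divisions by a left descent of the trace [c v] that is chosen as a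
   function of the trace only; a contracting homotopy for [dgr]. *)
Definition hgr (F : seq X -> {set X} -> rat) v (c : {set X}) :=
  if [pick x in ldesc c v] is Some x then
    if x \in c then 0 else sgn c x * F (rem x v) (x |: c)
  else 0.

Lemma hgr_neq0 F v (c : {set X}) : hgr F v c != 0 -> exists x,
  [/\ x \notin c, x \in v, {in c, forall g, adj g x} &
      F (rem x v) (x |: c) != 0].
Proof.
rewrite /hgr; case: pickP => [x|]; last by rewrite eqxx.
rewrite !inE; case: ifP => [_ _|xc /andP[dx /forall_inP ax]].
  by rewrite eqxx.
rewrite mulf_eq0 negb_or => /andP[_ nz]; exists x; split=> //.
- by rewrite xc.
- exact: desc_mem.
Qed.

Lemma graded_hgr p q F : graded p q.+1 F -> graded p.+1 q (hgr F).
Proof.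
move=> gF v c /hgr_neq0[x [xc xv ax /gF[sz cl cd]]]; split.
- by rewrite -sz size_rem // prednK //; case: v xv {sz}.
- by apply: clique_sub cl; exact: subsetUr.
- by move: cd; rewrite cardsU1 xc => -[].
Qed.

Lemma swapinv_hgr F : (forall c, swapinv (F^~ c)) ->
  forall c, swapinv ((hgr F)^~ c).
Proof.
move=> iF c u v g h gh; rewrite /hgr ldesc_swap //.
case: pickP => // x _; case: ifP => // _; congr (_ * _).
have ghn : g != h by apply: contraTneq gh => ->; rewrite adj_irr.
by case: (rem_swap x u v ghn) => [->//|[u' [v' [-> ->]]]]; exact: iF.
Qed.

Lemma hgr_wt F W :
  (forall w c, F w c != 0 -> (wtw w + wtc c)%N = W) ->
  forall w c, hgr F w c != 0 -> (wtw w + wtc c)%N = W.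
Proof.
move=> hF v c /hgr_neq0[x [xc xv _ /hF <-]].
by rewrite (wtw_rem xv) wtcU1 // -addnA [(wt x + _)%N]addnC.
Qed.

Lemma dgr_hgr F u (c : {set X}) : (forall c, swapinv (F^~ c)) -> clique c -> c != set0 ->
  (forall v (c' : {set X}), clique c' -> #|c'| = #|c|.+1 -> dgr F v c' = 0) ->
  dgr (hgr F) u c = F u c.
Proof.
move=> iF cl c0 dF; rewrite /dgr /hgr.
under eq_bigr => g gc do rewrite ldesc_cons //.
case: pickP => [x xD|D0]; last first.
  by case/set0Pn: c0 => y yc; have := D0 y; rewrite !inE yc.
(* If the chosen letter lies in [c], then for [g] other than [x] it still lies in [c :\ g], where
   [hgr] is zero; only the term of [x] remains, and its sign occurs squared. *)
case xc: (x \in c).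
  rewrite (bigD1 x) //= big1 ?addr0 => [|g /andP[gc gx]]; last first.
    by rewrite !inE eq_sym gx xc mulr0.
  by rewrite !inE eqxx /= mulrA sgn2 ?setD11 ?setD1K // mul1r.
(* Otherwise [x] is a descent of [u]. In the cycle condition at [rem x u] and [x |: c], the term of
   [x] is [F u c] up to sign, by invariance, and the other terms are those of the boundary to be
   computed. *)
move: xD; rewrite !inE xc /= => /andP[dx /forall_inP ax].
have xuc : clique (x |: c) by exact: cliqueU1.
have := dF (rem x u) (x |: c) xuc.
rewrite cardsU1 xc => /(_ erefl).
rewrite /dgr big_setU1 ?xc //= setU1K ?xc //.
have /= -> := desc_front [::] (iF c) dx.
move/eqP; rewrite addr_eq0 => /eqP e.
rewrite -[RHS]mul1r -(@sgn2 c x) ?xc // -mulrA e mulrN mulr_sumr -sumrN.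
apply: eq_bigr => g gc.
have gx : g != x by apply: contraFneq xc => <-.
rewrite !inE [x == g]eq_sym (negPf gx) xc /=.
have -> : x |: c :\ g = (x |: c) :\ g.
  by apply/setP=> y; rewrite !inE; case: (eqVneq y x) => [->|//]; rewrite eq_sym gx.
have -> : sgn c x = sgn (g |: (c :\ g)) x by rewrite setD1K.
have -> : (x |: c) :\ g = x |: (c :\ g).
  by apply/setP=> y; rewrite !inE; case: (eqVneq y x) => [->|//]; rewrite eq_sym gx.
set c' := c :\ g.
have gc' : g \notin c' by rewrite !inE eqxx.
have xc' : x \notin c' by rewrite !inE xc andbF.
have cE : g |: c' = c by exact: setD1K.
have cl' : clique (g |: (x |: c')) by rewrite setUCA cE.
have anti := sgn_anti gx gc' xc' cl'.
have s1 : sgn (g |: c') x * sgn (g |: c') x = 1.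
  by apply: sgn2; rewrite cE ?xc.
have s2 := sgn2 xc' (clique_sub (subsetUr _ _) cl').
rewrite !mulrA -mulNr; congr (_ * _).
rewrite -[LHS]mulr1 -s1 mulrACA mulrA anti.
by rewrite !mulNr -!mulrA [_ * (sgn c' x * _)]mulrCA mulrA; ring: s2.
Qed.

(** [mu c g c'] plays the coefficient of the clique monomial [c'] in the product of the monomial [c]
    with [g]. By [mu_top], multiplication in full weight is exterior multiplication restricted to
    cliques; [mu_rel] says that a relation between pairs of generators holds after multiplication by
    any clique. *)
Variable mu : {set X} -> X -> {set X} -> rat.
Hypothesis mu0 : forall g c', mu set0 g c' = (c' == [set g])%:R.
Hypothesis mu_neq0 : forall c g c', clique c -> mu c g c' != 0 ->
  [/\ clique c', #|c'| = #|c|.+1 & (wtc c' <= wtc c + wt g)%N].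
Hypothesis mu_top : forall (c : {set X}) g c', clique c ->
  wtc c' = (wtc c + wt g)%N ->
  mu c g c' = if [&& g \notin c, clique (g |: c) & c' == g |: c]
              then sgn c g else 0.

(** The combination of products [g h] with coefficients [f g h] vanishes in the dual algebra. By
    orthogonality of the two sets of relations, this also says that the functional [f] kills the
    quadratic relations of the original algebra, which is why [relw] imposes it on every factor of
    length two. *)
Definition rel2 (f : X -> X -> rat) :=
  forall e, \sum_g \sum_h f g h * mu [set g] h e = 0.

Hypothesis mu_rel : forall f c c'', clique c -> rel2 f ->
  \sum_g \sum_h f g h * (\sum_c' mu c g c' * mu c' h c'') = 0.

Definition relw (f : seq X -> rat) :=
  forall u v, rel2 (fun g h => f (u ++ g :: h :: v)).

Definition dmu (F : seq X -> {set X} -> rat) u c' :=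
  \sum_g \sum_c F (g :: u) c * mu c g c'.

(* The functionals on the words of length [p] that vanish on the relations,
   tensored with the degree [q] part: a component of the Koszul complex. *)
Definition kosz p q (F : seq X -> {set X} -> rat) :=
  graded p q F /\ forall c, relw (F^~ c).

Definition wlt W (F : seq X -> {set X} -> rat) :=
  forall w c, F w c != 0 -> (wtw w + wtc c < W)%N.

Definition top W (F : seq X -> {set X} -> rat) w c :=
  if (wtw w + wtc c)%N == W then F w c else 0.

Lemma sum_neq0 (I : finType) (E : I -> rat) :
  \sum_i E i != 0 -> exists i, E i != 0.
Proof.
move=> nz; apply/existsP; apply: contraNT nz => /existsPn E0.
by apply/eqP/big1 => i _; apply/eqP/negPn/E0.
Qed.

Lemma clique1 x : clique [set x].
Proof. by apply/cliqueP => g h /set1P-> /set1P->; rewrite eqxx. Qed.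

Lemma clique0 : clique set0.
Proof. by apply/cliqueP => g h; rewrite inE. Qed.

Lemma wtc1 x : wtc [set x] = wt x.
Proof. by rewrite /wtc big_set1. Qed.

Lemma wtc0 : wtc set0 = 0%N.
Proof. by rewrite /wtc big_set0. Qed.

Lemma wtw_cons g u : wtw (g :: u) = (wt g + wtw u)%N.
Proof. by rewrite /wtw big_cons. Qed.

Lemma wtw_cat u v : wtw (u ++ v) = (wtw u + wtw v)%N.
Proof. by rewrite /wtw big_cat. Qed.

Lemma sgn0 g : sgn set0 g = 1.
Proof.
have := mu_top (c' := [set g]) clique0; rewrite wtc0 wtc1 => /(_ g erefl).
by rewrite setU0 eqxx inE clique1 mu0 eqxx.
Qed.

Lemma dmu_neq0 p q F u c' : graded p q F -> dmu F u c' != 0 -> exists g c,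
  [/\ F (g :: u) c != 0, clique c' , p = (size u).+1, #|c'| = q.+1 &
      (wtc c' <= wtc c + wt g)%N].
Proof.
move=> gF /sum_neq0[g /sum_neq0[c]]; rewrite mulf_eq0 negb_or => /andP[nF nm].
have [<- cc <-] := gF _ _ nF; have [] := mu_neq0 cc nm.
by exists g, c.
Qed.

Lemma kosz_dmu p q F : kosz p.+1 q F -> kosz p q.+1 (dmu F).
Proof.
move=> [gF rF]; split=> [u c' /(dmu_neq0 gF)[g [c [_ ? [->] ->]]]//|].
move=> c' u v e; rewrite /dmu.
transitivity (\sum_k \sum_c mu c k c' *
   (\sum_g \sum_h F (k :: u ++ g :: h :: v) c * mu [set g] h e)); last first.
  apply: big1 => k _; apply: big1 => c _.
  by rewrite (rF c (k :: u) v e) mulr0.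
under eq_bigr => g _ do under eq_bigr => h _ do
  (rewrite mulr_suml; under eq_bigr => k _ do rewrite mulr_suml).
under [RHS]eq_bigr => k _ do under eq_bigr => c _ do
  (rewrite mulr_sumr; under eq_bigr => g _ do rewrite mulr_sumr).
under eq_bigr => g _ do (rewrite exchange_big; under eq_bigr => k _ do
  rewrite exchange_big).
rewrite exchange_big /=; apply: eq_bigr => k _; rewrite exchange_big /=.
apply: eq_bigr => c _; apply: eq_bigr => g _; apply: eq_bigr => h _.
by rewrite -mulrA mulrCA.
Qed.

(** The two applications consume the first two letters of the word; the relation satisfied there,
    multiplied by a clique through [mu_rel], gives zero. *)
Lemma dmuK p q F u c : kosz p q F -> dmu (dmu F) u c = 0.
Proof.
move=> [gF rF]; rewrite /dmu.
transitivity (\sum_c1 \sum_g \sum_h F (g :: h :: u) c1 *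
   (\sum_c' mu c1 g c' * mu c' h c)).
  transitivity (\sum_h \sum_g \sum_c1 \sum_c'
      F (g :: h :: u) c1 * (mu c1 g c' * mu c' h c)).
    apply: eq_bigr => h _; under eq_bigr => c' _ do rewrite mulr_suml.
    rewrite exchange_big; apply: eq_bigr => g _.
    under eq_bigr => c' _ do rewrite mulr_suml.
    rewrite exchange_big; apply: eq_bigr => c1 _; apply: eq_bigr => c' _.
    by rewrite mulrA.
  rewrite exchange_big; under eq_bigr => g _ do rewrite exchange_big.
  rewrite exchange_big; apply: eq_bigr => c1 _; apply: eq_bigr => g _.
  by apply: eq_bigr => h _; rewrite mulr_sumr.
apply: big1 => c1 _; case cc: (clique c1).
  exact: (mu_rel c cc (rF c1 [::] u)).
apply: big1 => g _; apply: big1 => h _.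
case: (eqVneq (F (g :: h :: u) c1) 0) => [->|/gF[_]]; first by rewrite mul0r.
by rewrite cc.
Qed.

(** The relation is tested on the clique formed by [g] and [h]. The weight bound lets only the two
    orderings of this pair contribute, and their structure constants are opposite, so the two values
    of [F] agree. *)
Lemma swapinv_top W F : (forall c, relw (F^~ c)) -> wlt W.+1 F ->
  forall c, swapinv ((top W F)^~ c).
Proof.
move=> rF wF c u v g h gh; rewrite /top !wtw_cat !wtw_cons.
rewrite [(wt h + (wt g + _))%N]addnCA; case: eqP => // eW.
have ghn : g != h by apply: contraTneq gh => ->; rewrite adj_irr.
have hgn : h != g by rewrite eq_sym.
have cl2 : clique (h |: [set g]).
  by apply: cliqueU1 (clique1 _) => y /set1P->.
have w2 : wtc (h |: [set g]) = (wt g + wt h)%N.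
  by rewrite wtcU1 ?inE // wtc1.
have := rF c u v (h |: [set g]); rewrite pair_bigA /=.
rewrite (bigD1 (g, h)) //= (bigD1 (h, g)) /=; last first.
  by rewrite xpair_eqE negb_and hgn.
have zero g' h' : (g', h') != (g, h) -> (g', h') != (h, g) ->
    F (u ++ g' :: h' :: v) c * mu [set g'] h' (h |: [set g]) = 0.
  move=> n1 n2; case: (eqVneq (F (u ++ g' :: h' :: v) c) 0) => [->|nF].
    by rewrite mul0r.
  case: (eqVneq (mu [set g'] h' (h |: [set g])) 0) => [->|nm].
    by rewrite mulr0.
  have [_ _] := mu_neq0 (clique1 _) nm; rewrite w2 wtc1 => le1.
  have := wF _ _ nF; rewrite -eW !wtw_cat !wtw_cons ltnS => le2.
  have e2 : wtc (h |: [set g]) = (wtc [set g'] + wt h')%N.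
    rewrite w2 wtc1; apply/eqP; rewrite eqn_leq le1 /=.
    move: le2; rewrite !addnA -!(addnC (wtc c)) !addnA -!(addnC (wtw v)) !addnA.
    by rewrite -!addnA !leq_add2l.
  move: nm; rewrite (mu_top (clique1 _) e2); case: ifP; last by rewrite eqxx.
  case/and3P; rewrite inE => hg' _ /eqP/setP eS _.
  have := eS h'; have := eS g'; rewrite !inE !eqxx orbT /=.
  move: n1 n2 hg'; rewrite !xpair_eqE => n1 n2 hg'.
  case/orP=> /eqP eg; case/orP=> /eqP eh; subst.
  + by rewrite eqxx in hg'.
  + by rewrite !eqxx in n2.
  + by rewrite !eqxx in n1.
  + by rewrite eqxx in hg'.
rewrite big1 ?addr0 => [|[g' h'] /andP[]]; last exact: zero.
rewrite (mu_top (clique1 g)) ?w2 ?wtc1 // !inE hgn cl2 eqxx /=.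
have -> : h |: [set g] = g |: [set h] by rewrite setUC.
have cl2' : clique (g |: [set h]) by rewrite setUC.
rewrite (mu_top (clique1 h)) ?wtc1; last by rewrite setUC w2 addnC.
rewrite !inE ghn cl2' eqxx /=.
have anti : sgn [set g] h = - sgn [set h] g.
  have := @sgn_anti set0 g h ghn; rewrite !inE !setU0 !sgn0 !mul1r; exact.
rewrite anti mulrN addrC -mulrBl => /eqP; rewrite mulf_eq0 subr_eq0.
case/orP=> [/eqP->//|/eqP s0].
have := @sgn2 [set h] g; rewrite !inE s0 mul0r => /(_ ghn cl2') /eqP.
by rewrite eq_sym oner_eq0.
Qed.

(** Multiplication does not raise the weight, so a contribution in weight [W] forces equality in
    [mu_neq0]; there [mu_top] leaves only the clique [c' :\ g]. *)
Lemma top_dmu p q W F u c' : graded p q F -> wlt W.+1 F -> clique c' ->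
  top W (dmu F) u c' = dgr (top W F) u c'.
Proof.
move=> gF wF cl; rewrite {1}/top; case: eqP => [eW|nW]; last first.
  rewrite /dgr big1 // => g gc; rewrite /top wtw_cons.
  rewrite [(wt g + _)%N]addnC -addnA [(wt g + _)%N]addnC wtcD1 //.
  by move/eqP/negPf: nW => ->; rewrite mulr0.
rewrite /dmu /dgr [RHS]big_mkcond /=; apply: eq_bigr => g _.
have nz c : F (g :: u) c * mu c g c' != 0 -> g \in c' /\ c = c' :\ g.
  rewrite mulf_eq0 negb_or => /andP[nF nm].
  have [_ cc _] := gF _ _ nF; have [_ _ le1] := mu_neq0 cc nm.
  have := wF _ _ nF; rewrite -eW ltnS wtw_cons [(wt g + _)%N]addnC -addnA.
  rewrite leq_add2l [(wt g + _)%N]addnC => le2.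
  have e2 : wtc c' = (wtc c + wt g)%N by apply/eqP; rewrite eqn_leq le1.
  move: nm; rewrite (mu_top cc e2); case: ifP; last by rewrite eqxx.
  by case/and3P=> gc _ /eqP->; rewrite setU11 setU1K.
case: ifP => gc'; last first.
  apply: big1 => c _; apply/eqP; apply: contraFT gc' => /nz[].
  by [].
rewrite (bigD1 (c' :\ g)) //= big1 ?addr0 => [|c nc]; last first.
  by apply/eqP; apply: contraNT nc => /nz[_ ->].
have clg : clique (c' :\ g) by apply: clique_sub cl; exact: subD1set.
rewrite (mu_top clg) ?wtcD1 // setD1K // cl eqxx !inE eqxx /= mulrC.
rewrite /top wtw_cons [(wt g + _)%N]addnC -addnA [(wt g + _)%N]addnC wtcD1 //.
by rewrite eW eqxx.
Qed.

(** The converse of [swapinv_top] for words of length [p]. The offset [k] is the weight of the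
    clique with which the function is tensored, so that one bound [W] covers words and cliques
    together. *)
Definition liftable p := forall k W (f0 : seq X -> rat),
  (forall w, f0 w != 0 -> size w = p /\ (wtw w + k)%N = W) -> swapinv f0 ->
  exists f, [/\ forall w, f w != 0 -> size w = p /\ (wtw w + k <= W)%N,
    forall w, (wtw w + k)%N = W -> f w = f0 w & relw f].

Lemma liftable_kosz p q W F0 : liftable p -> graded p q F0 ->
  (forall c, swapinv (F0^~ c)) ->
  (forall w c, F0 w c != 0 -> (wtw w + wtc c)%N = W) ->
  exists F, [/\ kosz p q F, wlt W.+1 F & forall w c, top W F w c = F0 w c].
Proof.
move=> lp gF iF hF.
have hw c w : F0 w c != 0 -> size w = p /\ (wtw w + wtc c)%N = W.
  by move=> nz; have [sz _ _] := gF w c nz; split=> //; exact: hF.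
(* The coefficient of each clique is lifted separately, with the weight of the clique as offset. *)
have [f hf] := fin_all_exists (fun c => lp (wtc c) W _ (hw c) (iF c)).
exists (fun w c => if clique c && (#|c| == q) then f c w else 0); split.
- split=> [w c|c].
    case: ifP => [/andP[cc /eqP cq]|]; last by rewrite eqxx.
    by have [h _ _] := hf c; case/h.
  case: (clique c && (#|c| == q)); first by have [] := hf c.
  by move=> u v e; apply: big1 => g _; apply: big1 => h _; rewrite mul0r.
- move=> w c; case: ifP => _; last by rewrite eqxx.
  by have [h _ _] := hf c; case/h.
- move=> w c; rewrite /top.
  case: eqP => [eW|nW]; last by apply/esym/eqP; apply/negPn/negP => /hF.
  case: ifP => [_|ncq]; first by have [_ h _] := hf c; exact: h.
  apply/esym/eqP; apply: contraFT ncq => /gF[_ -> ->]; by rewrite eqxx.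
Qed.

Lemma kosz_sub p q F G : kosz p q F -> kosz p q G ->
  kosz p q (fun w c => F w c - G w c).
Proof.
move=> [gF rF] [gG rG]; split=> [w c|c u v e].
  case: (eqVneq (F w c) 0) => [->|/gF//]; rewrite sub0r oppr_eq0; exact: gG.
under eq_bigr => g _ do (under eq_bigr => h _ do rewrite mulrBl;
  rewrite sumrB).
by rewrite sumrB (rF c u v e) (rG c u v e) subrr.
Qed.

Lemma kosz_add p q F G : kosz p q F -> kosz p q G ->
  kosz p q (fun w c => F w c + G w c).
Proof.
move=> kF kG; have k0 : kosz p q (fun w c => 0 - G w c).
  apply: kosz_sub kG; split=> [w c /eqP//|c u v e].
  by apply: big1 => g _; apply: big1 => h _; rewrite mul0r.
have := kosz_sub kF k0; congr (kosz _ _ _).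
by apply/funext => w; apply/funext => c; rewrite sub0r opprK.
Qed.

Lemma dmu_sub F G u c :
  dmu (fun w c => F w c - G w c) u c = dmu F u c - dmu G u c.
Proof.
rewrite /dmu -sumrB; apply: eq_bigr => g _; rewrite -sumrB.
by apply: eq_bigr => c1 _; rewrite mulrBl.
Qed.

Lemma dmu_add F G u c :
  dmu (fun w c => F w c + G w c) u c = dmu F u c + dmu G u c.
Proof.
rewrite /dmu -big_split; apply: eq_bigr => g _; rewrite -big_split.
by apply: eq_bigr => c1 _; rewrite mulrDl.
Qed.

Lemma wlt_dmu p q W F : graded p q F -> wlt W F -> wlt W (dmu F).
Proof.
move=> gF wF u c' /(dmu_neq0 gF)[g [c [/wF lt _ _ _ le]]].
apply: leq_ltn_trans lt; rewrite wtw_cons [(wt g + _)%N]addnC -addnA leq_add2l.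
by rewrite addnC.
Qed.

Lemma wltS W F : wlt W.+1 F -> (forall w c, top W F w c = 0) -> wlt W F.
Proof.
move=> wF tF w c nz; have := wF w c nz; rewrite ltnS leq_eqVlt.
case/predU1P=> // eW; have := tF w c; rewrite /top eW eqxx => e.
by rewrite e eqxx in nz.
Qed.

(* Subtract from a cycle the boundary of a lift of [hgr] of its part of top
   weight. *)
Lemma filtered_exact p q W F : liftable p.+1 -> kosz p q.+1 F -> wlt W F ->
  (forall u c, dmu F u c = 0) ->
  exists G, [/\ kosz p.+1 q G, wlt W G & forall u c, dmu G u c = F u c].
Proof.
move=> lp; elim: W F => [|W IHW] F kF wF dF.
  exists (fun _ _ => 0); split=> [|w c|u c]; first split=> [w c|c u v e].
  - by move/eqP.
  - by apply: big1 => g _; apply: big1 => h _; rewrite mul0r.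
  - by move/eqP.
  rewrite /dmu big1 => [|g _]; last by apply: big1 => c' _; rewrite mul0r.
  by apply/esym/eqP/negPn/negP => /wF.
have [gF rF] := kF; pose F0 := top W F.
have hF0 w c : F0 w c != 0 -> (wtw w + wtc c)%N = W.
  by rewrite /F0 /top; case: (_ =P W) => // _; rewrite eqxx.
have gF0 : graded p q.+1 F0.
  by move=> w c; rewrite /F0 /top; case: (_ =P W) => _; [exact: gF | rewrite eqxx].
have iF0 := swapinv_top rF wF; rewrite -/F0 in iF0.
have [G1 [kG1 wG1 tG1]] := liftable_kosz lp (graded_hgr gF0)
  (swapinv_hgr iF0) (hgr_wt hF0).
have gG1 := kG1.1.
have tE u c : top W (dmu G1) u c = F0 u c.
  have [cc|ncc] := boolP (clique c && (#|c| == q.+1)).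
    have [cl /eqP cq] := andP cc.
    rewrite (top_dmu u gG1 wG1 cl) -(dgr_hgr u iF0 cl) -?card_gt0 ?cq //.
      by apply: eq_bigr => g _; rewrite tG1.
    move=> v c' cl' _; rewrite -(top_dmu v gF wF cl') /top.
    by case: eqP; rewrite ?dF.
  have -> : F0 u c = 0.
    apply/eqP; apply: contraNT ncc => /gF0[_ -> ->]; by rewrite eqxx.
  rewrite /top; case: (_ =P W) => // _; apply/eqP; apply: contraNT ncc.
  by case/(dmu_neq0 gG1)=> g [c1 [_ -> _ ->]]; rewrite eqxx.
have kH := kosz_sub kF (kosz_dmu kG1).
have wH : wlt W (fun u c => F u c - dmu G1 u c).
  apply: wltS => [u c|u c]; last first.
    have := tE u c; rewrite /F0 /top; case: (_ =P W) => // _ ->; exact: subrr.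
  case: (eqVneq (F u c) 0) => [->|/wF//]; rewrite sub0r oppr_eq0.
  exact: wlt_dmu gG1 wG1 _ _.
have dH u c : dmu (fun u c => F u c - dmu G1 u c) u c = 0.
  by rewrite dmu_sub dF (dmuK _ _ kG1) subr0.
have [G2 [kG2 wG2 dG2]] := IHW _ kH wH dH.
exists (fun w c => G1 w c + G2 w c); split; first exact: kosz_add.
  move=> w c; case: (eqVneq (G1 w c) 0) => [->|/wG1//]; rewrite add0r => /wG2.
  exact: ltnW.
by move=> u c; rewrite dmu_add dG2 addrC subrK.
Qed.

Lemma sum_set1 (E : {set X} -> rat) :
  (forall c, E c != 0 -> #|c| = 1%N) -> \sum_c E c = \sum_x E [set x].
Proof.
move=> hE; rewrite (bigID (fun c : {set X} => #|c| == 1%N)) /= [X in _ + X]big1 ?addr0.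
  rewrite -(big_imset E (h := set1) (A := predT)) => [|x y _ _ /set1_inj//].
  apply: eq_bigl => c; apply/cards1P/imsetP => [[x ->]|[x _ ->]]; first by exists x.
  by exists x.
by move=> c; apply: contraNeq => /hE ->.
Qed.

(* The boundary of a first lift of [f0] has a vanishing top part and is a
   cycle, hence bounds something of lower weight. *)
Lemma liftableS p : liftable p -> liftable p.+1.
Proof.
case: p => [_|p lp] k W f0 hf0 if0.
  exists f0; split=> // [w /hf0[-> ->]//|u v e].
  apply: big1 => g _; apply: big1 => h _.
  case: (eqVneq (f0 (u ++ g :: h :: v)) 0) => [->|/hf0[]].
    by rewrite mul0r.
  by rewrite size_cat /= !addnS.
(* The difference [W - k] below is truncated; when [k] exceeds [W] the weight condition leaves only
   the zero function. *)
have [kW|Wk] := leqP k W; last first.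
  have f00 w : f0 w = 0.
    apply/eqP/negPn/negP => /hf0[_ e].
    by have := leq_addl (wtw w) k; rewrite e leqNgt Wk.
  exists f0; split=> // [w|u v e]; first by rewrite f00 eqxx.
  by apply: big1 => g _; apply: big1 => h _; rewrite f00 mul0r.
(* The first letter moves into the clique slot: words become one letter shorter, and the dual degree
   becomes one. *)
pose F0 u (c : {set X}) := \sum_x (c == [set x])%:R * f0 (x :: u).
have F0E u x : F0 u [set x] = f0 (x :: u).
  rewrite /F0 (bigD1 x) //= eqxx mul1r big1 ?addr0 // => y yx.
  by rewrite (inj_eq set1_inj) eq_sym (negPf yx) mul0r.
have F0nz u c : F0 u c != 0 -> exists2 x, c = [set x] & f0 (x :: u) != 0.
  case/sum_neq0=> x; case: (c =P _) => [->|_]; last by rewrite mul0r eqxx.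
  by rewrite mul1r; exists x.
have gF0 : graded p.+1 1 F0.
  move=> u c /F0nz[x -> /hf0[[<-] _]]; split=> //; first exact: clique1.
  by rewrite cards1.
have iF0 c : swapinv (F0^~ c).
  move=> u v g h gh; apply: eq_bigr => x _; congr (_ * _).
  exact: (if0 (x :: u)).
have hF0 u c : F0 u c != 0 -> (wtw u + wtc c)%N = (W - k)%N.
  case/F0nz=> x -> /hf0[_ <-]; rewrite addnK wtc1 wtw_cons; exact: addnC.
have [F1 [kF1 wF1 tF1]] := liftable_kosz lp gF0 iF0 hF0.
have kH := kosz_dmu kF1.
have wH : wlt (W - k) (dmu F1).
  apply: wltS => [|u c]; first exact: wlt_dmu kF1.1 wF1.
  have [/andP[cl /eqP c2]|ncc] := boolP (clique c && (#|c| == 2%N)); last first.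
    rewrite /top; case: (_ =P _) => // _; apply/eqP; apply: contraNT ncc.
    by case/(dmu_neq0 kF1.1)=> g [c1 [_ -> _ ->]]; rewrite eqxx.
  rewrite (top_dmu u kF1.1 wF1 cl) /dgr; under eq_bigr do rewrite tF1.
  have /cards2P[g [h [gh cE]]] := introT eqP c2.
  have hg : h != g by rewrite eq_sym.
  have adjgh : adj g h by move/cliqueP: cl; apply=> //; rewrite cE !inE eqxx ?orbT.
  have gc : c :\ g = [set h].
    by apply/setP=> x; rewrite cE !inE; case: eqVneq => // ->; rewrite (negPf gh).
  have hc : c :\ h = [set g].
    apply/setP=> x; rewrite cE !inE andbC; case: eqVneq => [->|_] //=.
    by case: eqVneq.
  rewrite cE big_setU1 ?inE //= big_set1 -cE gc hc !F0E.
  have -> : f0 [:: h, g & u] = f0 [:: g, h & u].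
    by apply: (if0 [::]); rewrite adj_sym.
  have := @sgn_anti set0 g h gh; rewrite !inE !setU0 !sgn0 !mul1r.
  rewrite -cE => /(_ erefl erefl cl) ->; rewrite mulNr; exact: subrr.
have [K [kK wK dK]] := filtered_exact lp kH wH (fun u c => dmuK u c kF1).
have kF := kosz_sub kF1 kK.
have dF u c : dmu (fun w c => F1 w c - K w c) u c = 0.
  by rewrite dmu_sub dK subrr.
pose F w c := F1 w c - K w c; rewrite -/F in kF dF.
exists (fun w => if w is x :: u then F u [set x] else 0); split.
- case=> [|x u]; first by rewrite eqxx.
  move=> nz; have [/= -> _ _] := kF.1 _ _ nz; split=> //.
  suff le1 : (wtw u + wt x <= W - k)%N.
    by rewrite -(subnK kW) leq_add2r wtw_cons addnC.
  move: nz; rewrite /F -(wtc1 x); case: (eqVneq (F1 u [set x]) 0) => [->|/wF1//].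
  by rewrite sub0r oppr_eq0 => /wK/ltnW.
- case=> [|x u] eW.
    by apply/esym/eqP/negPn/negP => /hf0[].
  have eW' : (wtw u + wtc [set x])%N = (W - k)%N.
    by rewrite -eW addnK wtc1 wtw_cons addnC.
  have := tF1 u [set x]; rewrite /top eW' eqxx F0E /F => ->.
  have -> : K u [set x] = 0; last exact: subr0.
  by apply/eqP/negPn/negP => /wK; rewrite eW' ltnn.
(* Relations beyond the first letter hold because [F] lies in the complex; the relation at the first
   two letters is the vanishing of the differential of [F]. *)
- case=> [|x u] v e; last exact: (kF.2 [set x] u v e).
  rewrite -[RHS](dF v e) /dmu exchange_big /=; apply: eq_bigr => h _.
  rewrite (sum_set1 (E := fun c => F (h :: v) c * mu c h e)) // => c.
  by rewrite mulf_eq0 negb_or => /andP[/kF.1[]].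
Qed.

Lemma liftable_all p : liftable p.
Proof.
elim: p => [|p]; last exact: liftableS.
move=> k W f0 hf0 if0; exists f0; split=> // [w /hf0[-> ->]//|u v e].
apply: big1 => g _; apply: big1 => h _.
case: (eqVneq (f0 (u ++ g :: h :: v)) 0) => [->|/hf0[]].
  by rewrite mul0r.
by rewrite size_cat /= !addnS.
Qed.

Theorem kosz_exact p q F : kosz p q.+1 F -> (forall u c, dmu F u c = 0) ->
  exists2 G, kosz p.+1 q G & forall u c, dmu G u c = F u c.
Proof.
(* A crude bound starts the descent: each of the [p] letters has at most the maximal weight, and a
   clique weighs at most as much as all generators together. *)
move=> kF dF; have wF : wlt (p * (\max_x wt x) + wtc setT).+1 F.
  move=> w c /kF.1[<- _ _]; rewrite ltnS; apply: leq_add.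
    elim: w => [|x w IHw]; first by rewrite /wtw big_nil.
    by rewrite wtw_cons mulSn leq_add // leq_bigmax.
  by rewrite /wtc [leqRHS](big_setID c) /= setTI leq_addr.
by have [G [kG _ dG]] := filtered_exact (@liftable_all p.+1) kF wF dF; exists G.
Qed.
End TraceMonoid.

(** * Traces on subspaces *)

Section FamilyBasis.
Variables (F : fieldType) (V : lmodType F).
Implicit Types (U : V -> Prop) (f : V -> V).

Definition subspace U := U 0 /\ forall a u v, U u -> U v -> U (a *: u + v).

Lemma subspaceZ U a u : subspace U -> U u -> U (a *: u).
Proof. by move=> [U0 UD] Uu; rewrite -[_ *: _]addr0; exact: UD. Qed.

Lemma subspaceD U u v : subspace U -> U u -> U v -> U (u + v).
Proof. by move=> [_ UD] Uu; rewrite -[u]scale1r; exact: UD. Qed.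

Lemma subspaceB U u v : subspace U -> U u -> U v -> U (u - v).
Proof.
by move=> sU Uu Uv; apply: subspaceD => //; rewrite -scaleN1r; exact: subspaceZ.
Qed.

Lemma subspace_sum U (I : finType) (c : I -> F) (b : I -> V) :
  subspace U -> (forall i, U (b i)) -> U (\sum_i c i *: b i).
Proof.
move=> sU Ub; elim/big_ind: _ => [|x y|i _]; first exact: sU.1.
  exact: subspaceD.
exact: subspaceZ.
Qed.

Definition free_family (I : finType) (b : I -> V) :=
  forall c : I -> F, \sum_i c i *: b i = 0 -> forall i, c i = 0.

Definition family_basis (I : finType) U (b : I -> V) :=
  free_family b /\ forall v, U v <-> exists c : I -> F, v = \sum_i c i *: b i.

Lemma family_basis_mem (I : finType) U (b : I -> V) i :
  family_basis U b -> U (b i).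
Proof.
move=> [_ bU]; apply/bU; exists (fun j => (j == i)%:R).
rewrite (bigD1 i) //= eqxx scale1r big1 ?addr0 // => j /negPf->.
by rewrite scale0r.
Qed.

Lemma family_basis_trace (I : finType) U f (b : I -> V) (M : I -> I -> F) :
  family_basis U b -> (forall j, f (b j) = \sum_i M i j *: b i) ->
  is_trace U f (\sum_i M i i).
Proof.
move=> [bf bU] bM; exists #|I|, (b \o enum_val).
exists (\matrix_(i, j) M (enum_val i) (enum_val j)).
have reidx (E : I -> V) : \sum_i E i = \sum_(k < #|I|) E (enum_val k).
  exact: (reindex _ (onW_bij _ (@enum_val_bij I))).
split=> [|j|].
- split=> [c c0 i|v].
    rewrite -[i]enum_valK; apply: (bf (c \o enum_rank)).
    by rewrite reidx -[RHS]c0; apply: eq_bigr => k _; rewrite /= enum_valK.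
  rewrite bU; split=> [[c ->]|[c ->]]; first by exists (c \o enum_val); rewrite reidx.
  exists (c \o enum_rank); rewrite reidx.
  by apply: eq_bigr => k _; rewrite /= enum_valK.
- by rewrite /= bM reidx; apply: eq_bigr => i _; rewrite mxE.
- rewrite /mxtrace (reindex _ (onW_bij _ (@enum_val_bij I))).
  by apply: eq_bigr => i _; rewrite mxE.
Qed.

Lemma free_family_leq (I : finType) (b : I -> V) m (e : 'I_m -> V) :
  free_family b -> (forall i, exists c : 'I_m -> F, b i = \sum_j c j *: e j) ->
  (#|I| <= m)%N.
Proof.
move=> bf /fin_all_exists[c bE].
pose A : 'M[F]_(#|I|, m) := \matrix_(i, j) c (enum_val i) j.
rewrite leqNgt; apply/negP => ltm.
have : kermx A != 0.
  rewrite kermx_eq0 /row_free neq_ltn; apply/orP; left.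
  exact: leq_ltn_trans (rank_leq_col _) ltm.
case/rowV0Pn=> v /sub_kermxP vA /eqP[].
apply/rowP => i; rewrite mxE -[i]enum_valK.
apply: (bf (fun x => v 0 (enum_rank x))).
rewrite (reindex_omap enum_val (fun x => Some (enum_rank x))) => [|x _]; last first.
  by rewrite /= enum_rankK.
under eq_bigl => j do rewrite enum_valK eqxx.
under eq_bigr => j _ do rewrite enum_valK bE scaler_sumr.
rewrite exchange_big big1 //= => k _.
under eq_bigr => j _ do rewrite scalerA.
rewrite -scaler_suml; have /rowP/(_ k) := vA; rewrite !mxE => vAk.
rewrite (_ : \sum_j _ = 0) ?scale0r // -[RHS]vAk.
by apply: eq_bigr => j _; rewrite mxE.
Qed.

Definition fin_spanned U :=
  exists m (e : 'I_m -> V), forall u, U u -> exists c : 'I_m -> F,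
    u = \sum_i c i *: e i.

Lemma subspace_basis U : subspace U -> fin_spanned U ->
  exists (I : finType) (b : I -> V), family_basis U b.
Proof.
move=> sU [m [e eU]].
(* [d] bounds the number of vectors that can still be adjoined, since a free family has at most [m]
   members. *)
suff ext d (I : finType) (b : I -> V) : (m < #|I| + d)%N ->
    free_family b -> (forall i, U (b i)) ->
    exists (I : finType) (b : I -> V), family_basis U b.
  by apply: (ext m.+1 void (fun=> 0)); rewrite ?leq_addl // => ? _ [].
elim: d I b => [|d IHd] I b led bf Ub.
  have := free_family_leq bf (fun i => eU _ (Ub i)).
  by rewrite leqNgt -[#|I|]addn0 led.
have [sp|/existsNP[v /not_implyP[Uv nv]]] :=
    pselect (forall v, U v -> exists c : I -> F, v = \sum_i c i *: b i).
  exists I, b; split=> // v; split=> [|[c ->]]; first exact: sp.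
  exact: subspace_sum.
pose b' (i : I + 'I_1) := if i is inl j then b j else v.
apply: (IHd _ b') => [||[]] //; first by rewrite card_sum card_ord addn1 addSnnS.
move=> c; rewrite big_sumType /= big_ord1 => c0.
have cv : c (inr ord0) = 0.
  apply: contrapT => /eqP nz; apply: nv.
  exists (fun i => - (c (inr ord0))^-1 * c (inl i)).
  under eq_bigr => i _ do rewrite -scalerA.
  rewrite -scaler_sumr -[v in LHS]scale1r -(mulVf nz) -scalerA scaleNr -scalerN.
  by congr (_ *: _); apply/eqP; rewrite -addr_eq0 addrC c0.
move: c0; rewrite cv scale0r addr0 => /(bf (c \o inl)) c0 [i|i]; first exact: c0.
by rewrite (ord1 i).
Qed.

Lemma is_trace_ex U f : subspace U -> fin_spanned U ->
  (forall u, U u -> U (f u)) -> exists t, is_trace U f t.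
Proof.
move=> sU fU Uf; have [I [b bb]] := subspace_basis sU fU.
have /fin_all_exists[M MP] j : exists c : I -> F, f (b j) = \sum_i c i *: b i.
  by apply/bb.2/Uf; exact: family_basis_mem bb.
exists (\sum_i M i i); exact: (family_basis_trace (M := fun i j => M j i) bb).
Qed.

(** The family [e] represents a basis of the quotient of [U] by [K], and [M] is the matrix induced
    there. Joined to a basis of [K], it makes the matrix of [f] block triangular. *)
Lemma is_trace_ext U K f t1 l (e : 'I_l -> V) (M : 'M[F]_l) :
  is_trace K f t1 -> subspace U -> (forall v, K v -> U v) ->
  (forall j, U (e j)) -> (forall j, K (f (e j) - \sum_i M i j *: e i)) ->
  (forall d : 'I_l -> F, K (\sum_i d i *: e i) -> forall i, d i = 0) ->
  (forall u, U u -> exists d : 'I_l -> F, K (u - \sum_i d i *: e i)) ->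
  is_trace U f (t1 + \tr M).
Proof.
move=> [k [b [N [[bf bK] bN ->]]]] sU KU Ue eM eK eU.
have K0 : K 0 by apply/bK; exists (fun=> 0); rewrite big1 // => i; rewrite scale0r.
have /fin_all_exists[P hP] j : exists c : 'I_k -> F,
  f (e j) - \sum_i M i j *: e i = \sum_i c i *: b i by exact/bK.
pose be (i : 'I_k + 'I_l) := match i with inl i => b i | inr j => e j end.
pose Q (i j : 'I_k + 'I_l) := match i, j with
  | inl i, inl j => N i j | inl i, inr j => P j i
  | inr _, inl _ => 0 | inr i, inr j => M i j end.
have <- : \sum_i Q i i = \tr N + \tr M by rewrite big_sumType.
apply: (@family_basis_trace _ U f be Q) => [|[j|j]]; last 2 first.
- rewrite bN big_sumType /= [X in _ + X]big1 ?addr0 // => i _.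
  by rewrite scale0r.
- by rewrite big_sumType /= -hP subrK.
split=> [c|v].
  rewrite big_sumType /= => c0.
  have cr : forall j, c (inr j) = 0.
    apply: (eK (fun j => c (inr j))); apply/bK.
    exists (fun i => - c (inl i)).
    under [RHS]eq_bigr do rewrite scaleNr.
    by rewrite sumrN; apply/eqP; rewrite -addr_eq0 addrC c0.
  move: c0; rewrite [X in _ + X]big1 ?addr0 => [/(bf (c \o inl)) cl [|//]|j _].
    exact: cl.
  by rewrite cr scale0r.
split=> [/eU[d /bK[c vE]]|[c ->]].
  exists (fun i => match i with inl i => c i | inr j => d j end).
  by rewrite big_sumType /= -vE subrK.
apply: subspace_sum => // -[i|j] //=; apply: KU.
exact: (family_basis_mem i (conj bf bK)).
Qed.
End FamilyBasis.

Lemma is_trace_exact (F : fieldType) (V V' : lmodType F) (U : V -> Prop)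
    (f : V -> V) (p : {linear V -> V'}) (g : V' -> V') (t1 t2 : F) :
  subspace U -> (forall u, U u -> p (f u) = g (p u)) ->
  is_trace (fun u => U u /\ p u = 0) f t1 ->
  is_trace (fun w => exists2 u, U u & p u = w) g t2 ->
  (forall u, U u -> U (f u)) ->
  is_trace U f (t1 + t2).
Proof.
move=> sU pf t1P [l [e [M [eb eM ->]]]] Uf.
have /fin_all_exists2[e' Ue' pe'] j : exists2 u, U u & p u = e j.
  exact: (family_basis_mem j eb).
have pE (d : 'I_l -> F) : p (\sum_i d i *: e' i) = \sum_i d i *: e i.
  by rewrite linear_sum; apply: eq_bigr => i _; rewrite linearZ /= pe'.
apply: (is_trace_ext t1P sU (e := e')) => // [v []//|j|d [_]|u Uu].
- split; last by rewrite linearB /= pE pf // pe' eM subrr.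
  by apply: subspaceB => //; [exact: Uf | exact: subspace_sum].
- by rewrite pE; exact: eb.1.
- have [d dE] : exists d : 'I_l -> F, p u = \sum_i d i *: e i.
    by apply/(eb.2 (p u)); exists u.
  exists d; split; last by rewrite linearB /= pE dE subrr.
  by apply: subspaceB => //; exact: subspace_sum.
Qed.

Lemma is_trace_direct (F : fieldType) (V : lmodType F) (K W U : V -> Prop)
    (f : V -> V) (t1 t2 : F) :
  subspace U -> (forall v, K v -> W v -> v = 0) ->
  (forall u, U u <-> exists v w, [/\ K v, W w & u = v + w]) ->
  subspace K -> subspace W ->
  is_trace K f t1 -> is_trace W f t2 -> is_trace U f (t1 + t2).
Proof.
move=> sU KW UE sK sW t1P [l [e [M [eb eM ->]]]].
have eW := eb.2.
have We j : W (e j) by exact: (family_basis_mem j eb).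
apply: (is_trace_ext t1P sU (e := e)) => // [v Kv|j|j|d Kd|u /UE[v [w [Kv /eW[d ->] ->]]]].
- by apply/UE; exists v, 0; rewrite addr0; split=> //; exact: sW.1.
- by apply/UE; exists 0, (e j); rewrite add0r; split=> //; exact: sK.1.
- by rewrite eM subrr; exact: sK.1.
- by apply: eb.1; apply: KW => //; exact: subspace_sum.
- by exists d; rewrite addrK.
Qed.

(** * Annihilators, tensor products and orthogonal complements *)

Section Words.
Variables (F : fieldType) (T : finType) (V : lmodType F).

Definition annih (Phi : {ffun T -> F^o} -> Prop) (W : lmodType F) (h : {ffun T -> W}) :=
  forall a, Phi a -> \sum_w (a w : F) *: h w = 0.

(** A model of the tensor product of the scalar annihilator of [Phi] with [B], as functions with
    values in [B]; [is_trace_tensor] exhibits the product basis. *)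
Definition annih_in Phi (B : V -> Prop) (h : {ffun T -> V}) :=
  (forall w, B (h w)) /\ annih Phi h.

Lemma annih_subspace Phi (W : lmodType F) : subspace (@annih Phi W).
Proof.
split=> [a _|c u v au av a Pa]; first by rewrite big1 // => w _; rewrite ffunE scaler0.
transitivity (c *: (\sum_w (a w : F) *: u w) + \sum_w (a w : F) *: v w).
  rewrite scaler_sumr -big_split /=; apply: eq_bigr => w _.
  by rewrite !ffunE scalerDr !scalerA mulrC.
by rewrite au // av // scaler0 addr0.
Qed.

Lemma is_trace_tensor Phi (B : V -> Prop) (rho : T -> T) (g : {linear V -> V}) s t :
  is_trace (@annih Phi F^o) (fun h => [ffun w => h (rho w)]) s ->
  is_trace B g t ->
  is_trace (annih_in Phi B) (fun h => [ffun w => g (h (rho w))]) (s * t).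
Proof.
move=> [k [a [M [[af aU] aM ->]]]] [l [b [N [[bf bU] bN ->]]]].
pose ab (x : 'I_k * 'I_l) : {ffun T -> V} := [ffun w => (a x.1 w : F) *: b x.2].
pose MN (x y : 'I_k * 'I_l) := M x.1 y.1 * N x.2 y.2.
have -> : \tr M * \tr N = \sum_x MN x x.
  by rewrite /mxtrace mulr_suml -(pair_bigA _ (fun i j => MN (i, j) (i, j))) /=;
     apply: eq_bigr => i _; rewrite mulr_sumr.
have sumE (I : finType) (c : I -> F) (W : lmodType F) (e : I -> {ffun T -> W}) w :
    (\sum_i c i *: e i) w = \sum_i c i *: e i w.
  by rewrite sum_ffunE; apply: eq_bigr => i _; rewrite ffunE.
have abE (c : 'I_k * 'I_l -> F) w : (\sum_x c x *: ab x) w =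
    \sum_j (\sum_i c (i, j) *: (a i w : F^o)) *: b j.
  rewrite sumE; transitivity (\sum_i \sum_j c (i, j) *: ab (i, j) w).
    by rewrite pair_bigA; apply: eq_bigr => -[].
  rewrite exchange_big /=.
  apply: eq_bigr => j _; rewrite scaler_suml; apply: eq_bigr => i _.
  by rewrite ffunE scalerA.
apply: (family_basis_trace (b := ab)) => [|[i j]].
  split=> [c c0 [i j]|h].
    apply: (af (fun i => c (i, j))); apply/ffunP => w; rewrite sumE ffunE.
    apply: (bf (fun j => \sum_i c (i, j) *: (a i w : F^o))).
    by rewrite -abE c0 ffunE.
  split=> [[hB ha]|[c ->]].
    have /fin_all_exists[d dE] w : exists d : 'I_l -> F, h w = \sum_j d j *: b j.
      exact/bU.
    (* Since [b] is free, a vector valued function kills [Phi] only if each of its coordinates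
       does. *)
    have dA j : annih Phi [ffun w => d w j : F^o].
      move=> x Px; apply: (bf (fun j => \sum_w (x w : F) *: ([ffun w => d w j : F^o] w))).
      rewrite -[RHS](ha _ Px); under [LHS]eq_bigr do rewrite scaler_suml.
      rewrite exchange_big /=; apply: eq_bigr => w _.
      rewrite dE scaler_sumr; apply: eq_bigr => j' _.
      by rewrite ffunE scalerA.
    have /fin_all_exists[c cE] j : exists c : 'I_k -> F,
        [ffun w => d w j : F^o] = \sum_i c i *: a i by exact/aU/dA.
    exists (fun x => c x.2 x.1); apply/ffunP => w; rewrite abE dE.
    apply: eq_bigr => j _; congr (_ *: _).
    by have /ffunP/(_ w) := cE j; rewrite ffunE sumE.
  split=> [w|x Px].
    rewrite abE; apply/bU.
    by exists (fun j => \sum_i c (i, j) *: (a i w : F^o)).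
  under eq_bigr do rewrite abE scaler_sumr.
  rewrite exchange_big big1 //= => j _.
  have aA : annih Phi (\sum_i c (i, j) *: a i) by apply/aU; exists (fun i => c (i, j)).
  transitivity ((\sum_w (x w : F) *: (\sum_i c (i, j) *: a i) w) *: b j).
    rewrite scaler_suml; apply: eq_bigr => w _.
    by rewrite sumE -scalerA.
  by rewrite aA // scale0r.
apply/ffunP => w; rewrite ffunE abE ffunE linearZ /= bN scaler_sumr.
apply: eq_bigr => j' _; rewrite scalerA; congr (_ *: _).
have /ffunP/(_ (w)) := aM i; rewrite ffunE sumE => ->.
rewrite mulr_suml; apply: eq_bigr => i' _; rewrite /MN /=.
by rewrite mulrAC.
Qed.
End Words.

Lemma ffun_spanned (T : finType) (U : {ffun T -> rat^o} -> Prop) : fin_spanned U.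
Proof.
exists #|T|, (fun i => [ffun w => (w == enum_val i)%:R]) => u _.
exists (fun i => u (enum_val i)); apply/ffunP => w; rewrite sum_ffunE.
rewrite (bigD1 (enum_rank w)) //= big1 ?addr0 => [|i ni].
  by rewrite !ffunE enum_rankK eqxx; exact/esym/mulr1.
rewrite !ffunE; case: eqP => [e|_]; last exact: mulr0.
by rewrite e enum_valK eqxx in ni.
Qed.

(** A vector orthogonal to itself is zero, because a rational sum of squares vanishes only
    termwise. *)
Lemma annih_disjoint (T : finType) (K : {ffun T -> rat^o} -> Prop) v :
  K v -> annih K v -> v = 0.
Proof.
move=> Kv /(_ _ Kv) v0; apply/ffunP => t; rewrite ffunE.
apply/eqP; rewrite -[_ == 0]sqrf_eq0 expr2; apply/eqP.
have /psumr_eq0P := v0; apply=> // u _; exact: sqr_ge0.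
Qed.

(** Orthogonal projection to [K]: positivity of the standard form makes the Gram matrix of a basis
    invertible, and its inverse gives the coordinates of the projection. *)
Lemma annih_complement (T : finType) (K : {ffun T -> rat^o} -> Prop)
    (h : {ffun T -> rat^o}) : subspace K ->
  exists v w, [/\ K v, annih K (w : {ffun T -> rat^o}) & h = v + w].
Proof.
move=> sK.
have [I [b [bf bU]]] := subspace_basis sK (ffun_spanned K).
have Kb i : K (b i) by exact: (family_basis_mem i (conj bf bU)).
pose ip (x y : {ffun T -> rat^o}) : rat := \sum_w (x w : rat) * y w.
have sumE (c : I -> rat) w : (\sum_i c i *: b i) w = \sum_i c i * b i w.
  by rewrite sum_ffunE; apply: eq_bigr => i _; rewrite ffunE.
have ipD (c : I -> rat) y : ip (\sum_i c i *: b i) y = \sum_i c i * ip (b i) y.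
  rewrite /ip; under eq_bigr do rewrite sumE mulr_suml.
  rewrite exchange_big; apply: eq_bigr => i _; rewrite mulr_sumr.
  by apply: eq_bigr => w _; rewrite mulrA.
have ipC x y : ip x y = ip y x by apply: eq_bigr => w _; rewrite mulrC.
pose G : 'M[rat]_#|I| := \matrix_(i, j) ip (b (enum_val i)) (b (enum_val j)).
have Gu : G \in unitmx.
  rewrite -row_free_unit -kermx_eq0; apply/rowV0P => v /sub_kermxP vG.
  pose x := \sum_i v 0 (enum_rank i) *: b i.
  have xb i : ip x (b i) = 0.
    have /rowP/(_ (enum_rank i)) := vG; rewrite !mxE => <-; rewrite ipD.
    rewrite (reindex _ (onW_bij _ (@enum_val_bij I))).
    by apply: eq_bigr => j _; rewrite mxE !enum_rankK enum_valK.
  have x0 : ip x x = 0.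
    by rewrite {1}/x ipD big1 // => i _; rewrite ipC xb mulr0.
  have : x = 0.
    apply/ffunP => w; rewrite [RHS]ffunE; apply/eqP; rewrite -sqrf_eq0 expr2.
    have /psumr_eq0P := x0; move=> /(_ (fun w _ => sqr_ge0 (x w : rat))).
    by move=> /(_ w erefl)/eqP.
  move/bf => c0; apply/rowP => i; rewrite mxE -[i]enum_valK; exact: c0.
pose y : 'rV[rat]_#|I| := \row_j ip h (b (enum_val j)).
pose v := \sum_i (y *m invmx G) 0 (enum_rank i) *: b i.
exists v, (h - v); split; last by rewrite addrC subrK.
  by apply/bU; exists (fun i => (y *m invmx G) 0 (enum_rank i)).
move=> a /bU[c ->]; rewrite -/(ip _ _) ipD big1 // => i _.
have -> : ip (b i) (h - v) = 0; last exact: mulr0.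
rewrite ipC.
have -> : ip (h - v) (b i) = ip h (b i) - ip v (b i).
  by rewrite /ip -sumrB; apply: eq_bigr => w _; rewrite !ffunE mulrBl.
apply/eqP; rewrite subr_eq0; apply/eqP.
have <- : (y *m invmx G *m G) 0 (enum_rank i) = ip h (b i).
  by rewrite mulmxKV // /y mxE enum_rankK.
rewrite mxE /v ipD (reindex _ (onW_bij _ (@enum_val_bij I))).
by apply: eq_bigr => j _; rewrite [G _ _]mxE enum_rankK enum_valK.
Qed.

(** * Linear maps on the free algebra *)

(* Locked: unification of distinct words would unfold them to finitely
   supported functions. *)
HB.lock Definition word (X : choiceType) (w : seq X) : freealg X := << FMonom w >>.

Section LinearExtension.
Variables (X : choiceType) (M : lmodType rat).
Implicit Types (a b : freealg X) (u v w : seq X).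

Lemma word_nil : word ([::] : seq X) = 1.
Proof. by rewrite word.unlock -fmoneE. Qed.

Lemma wordE (x : X) : word [:: x] = letter x.
Proof. by rewrite word.unlock /letter fmuE. Qed.

Lemma word_cat u v : word (u ++ v) = word u * word v.
Proof. rewrite word.unlock malgM_def fgmulUU mulr1; congr (<< _ >>).
by apply/eqP; rewrite -val_eqE /= fmM. Qed.

Lemma mcoeff_word w (k : {fmonom X}) : (word w)@_k = (FMonom w == k)%:R.
Proof. by rewrite word.unlock; exact: mcoeffU1. Qed.

Lemma freealg_words a : a = \sum_(w <- msupp a) a@_w *: word w.
Proof.
rewrite {1}[a]monalgE; apply: eq_bigr => w _; rewrite word.unlock fmK.
apply/malgP => k; rewrite mcoeffZ mcoeffU mcoeffU1.
by case: eqP; rewrite ?mulr1 ?mulr0 ?mulr1n.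
Qed.

Definition lin (h : seq X -> M) a : M := \sum_(w <- msupp a) a@_w *: h w.

Variable h : seq X -> M.

Lemma linEw a (d : {fset {fmonom X}}) : (msupp a `<=` d)%fset ->
  lin h a = \sum_(w <- d) a@_w *: h w.
Proof.
move=> ad; apply: big_fset_incl => // w _ /mcoeff_outdom ->.
by rewrite scale0r.
Qed.

Fact lin_is_zmod_morphism : zmod_morphism (lin h).
Proof.
move=> a b; pose d := (msupp a `|` msupp b)%fset.
rewrite (@linEw (a - b) d) ?msuppB_le // (@linEw a d) ?fsubsetUl //.
rewrite (@linEw b d) ?fsubsetUr // -sumrB; apply: eq_bigr => w _.
by rewrite mcoeffB scalerBl.
Qed.

Fact lin_is_scalable : scalable (lin h).
Proof.
move=> c a; rewrite (@linEw (c *: a) (msupp a)) ?msuppZ_le // scaler_sumr.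
by apply: eq_bigr => w _; rewrite mcoeffZ scalerA.
Qed.

HB.instance Definition _ :=
  GRing.isZmodMorphism.Build (freealg X) M (lin h) lin_is_zmod_morphism.
HB.instance Definition _ :=
  GRing.isScalable.Build rat (freealg X) M *:%R (lin h) lin_is_scalable.

Lemma lin_word w : lin h (word w) = h w.
Proof. by rewrite /lin word.unlock msuppU1 big_seq_fset1 mcoeffUU scale1r. Qed.
End LinearExtension.

Lemma lin_shift (X : choiceType) (M : lmodType rat) (h : seq X -> M) u v a :
  lin h (word u * a * word v) = lin (fun w => h (u ++ w ++ v)) a.
Proof.
rewrite [a]freealg_words mulr_sumr mulr_suml !linear_sum.
apply: eq_bigr => w _; rewrite -scalerAr -scalerAl !linearZ /= -!word_cat.
by rewrite !lin_word -catA.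
Qed.

Lemma lin_ideal (X : choiceType) (M : lmodType rat) (h : seq X -> M)
    (S : freealg X -> Prop) :
  (forall u v r, S r -> lin (fun w => h (u ++ w ++ v)) r = 0) ->
  forall a, ideal_gen S a -> lin h a = 0.
Proof.
have lS (I : Type) (s : seq I) (E : I -> freealg X) :
    lin h (\sum_(i <- s) E i) = \sum_(i <- s) lin h (E i).
  exact: linear_sum.
move=> hS _ [m [u [r [v [Sr ->]]]]]; rewrite lS; apply: big1 => i _.
rewrite -mulrA [u i]freealg_words mulr_suml lS; apply: big1 => wu _.
rewrite -scalerAl linearZ /= mulrA [v i]freealg_words mulr_sumr lS scaler_sumr.
apply: big1 => wv _.
by rewrite -scalerAr linearZ /= lin_shift hS // !scaler0.
Qed.

Lemma lin_tuple (X : finType) (M : lmodType rat) (h : seq X -> M) p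
    (a : freealg X) : (forall w, size w <> p -> h w = 0) ->
  lin h a = \sum_(t : p.-tuple X) a@_(FMonom t : {fmonom X}) *: h t.
Proof.
move=> hp; rewrite {2}[a]freealg_words.
under [RHS]eq_bigr => t _ do rewrite raddf_sum scaler_suml.
rewrite exchange_big [LHS]big_seq [RHS]big_seq; apply: eq_bigr => w _ /=.
under eq_bigr => t _ do rewrite mcoeffZ mcoeff_word.
have [wp|/eqP wp] := eqVneq (size (w : seq X)) p; last first.
  rewrite hp // scaler0 big1 // => t _; case: eqP => [e|_].
    by case: wp; rewrite -(size_tuple t) -[LHS]/(size (fmonom_val w)) -[w]fmK e.
  by rewrite mulr0 scale0r.
have wt : size (w : seq X) == p by apply/eqP.
rewrite (bigD1 (Tuple wt)) //= fmK eqxx mulr1 big1 ?addr0 // => t nt.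
case: eqP => [e|_]; last by rewrite mulr0 scale0r.
by case/eqP: nt; apply/val_inj; rewrite /= e.
Qed.

Lemma lin_mul (X : choiceType) (M : lmodType rat) (h : seq X -> M) a b :
  lin h (a * b) = lin (fun u => lin (fun v => h (u ++ v)) b) a.
Proof.
rewrite {1}[a]freealg_words mulr_suml.
have lS (I : Type) (s : seq I) (E : I -> freealg X) :
    lin h (\sum_(i <- s) E i) = \sum_(i <- s) lin h (E i).
  exact: linear_sum.
rewrite lS; apply: eq_bigr => u _; rewrite -scalerAl linearZ /=; congr (_ *: _).
have := lin_shift h u [::] b; rewrite word_nil mulr1 => ->.
by apply: eq_bigr => v _; rewrite cats0.
Qed.

Lemma lin_comp (X : choiceType) (M N : lmodType rat) (f : {linear M -> N})
    (h : seq X -> M) a : lin (f \o h) a = f (lin h a).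
Proof. by rewrite linear_sum; apply: eq_bigr => w _; rewrite linearZ. Qed.

Lemma homog_word (X : choiceType) (w : seq X) : homog (size w) (word w).
Proof. by move=> x; rewrite word.unlock msuppU1 inE => /eqP->. Qed.

Lemma homog_words (X : finType) p (a : freealg X) : homog p a ->
  a = \sum_(t : p.-tuple X) a@_(FMonom t : {fmonom X}) *: word t.
Proof.
move=> ha; pose h (w : seq X) : freealg X := if size w == p then word w else 0.
have hp w : size w <> p -> h w = 0 by rewrite /h => /eqP/negPf->.
transitivity (lin h a).
  rewrite [LHS]freealg_words /lin big_seq [RHS]big_seq.
  by apply: eq_bigr => w /ha sw; rewrite /h -[size _]/(fdeg w) sw eqxx.
by rewrite (lin_tuple _ hp); apply: eq_bigr => t _; rewrite /h size_tuple eqxx.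
Qed.

Lemma mcoeff_lincomb (X : choiceType) (I : finType) (c : I -> rat)
    (E : I -> freealg X) (m : {fmonom X}) :
  (\sum_i c i *: E i)@_m = \sum_i c i * (E i)@_m.
Proof.
transitivity (\sum_i (c i *: E i)@_m); first exact: (raddf_sum (mcoeff m)).
by apply: eq_bigr => i _; exact: mcoeffZ.
Qed.

Lemma mcoeff_pairs (X : finType) (f : X -> X -> rat) g h :
  (\sum_x \sum_y f x y *: word [:: x; y] : freealg X)@_(FMonom [:: g; h]) = f g h.
Proof.
rewrite pair_bigA /= (@mcoeff_lincomb X _ (fun p => f p.1 p.2)
  (fun p => word [:: p.1; p.2])).
rewrite (bigD1 (g, h)) //= big1 ?addr0 => [|[x y] /=].
  by rewrite mcoeff_word eqxx mulr1.
rewrite xpair_eqE mcoeff_word fmP !eqseq_cons andbT => /negPf->.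
exact: mulr0.
Qed.

(** * Clique monomials span the dual *)

Section Dual.
Variables (n : nat) (B : algType rat) (rd : 'I_n -> 'I_n -> B).
Local Notation X := (gen n).

(** The vanishing of the squares of all linear combinations is replaced by its polarized form on
    generators, [rd_sq] and [rd_anti]. *)
Record dual_relations := DualRelations {
  rd_sq : forall i j, i != j -> rd i j * rd i j = 0;
  rd_anti : forall i j k l, i != j -> k != l ->
    rd i j * rd k l = - (rd k l * rd i j);
  rd_opp : forall i j, i != j -> rd i j * rd j i = 0;
  rd_out : forall i j k, uniq [:: i; j; k] ->
    rd i j * rd i k = rd i j * rd j k - rd i k * rd k j;
  rd_in : forall i j k, uniq [:: i; j; k] ->
    rd i k * rd j k = rd i j * rd j k - rd j i * rd i k }.

Hypothesis rel : dual_relations.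

Definition bw (w : seq X) : B := \prod_(g <- w) rd (val g).1 (val g).2.

Lemma bw_cat u v : bw (u ++ v) = bw u * bw v.
Proof. by rewrite /bw big_cat. Qed.

Lemma bw_nil : bw [::] = 1.
Proof. exact: big_nil. Qed.

Lemma bw1 (g : X) : bw [:: g] = rd (val g).1 (val g).2.
Proof. exact: big_seq1. Qed.

Lemma bw_cons g w : bw (g :: w) = bw [:: g] * bw w.
Proof. by rewrite -bw_cat. Qed.

Lemma bw_anti (g h : X) : bw [:: g] * bw [:: h] = - (bw [:: h] * bw [:: g]).
Proof. by rewrite !bw1; exact: (rd_anti rel (valP g) (valP h)). Qed.

Definition level (g : X) : nat := maxn (val g).1 (val g).2.

(* Generators of a given level are heavier than all those of lower level, and
   [r i m] is heavier than [r j m] for [j < i < m] and than any [r m j]. *)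
Definition wtp (i j : 'I_n) : nat :=
  (maxn i j * n.*2.+2 + (if (i < j)%N then i.+1 else 0))%N.
Definition wt (g : X) : nat := wtp (val g).1 (val g).2.

(** [h] is r_am with a < m, and a is the larger index of [g]. So in a clique each index is the
    larger index of at most one generator, and r_am with a < m occurs only if a is the larger index
    of no member. *)
Definition clash (g h : X) :=
  ((val h).1 < (val h).2)%N && ((val h).1 == level g :> nat).
Definition adj (g h : X) :=
  [&& level g != level h, ~~ clash g h & ~~ clash h g].

Lemma adj_sym : symmetric adj.
Proof. by move=> g h; rewrite /adj eq_sym andbCA andbA andbC andbA andbC. Qed.

Lemma adj_irr : irreflexive adj.
Proof. by move=> g; rewrite /adj eqxx. Qed.

(** The step [n.*2.+2] between levels exceeds the correction [i.+1], which is at most [n]. *)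
Lemma wtp_lt (i j m : 'I_n) : (i < m)%N -> (j < m)%N -> (wtp i j < m * n.*2.+2)%N.
Proof.
move=> im jm; rewrite /wtp.
have le1 : (maxn i j <= m.-1)%N by lia.
have : (maxn i j * n.*2.+2 <= m.-1 * n.*2.+2)%N by rewrite leq_mul2r le1 orbT.
have -> : (m * n.*2.+2 = m.-1 * n.*2.+2 + n.*2.+2)%N.
  by rewrite -mulSnr prednK //; lia.
by have := ltn_ord i; case: ifP => _; lia.
Qed.

Lemma wtp_hi (i m : 'I_n) : (i < m)%N -> wtp m i = (m * n.*2.+2)%N.
Proof. by move=> im; rewrite /wtp ltnNge ltnW //= (maxn_idPl (ltnW im)) addn0. Qed.

Lemma wtp_lo (i m : 'I_n) : (i < m)%N -> wtp i m = (m * n.*2.+2 + i.+1)%N.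
Proof. by move=> im; rewrite /wtp im (maxn_idPr (ltnW im)). Qed.

Definition low2 W (x : B) := exists s : seq (rat * (X * X)),
  x = \sum_(t <- s) t.1 *: bw [:: t.2.1; t.2.2] /\
  forall t, t \in s -> (wt t.2.1 + wt t.2.2 < W)%N.

Lemma low2_0 W : low2 W 0.
Proof. by exists [::]; rewrite big_nil. Qed.

Lemma low2D W x y : low2 W x -> low2 W y -> low2 W (x + y).
Proof.
move=> [s [-> hs]] [s' [-> hs']]; exists (s ++ s'); rewrite big_cat.
by split=> // t; rewrite mem_cat => /orP[/hs|/hs'].
Qed.

Lemma low2N W x : low2 W x -> low2 W (- x).
Proof.
move=> [s [-> hs]]; exists [seq (- t.1, t.2) | t <- s]; split.
  by rewrite big_map -sumrN; apply: eq_bigr => t _; rewrite scaleNr.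
by move=> t /mapP[t' /hs h ->].
Qed.

Lemma low2_rd W i j k l : i != j -> k != l -> (wtp i j + wtp k l < W)%N ->
  low2 W (rd i j * rd k l).
Proof.
move=> ij kl lt; pose g : X := exist _ (i, j) ij; pose h : X := exist _ (k, l) kl.
exists [:: (1, (g, h))]; split=> [|t]; last by rewrite inE => /eqP->.
by rewrite big_seq1 scale1r bw_cons !bw1.
Qed.

(** Two of the triangle relations together replace the factor r_jm by r_im, r_mj or r_mi. All three
    are lighter than r_jm, the first because i < j. *)
Lemma low2_clash (i j m : 'I_n) : (i < j)%N -> (j < m)%N ->
  low2 (wtp i j + wtp j m) (rd i j * rd j m) /\
  low2 (wtp j i + wtp j m) (rd j i * rd j m).
Proof.
move=> ij jm; have im := ltn_trans ij jm.
have [ijn jmn imn] : [/\ i != j, j != m & i != m].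
  by split; rewrite -val_eqE /= neq_ltn ?ij ?jm ?im.
have [jin mjn min] : [/\ j != i, m != j & m != i] by split; rewrite eq_sym.
split.
- have -> : rd i j * rd j m = rd i j * rd i m + (rd i j * rd m j + rd m i * rd i j).
    have o : uniq [:: i; j; m] by rewrite /= !inE negb_or ijn imn jmn.
    have o' : uniq [:: i; m; j] by rewrite /= !inE negb_or ijn imn mjn.
    by rewrite (rd_out rel o) (rd_in rel o') (subrK (rd m i * rd i j)) subrK.
  apply: low2D; last apply: low2D; apply: low2_rd => //;
    rewrite ?(wtp_lo jm) ?(wtp_lo im) ?(wtp_hi jm) ?(wtp_hi im); lia.
- have -> : rd j i * rd j m = rd j i * rd i m - (rd j i * rd m i + rd m j * rd j i).
    have o : uniq [:: j; i; m] by rewrite /= !inE negb_or jin imn jmn.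
    have o' : uniq [:: j; m; i] by rewrite /= !inE negb_or jin jmn min.
    by rewrite (rd_out rel o) (rd_in rel o') subrK.
  apply: low2D; last apply: low2N; last apply: low2D; apply: low2_rd => //;
    rewrite ?(wtp_lo jm) ?(wtp_lo im) ?(wtp_hi jm) ?(wtp_hi im); lia.
Qed.

(** A triangle relation turns a product of two generators of level m into terms with one factor of
    level m and one of a lower level. *)
Lemma low2_level (i j m : 'I_n) : i != j -> (i < m)%N -> (j < m)%N ->
  [/\ low2 (wtp i m + wtp j m) (rd i m * rd j m),
      low2 (wtp m i + wtp m j) (rd m i * rd m j) &
      low2 (wtp i m + wtp m j) (rd i m * rd m j)].
Proof.
move=> ijn im jm; have jin : j != i by rewrite eq_sym.
have [imn jmn] : i != m /\ j != m by split; rewrite -val_eqE /= neq_ltn ?im ?jm.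
have [min mjn] : m != i /\ m != j by split; rewrite eq_sym.
have [l1 l2] := (wtp_lt im jm, wtp_lt jm im).
split.
- have o : uniq [:: i; j; m] by rewrite /= !inE negb_or ijn imn jmn.
  rewrite (rd_in rel o); apply: low2D; last apply: low2N; apply: low2_rd => //;
    rewrite ?(wtp_lo jm) ?(wtp_lo im); lia.
- have o : uniq [:: m; i; j] by rewrite /= !inE negb_or ijn min mjn.
  rewrite (rd_out rel o); apply: low2D; last apply: low2N; apply: low2_rd => //;
    rewrite ?(wtp_hi jm) ?(wtp_hi im); lia.
- have o : uniq [:: i; m; j] by rewrite /= !inE negb_or ijn imn mjn.
  have -> : rd i m * rd m j = rd i j * rd m j + rd m i * rd i j.
    by rewrite (rd_in rel o) subrK.
  apply: low2D; apply: low2_rd => //;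
    rewrite ?(wtp_hi jm) ?(wtp_lo im) ?(wtp_hi im); lia.
Qed.

Lemma low2_anti (g h : X) :
  low2 (wt h + wt g) (bw [:: h; g]) -> low2 (wt g + wt h) (bw [:: g; h]).
Proof.
rewrite !(bw_cons _ [:: _]) bw_anti addnC => /low2N; by rewrite opprK.
Qed.

Lemma low2_nadj (g h : X) : ~~ adj g h -> low2 (wt g + wt h) (bw [:: g; h]).
Proof.
have cl (x y : X) : clash x y -> low2 (wt x + wt y) (bw [:: x; y]).
  rewrite bw_cons !bw1 /clash /level /wt.
  case: x y => [[a b] /= ab] [[c d] /= cd] /andP[lt1 /eqP e].
  have [ltab|ltba|e1] := ltngtP a b; last by case/eqP: ab; exact: val_inj.
    have eb : b = c by apply: ord_inj; rewrite e (maxn_idPr (ltnW ltab)).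
    by subst c; have [] := low2_clash ltab lt1.
  have ea : a = c by apply: ord_inj; rewrite e (maxn_idPl (ltnW ltba)).
  by subst c; have [] := low2_clash ltba lt1.
rewrite /adj 2!negb_and !negbK => /or3P[e|c1|c2];
  [|exact: cl|exact/low2_anti/cl].
have sorted_pair (x : X) : exists i m : 'I_n, [/\ (i < m)%N, level x = m &
    (val x = (i, m)) \/ (val x = (m, i))].
  case: x => [[a b] /= ab]; rewrite /level /=.
  have [lt|lt|e1] := ltngtP a b; last by case/eqP: ab; exact: val_inj.
    by exists a, b; split=> //; left.
  by exists b, a; split=> //; right.
have [i [m [im lg eg]]] := sorted_pair g.
have [j [m' [jm' lh eh]]] := sorted_pair h.
have em : m' = m by apply: val_inj; rewrite /= -lg -lh (eqP e).
subst m'; have [eij|nij] := eqVneq i j.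
  subst j; rewrite bw_cons !bw1.
  have imn : i != m by rewrite -val_eqE neq_ltn im.
  have min : m != i by rewrite eq_sym.
  by case: eg => ->; case: eh => ->; rewrite /= ?(rd_sq rel) ?(rd_opp rel) //; exact: low2_0.
have [h1 h2 h3] := low2_level nij im jm'.
have [|h1' h2' h3'] := low2_level _ jm' im; first by rewrite eq_sym.
case: eg => eg; case: eh => eh.
- by rewrite bw_cons !bw1 /wt eg eh.
- by rewrite bw_cons !bw1 /wt eg eh.
- by apply: low2_anti; rewrite bw_cons !bw1 /wt eg eh.
- by rewrite bw_cons !bw1 /wt eg eh.
Qed.

Local Notation clique := (clique adj).

Definition cm (c : {set X}) : B := bw (enum c).

Lemma bw_swap (u : seq X) (g h : X) v : bw (u ++ g :: h :: v) = - bw (u ++ h :: g :: v).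
Proof.
have e (x y : X) : bw (u ++ x :: y :: v) = bw u * (bw [:: x] * bw [:: y]) * bw v.
  by rewrite bw_cat (bw_cons x) (bw_cons y) !mulrA.
by rewrite !e bw_anti mulrN mulNr.
Qed.

Lemma bw_move (u : seq X) b (h : X) v :
  bw (u ++ b ++ h :: v) = (-1) ^+ size b *: bw (u ++ h :: b ++ v).
Proof.
elim: b u => [|g b IHb] u; first by rewrite scale1r.
have := IHb (rcons u g); rewrite !cat_rcons => ->.
by rewrite bw_swap scalerN exprS mulN1r scaleNr.
Qed.

Lemma bw_perm (w w' : seq X) : perm_eq w w' ->
  exists2 e : rat, e * e = 1 & bw w = e *: bw w'.
Proof.
elim: w w' => [|g w IHw] w' pw.
  by exists 1; rewrite ?mulr1 // scale1r;
     have /perm_nilP-> : perm_eq w' [::] by rewrite perm_sym.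
have gw' : g \in w' by rewrite -(perm_mem pw) mem_head.
have [u [v e]] : exists u v, w' = u ++ g :: v by case/splitPr: gw' => u v; exists u, v.
subst w'; have /IHw[e e1 eE] : perm_eq w (u ++ v).
  by rewrite -(perm_cons g) (permPl pw) -cat1s perm_catCA.
exists ((-1) ^+ size u * e).
  by rewrite mulrACA e1 mulr1 -expr2 sqrr_sign.
have := bw_move [::] u g v => /= ->.
by rewrite bw_cons eE -scalerAr -bw_cons scalerA mulrAC -expr2 sqrr_sign mul1r.
Qed.

Definition inspan q W (x : B) := exists k : {set X} -> rat,
  x = \sum_c k c *: cm c /\
  forall c, k c != 0 -> [/\ clique c, #|c| = q & (wtc wt c < W)%N].

Lemma inspan0 q W : inspan q W 0.
Proof.
exists (fun=> 0); split=> [|c /eqP//].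
by rewrite big1 // => c _; rewrite scale0r.
Qed.

Lemma inspanD q W x y : inspan q W x -> inspan q W y -> inspan q W (x + y).
Proof.
move=> [k [-> hk]] [l [-> hl]]; exists (fun c => k c + l c); split.
  by rewrite -big_split; apply: eq_bigr => c _; rewrite scalerDl.
move=> c; case: (eqVneq (k c) 0) => [->|/hk//]; rewrite add0r; exact: hl.
Qed.

Lemma inspanZ q W a x : inspan q W x -> inspan q W (a *: x).
Proof.
move=> [k [-> hk]]; exists (fun c => a * k c); split.
  by rewrite scaler_sumr; apply: eq_bigr => c _; rewrite scalerA.
by move=> c; rewrite mulf_eq0 negb_or => /andP[_ /hk].
Qed.

Lemma inspan_leq q W W' x : (W <= W')%N -> inspan q W x -> inspan q W' x.
Proof.
move=> le [k [-> hk]]; exists k; split=> // c /hk[cc cq lt]; split=> //.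
exact: leq_trans le.
Qed.

Lemma inspan_cm c : clique c -> inspan #|c| (wtc wt c).+1 (cm c).
Proof.
move=> cc; exists (fun x => (x == c)%:R); split.
  rewrite (bigD1 c) //= eqxx scale1r big1 ?addr0 // => x /negPf->.
  by rewrite scale0r.
by move=> x; case: (x =P c) => [->|_]; [rewrite ltnS|rewrite eqxx].
Qed.

Lemma pairwiseNP (w : seq X) : ~~ pairwise adj w ->
  exists u g b h v, w = u ++ g :: b ++ h :: v /\ ~~ adj g h.
Proof.
elim: w => //= g w IHw; rewrite negb_and => /orP[/allPn[h hw nadj]|/IHw].
  by case/splitPr: hw => b v; exists [::], g, b, h, v.
by move=> [u [g' [b [h [v [-> nadj]]]]]]; exists (g :: u), g', b, h, v.
Qed.

Lemma pairwise_clique (w : seq X) : pairwise adj w ->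
  [/\ clique [set x in w], uniq w, #|[set x in w]| = size w,
      wtc wt [set x in w] = wtw wt w &
      exists2 e : rat, e * e = 1 & bw w = e *: cm [set x in w]].
Proof.
move=> pw.
have uw : uniq w.
  by apply: pairwise_uniq pw => x; rewrite adj_irr.
have pe : perm_eq w (enum [set x in w]).
  apply: uniq_perm => //; first exact: enum_uniq.
  by move=> x; rewrite mem_enum inE.
split=> //.
- apply/cliqueP => g h; rewrite !inE; elim: w pw {uw pe} => //= x w IHw.
  case/andP=> /allP xw pw; rewrite !inE => /predU1P[->|gw] /predU1P[->|hw] gh.
  + by rewrite eqxx in gh.
  + exact: xw.
  + by rewrite adj_sym; exact: xw.
  + exact: IHw.
- by rewrite cardsE; exact/card_uniqP.
- by rewrite /wtc /wtw (perm_big _ pe) /= big_enum.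
- exact: bw_perm.
Qed.

Lemma bw_low u (g h : X) v q W :
  (forall w, size w = (size u + size v).+2 ->
     (wtw wt w < wtw wt (u ++ g :: h :: v))%N -> inspan q W (bw w)) ->
  ~~ adj g h -> inspan q W (bw (u ++ g :: h :: v)).
Proof.
move=> H /low2_nadj[s [sE hs]].
have -> : bw (u ++ g :: h :: v) = bw u * bw [:: g; h] * bw v.
  by rewrite -mulrA -bw_cat -bw_cat.
rewrite sE mulr_sumr mulr_suml big_seq; elim/big_ind: _ => [|x y|t ts].
- exact: inspan0.
- exact: inspanD.
rewrite -scalerAr -scalerAl -mulrA -!bw_cat /=; apply: inspanZ; apply: H.
  by rewrite size_cat /= !addnS.
rewrite !wtw_cat !wtw_cons ltn_add2l; have := hs t ts.
by rewrite -(ltn_add2r (wtw wt v)) -!(addnA (wt _)).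
Qed.

(** Up to sign, two non-adjacent letters can be made neighbours, and [low2_nadj] then replaces their
    product by lighter ones. The strict bound records that such a word has no component in its own
    weight, which is the source of [mu_top]. *)
Lemma bw_span_lt W w : (wtw wt w < W)%N ->
  inspan (size w) (wtw wt w).+1 (bw w) /\
  (~~ pairwise adj w -> inspan (size w) (wtw wt w) (bw w)).
Proof.
elim: W w => // W IHW w; rewrite ltnS => lew.
have lt : ~~ pairwise adj w -> inspan (size w) (wtw wt w) (bw w).
  move=> /pairwiseNP[u [g [b [h [v [wE nadj]]]]]]; subst w.
  have -> : wtw wt (u ++ g :: b ++ h :: v) = wtw wt (u ++ g :: h :: b ++ v).
    rewrite !wtw_cat !wtw_cons !wtw_cat !wtw_cons; lia.
  have := bw_move (rcons u g) b h v; rewrite !cat_rcons => ->.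
  apply: inspanZ; apply: bw_low => // w' sw' ltw'.
  have -> : size (u ++ g :: b ++ h :: v) = size w'.
    rewrite sw' size_cat /= !size_cat /=; lia.
  have ltW : (wtw wt w' < W)%N.
    apply: leq_trans lew; apply: leq_trans ltw' _.
    rewrite !wtw_cat !wtw_cons !wtw_cat !wtw_cons; lia.
  by have [h1 _] := IHW w' ltW; exact: inspan_leq h1.
split=> //; have [pw|/lt] := boolP (pairwise adj w); last first.
  exact/inspan_leq/leqnSn.
have [cc uw <- <- [e _ ->]] := pairwise_clique pw.
exact/inspanZ/inspan_cm.
Qed.

Lemma bw_span w : inspan (size w) (wtw wt w).+1 (bw w).
Proof. by have [] := bw_span_lt (ltnSn (wtw wt w)). Qed.

Lemma bw_span_strict w : ~~ pairwise adj w -> inspan (size w) (wtw wt w) (bw w).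
Proof. by have [_] := bw_span_lt (ltnSn (wtw wt w)). Qed.
End Dual.

(** * Clique monomials are independent *)

(* Exterior multiplication by the basis vectors; [f S] is the coefficient of
   the ordered product of the basis vectors indexed by [S]. *)
Section Fermions.
Variable n : nat.
Local Notation V := {ffun {set 'I_n} -> rat^o}.

Definition esgn (S : {set 'I_n}) (i : 'I_n) : rat :=
  (-1) ^+ #|[set k in S | (k < i)%N]|.

Definition eps (i : 'I_n) (f : V) : V :=
  [ffun S : {set 'I_n} => if i \in S then esgn S i * f (S :\ i) else 0].

Lemma esgn_ge S (i j : 'I_n) : (j <= i)%N -> esgn (S :\ i) j = esgn S j.
Proof.
move=> ji; rewrite /esgn; congr (_ ^+ #|pred_of_set _|); apply/setP => k.
rewrite !inE -andbA andbCA; case: eqVneq => //= ->.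
by rewrite ltnNge ji andbF.
Qed.

Lemma esgn_lt (S : {set 'I_n}) (i j : 'I_n) : i \in S -> (i < j)%N ->
  esgn (S :\ i) j = - esgn S j.
Proof.
move=> iS ij; rewrite /esgn [in RHS](cardsD1 i) inE iS ij exprS mulN1r opprK.
congr (_ ^+ #|pred_of_set _|); apply/setP => k.
by rewrite !inE andbA.
Qed.

Lemma eps_anti i j f : eps i (eps j f) = - eps j (eps i f).
Proof.
apply/ffunP => S; rewrite !ffunE !inE.
have [->|ij] := eqVneq i j.
  by rewrite ?eqxx /=; case: ifP => _; rewrite ?mulr0 oppr0.
rewrite /=.
case: ifP => iS; case: ifP => jS; rewrite ?mulr0 ?oppr0 //.
have -> : S :\ i :\ j = S :\ j :\ i by apply/setP => k; rewrite !inE andbCA.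
rewrite !mulrA -mulNr; congr (_ * _).
have [lt|lt|e] := ltngtP i j.
- by rewrite (esgn_lt iS lt) (esgn_ge _ (ltnW lt)); ring.
- by rewrite (esgn_lt jS lt) (esgn_ge _ (ltnW lt)); ring.
- by case/eqP: ij; exact: ord_inj.
Qed.

Lemma eps_sq i f : eps i (eps i f) = 0.
Proof. by apply/ffunP => S; rewrite !ffunE !inE eqxx /=; case: ifP => _; rewrite ?mulr0. Qed.

Fact eps_is_zmod_morphism i : zmod_morphism (eps i).
Proof.
move=> f g; apply/ffunP => S; rewrite !ffunE.
by case: ifP => _; rewrite ?subr0 // mulrBr.
Qed.

Fact eps_is_scalable i : scalable (eps i).
Proof.
move=> c f; apply/ffunP => S; rewrite !ffunE.
by case: ifP => _; [exact: mulrCA | rewrite scaler0].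
Qed.

HB.instance Definition _ i :=
  GRing.isZmodMorphism.Build V V (eps i) (eps_is_zmod_morphism i).
HB.instance Definition _ i :=
  GRing.isScalable.Build rat V V *:%R (eps i) (eps_is_scalable i).

Definition om (i j : 'I_n) (f : V) : V := eps j f - eps i f.

Fact om_is_zmod_morphism i j : zmod_morphism (om i j).
Proof.
move=> f g; rewrite /om (raddfB (eps j)) (raddfB (eps i)) !opprB.
by rewrite addrACA [RHS]addrACA; congr (_ + _); rewrite addrC.
Qed.

Fact om_is_scalable i j : scalable (om i j).
Proof.
by move=> c f; rewrite /om !linearZ /= -scalerDr.
Qed.

HB.instance Definition _ i j :=
  GRing.isZmodMorphism.Build V V (om i j) (om_is_zmod_morphism i j).
HB.instance Definition _ i j :=
  GRing.isScalable.Build rat V V *:%R (om i j) (om_is_scalable i j).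

Lemma omE i j f : om i j f = eps j f - eps i f.
Proof. by []. Qed.

Lemma om_anti i j k l f : om i j (om k l f) = - om k l (om i j f).
Proof.
rewrite !omE !raddfB /= (eps_anti j l) (eps_anti i l) (eps_anti j k) (eps_anti i k).
move: (eps l (eps j f)) (eps k (eps j f)) (eps l (eps i f)) (eps k (eps i f)).
by move=> a b c d; apply/ffunP => S; rewrite !ffunE; ring.
Qed.

Lemma om_sq i j f : om i j (om i j f) = 0.
Proof.
rewrite !omE !raddfB /= !eps_sq (eps_anti i j); move: (eps j (eps i f)) => a.
by apply/ffunP => S; rewrite !ffunE; ring.
Qed.

Lemma om_tri i j k f : om i k f = om i j f + om j k f.
Proof. by rewrite !omE [RHS]addrC addrA subrK. Qed.

Lemma om_rev i j f : om j i f = - om i j f.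
Proof. by rewrite !omE opprB. Qed.

Lemma om_out i j k f : om i j (om i k f) = om i j (om j k f).
Proof. by rewrite (om_tri i j k) raddfD /= om_sq add0r. Qed.

Lemma om_in i j k f : om i k (om j k f) = om i j (om j k f).
Proof. by rewrite (om_tri i j k) om_sq addr0. Qed.
End Fermions.

(* A total order on the vertices, given by [s], and an equivalence relation,
   given by [t], determine a homomorphism to the exterior algebra that sends
   [r i j] to [e_j - e_i] if [i] and [j] are equivalent and [i] precedes [j],
   and to [0] otherwise. *)
Section Model.
Variables (n : nat) (s : 'I_n -> rat) (t : 'I_n -> nat).
Hypothesis s_inj : injective s.
Local Notation X := (gen n).
Local Notation V := {ffun {set 'I_n} -> rat^o}.

Definition cond (i j : 'I_n) : rat := ((s i < s j) && (t i == t j))%:R.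

Definition rop i j (f : V) : V := cond i j *: om i j f.

Fact rop_is_zmod_morphism i j : zmod_morphism (rop i j).
Proof. by move=> f g; rewrite /rop (raddfB (om i j)) scalerBr. Qed.

Fact rop_is_scalable i j : scalable (rop i j).
Proof. by move=> c f; rewrite /rop [om i j _]linearZ /= !scalerA mulrC. Qed.

HB.instance Definition _ i j :=
  GRing.isZmodMorphism.Build V V (rop i j) (rop_is_zmod_morphism i j).
HB.instance Definition _ i j :=
  GRing.isScalable.Build rat V V *:%R (rop i j) (rop_is_scalable i j).

Lemma ropZ i j c f : rop i j (c *: f) = c *: rop i j f.
Proof. exact: linearZ. Qed.

Lemma ropM i j k l f :
  rop i j (rop k l f) = (cond i j * cond k l) *: om i j (om k l f).
Proof. by rewrite /rop [om i j _]linearZ /= scalerA. Qed.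

Lemma rop_anti i j k l f : rop i j (rop k l f) = - rop k l (rop i j f).
Proof. by rewrite !ropM om_anti scalerN mulrC. Qed.

(** After [om_out], [om_in] and [om_rev], the three products of a triangle relation agree up to
    sign, and the relation becomes an identity of indicators: within a class, if i precedes j and k,
    then exactly one of i < j < k and i < k < j holds; dually if i and j precede k. Across classes
    both sides vanish by transitivity. *)
Lemma cond_cases i j k : uniq [:: i; j; k] ->
  cond i j * cond i k = cond i j * cond j k + cond i k * cond k j /\
  cond i k * cond j k = cond i j * cond j k + cond j i * cond i k.
Proof.
rewrite /= !inE negb_or andbT => /andP[/andP[ij ik] jk].
rewrite /cond !(eq_sym (t k)) !(eq_sym (t j) (t i)).
have [eij|nij] := eqVneq (t i) (t j); have [ejk|njk] := eqVneq (t j) (t k);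
  have [eik|nik] := eqVneq (t i) (t k); try (by rewrite eij ejk eqxx in nik);
  try (by rewrite -eij eik eqxx in njk);
  try (by rewrite eik ejk eqxx in nij);
  rewrite ?andbF ?andbT ?mulr0 ?mul0r ?addr0 //.
have := s_inj; case: (ltgtP (s i) (s j)) => [h1|h1|/s_inj e]; last by rewrite e eqxx in ij.
all: case: (ltgtP (s j) (s k)) => [h2|h2|/s_inj e]; last by rewrite e eqxx in jk.
all: case: (ltgtP (s i) (s k)) => [h3|h3|/s_inj e]; last by rewrite e eqxx in ik.
all: rewrite ?mulr0 ?mul0r ?addr0 ?add0r ?mulr1 //.
- by have := lt_trans h1 (lt_trans h2 h3); rewrite ltxx.
- by have := lt_trans h1 (lt_trans h3 h2); rewrite ltxx.
Qed.

Lemma cond_opp i j : cond i j * cond j i = 0.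
Proof.
by rewrite /cond; case: ltgtP => _; rewrite /= ?mulr0 ?mul0r.
Qed.

Definition wop (w : seq X) (f : V) : V :=
  foldr (fun g : X => rop (val g).1 (val g).2) f w.

Lemma wop_cons g w f : wop (g :: w) f = rop (val g).1 (val g).2 (wop w f).
Proof. by []. Qed.

Lemma wop_cat u v f : wop (u ++ v) f = wop u (wop v f).
Proof. exact: foldr_cat. Qed.

Fact wop_is_zmod_morphism w : zmod_morphism (wop w).
Proof. by elim: w => // g w IHw f f'; rewrite !wop_cons IHw (raddfB (rop _ _)). Qed.

Fact wop_is_scalable w : scalable (wop w).
Proof. by elim: w => // g w IHw c f; rewrite !wop_cons IHw [rop _ _ _]linearZ. Qed.

HB.instance Definition _ w :=
  GRing.isZmodMorphism.Build V V (wop w) (wop_is_zmod_morphism w).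
HB.instance Definition _ w :=
  GRing.isScalable.Build rat V V *:%R (wop w) (wop_is_scalable w).

Definition aop (a : freealg X) (f : V) : V := lin (fun w => wop w f) a.

Lemma aop_mul a b f : aop (a * b) f = aop a (aop b f).
Proof.
rewrite /aop lin_mul; congr (lin _ a); apply/funext => u.
rewrite -lin_comp; congr (lin _ b); apply/funext => v /=; exact: wop_cat.
Qed.

Lemma aop_letter (g : X) f : aop (letter g) f = rop (val g).1 (val g).2 f.
Proof. by rewrite -wordE /aop lin_word. Qed.

Lemma aop_r i j f : aop (r i j) f = rop i j f.
Proof.
rewrite /r; case: insubP => [g _ e|/=]; first by rewrite aop_letter e.
move=> /negPn/eqP->; rewrite /aop raddf0 /rop /om subrr; exact/esym/scaler0.
Qed.

Lemma aopB a b f : aop (a - b) f = aop a f - aop b f.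
Proof. exact: raddfB. Qed.

Lemma aop_three x1 y1 x2 y2 x3 y3 f : aop (x1 * y1 - (x2 * y2 - x3 * y3)) f =
  aop x1 (aop y1 f) - (aop x2 (aop y2 f) - aop x3 (aop y3 f)).
Proof.
apply: (etrans (aopB _ _ _)); congr (_ - _); first exact: aop_mul.
by apply: (etrans (aopB _ _ _)); congr (_ - _); exact: aop_mul.
Qed.

Lemma aop_rel a f : pvbd_rel a -> aop a f = 0.
Proof.
case=> [c|i j k u|i j k u|i j ij].
- set S := \sum_g _.
  have SE x : aop S x = \sum_g c g *: rop (val g).1 (val g).2 x.
    rewrite /aop linear_sum; apply: eq_bigr => g _; rewrite linearZ /=.
    by rewrite -/(aop _ _) aop_letter.
  rewrite aop_mul SE; under eq_bigr => g _ do rewrite SE linear_sum scaler_sumr.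
  set Y := \sum_g _; have YN : Y = - Y.
    rewrite {1}/Y exchange_big -sumrN; apply: eq_bigr => g _.
    rewrite -sumrN; apply: eq_bigr => h _.
    by rewrite /= 2!ropZ rop_anti 2!scalerN scalerA [in RHS]scalerA [c h * _]mulrC.
  have : (1 + 1) *: Y = 0 by rewrite scalerDl scale1r {1}YN addNr.
  by move/eqP; rewrite scaler_eq0 => /orP[//|/eqP].
- rewrite aop_three !aop_r 3!ropM om_out (om_rev j k) (raddfN (om i k)) /= om_in.
  have [-> _] := cond_cases u.
  by rewrite scalerN opprK scalerDl subrr.
- rewrite aop_three !aop_r 3!ropM om_in (om_rev i j) om_out /=.
  have [_ ->] := cond_cases u.
  by rewrite scalerN opprK scalerDl subrr.
- by rewrite aop_mul !aop_r ropM cond_opp scale0r.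
Qed.

Lemma wop_ideal a f : ideal_gen (@pvbd_rel n) a -> aop a f = 0.
Proof.
apply: lin_ideal => u v b /aop_rel b0.
transitivity (wop u (aop b (wop v f))); last by rewrite b0 raddf0.
rewrite -lin_comp; congr (lin _ b); apply/funext => w /=.
by rewrite !wop_cat.
Qed.
End Model.

(** * Leading terms and induction on the largest index *)

Section Independence.
Variable n : nat.
Local Notation X := (gen n).
Local Notation V := {ffun {set 'I_n} -> rat^o}.
Local Notation clique := (clique (@adj n)).

Definition hi (g : X) : 'I_n :=
  if ((val g).1 < (val g).2)%N then (val g).2 else (val g).1.
Definition lo (g : X) : 'I_n :=
  if ((val g).1 < (val g).2)%N then (val g).1 else (val g).2.

Lemma lo_hi g : (lo g < hi g)%N.
Proof.
rewrite /lo /hi; case: (ltngtP (val g).1 (val g).2) => // e; have := valP g.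
by rewrite -val_eqE /= e eqxx.
Qed.

Lemma level_hi g : level g = hi g.
Proof. by rewrite /level /hi; case: ltngtP. Qed.

Definition vac : V := [ffun S : {set 'I_n} => (S == set0)%:R].
Definition omw (w : seq X) : V :=
  foldr (fun g : X => om (val g).1 (val g).2) vac w.

Lemma om_hi_lo g f : om (val g).1 (val g).2 f =
  (if ((val g).1 < (val g).2)%N then 1 else -1) *: (eps (hi g) f - eps (lo g) f).
Proof.
rewrite omE /hi /lo; case: ifP => _; first by rewrite scale1r.
by rewrite scaleN1r opprB.
Qed.

Lemma eps_neq0 i (f : V) S : eps i f S != 0 -> i \in S /\ f (S :\ i) != 0.
Proof.
rewrite ffunE; case: ifP => // _.
by rewrite mulf_eq0 negb_or => /andP[_].
Qed.

Lemma om_coef g f S : om (val g).1 (val g).2 f S =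
  (if ((val g).1 < (val g).2)%N then 1 else -1) *
    (eps (hi g) f S - eps (lo g) f S).
Proof. by rewrite om_hi_lo !ffunE. Qed.

(** The sum of the indices serves as the order for leading terms: each factor contributes [hi g] or
    the smaller [lo g]. *)
Lemma omw_neq0 (w : seq X) (S : {set 'I_n}) : omw w S != 0 ->
  #|S| = size w /\ (\sum_(i in S) i <= \sum_(g <- w) hi g)%N.
Proof.
elim: w S => [|g w IHw] S.
  rewrite /= ffunE; case: (S =P set0) => [->|_]; last by rewrite eqxx.
  by rewrite cards0 big_set0.
rewrite /= -/(omw w) om_coef mulf_eq0 negb_or => /andP[_ nz].
have step i : eps i (omw w) S != 0 -> (i <= hi g)%N -> #|S| = (size w).+1 /\
    (\sum_(j in S) j <= \sum_(h <- g :: w) hi h)%N.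
  move=> /eps_neq0[iS /IHw[cS le]] ig.
  rewrite (cardsD1 i) iS cS; split=> //.
  by rewrite (big_setD1 i) //= big_cons leq_add.
have [e|] := eqVneq (eps (hi g) (omw w) S) 0; last by move/step; apply.
move: nz; rewrite e sub0r oppr_eq0 => /step; apply.
exact/ltnW/lo_hi.
Qed.

(** Only the choice of [hi] in each factor reaches this monomial: taking [lo g] in the first factor
    would leave for the others an index sum larger than [omw_neq0] allows. *)
Lemma omw_top (w : seq X) : uniq (map hi w) -> omw w [set i in map hi w] != 0.
Proof.
elim: w => [_|g w IHw] /=.
  have -> : [set i in [::]] = set0 :> {set 'I_n} by apply/setP => i; rewrite !inE.
  by rewrite ffunE eqxx.
move=> /andP[gw uw]; have := IHw uw; set S' := [set i in map hi w] => nz.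
have -> : [set i in hi g :: map hi w] = hi g |: S'.
  by apply/setP => i; rewrite !inE.
have gS' : hi g \notin S' by rewrite inE.
rewrite -/(omw w) om_coef mulf_neq0 //;
  first by case: ifP => _; rewrite ?oner_eq0 // oppr_eq0 oner_eq0.
have -> : eps (lo g) (omw w) (hi g |: S') = 0.
  apply/eqP/negPn/negP => /eps_neq0[lS /omw_neq0[_]].
  have -> : (\sum_(h <- w) hi h = \sum_(i in S') i)%N.
    rewrite -(big_map hi predT (fun i : 'I_n => i : nat)) -[RHS]big_enum /=.
    apply: perm_big; apply: uniq_perm => //; first exact: enum_uniq.
    by move=> i; rewrite mem_enum inE.
  have : (\sum_(i in hi g |: S') i =
      lo g + \sum_(i in (hi g |: S') :\ lo g) i)%N by rewrite (big_setD1 (lo g)).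
  rewrite big_setU1 //=; move: (lo_hi g).
  move: (\sum_(i in S') _)%N (\sum_(i in _ :\ _) _)%N => x y; lia.
rewrite subr0 ffunE setU11 setU1K // mulf_neq0 //.
by rewrite /esgn signr_eq0.
Qed.

Lemma wop_omw s t (w : seq X) :
  wop s t w vac = (\prod_(g <- w) cond s t (val g).1 (val g).2) *: omw w.
Proof.
elim: w => [|g w IHw]; first by rewrite big_nil scale1r.
by rewrite wop_cons IHw /= /rop [om _ _ (_ *: _)]linearZ /= scalerA big_cons.
Qed.

Definition val_at (s : 'I_n -> rat) (t : 'I_n -> nat) (c : {set X}) : rat :=
  \prod_(g in c) cond s t (val g).1 (val g).2.

(** The monomial whose coefficient is read off. If every generator of a clique [c] joins equivalent
    indices, each [hi g] is preceded by the equivalent [lo g], so [hi @: c] lies in this set, and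
    equals it when the sizes agree. *)
Definition nonmin (t : 'I_n -> nat) m : {set 'I_n} :=
  [set i : 'I_n | (i < m)%N && [exists j : 'I_n, (j < i)%N && (t j == t i)]].

Lemma val_at_eq s t s' t' (c : {set X}) (M : 'I_n) :
  {in c, forall g, (hi g < M)%N} ->
  (forall i, i != M -> s' i = s i) -> (forall i, i != M -> t' i = t i) ->
  val_at s' t' c = val_at s t c.
Proof.
move=> hc hs ht; apply: eq_bigr => g gc.
have lt := hc g gc; have lt' := ltn_trans (lo_hi g) lt.
have [n1 n2] : (val g).1 != M /\ (val g).2 != M.
  by move: lt lt'; rewrite /hi /lo -!val_eqE /=; case: ifP => _; lia.
by rewrite /cond !hs // !ht.
Qed.

Lemma hi_inj_clique (c : {set X}) : clique c -> {in c &, injective hi}.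
Proof.
move=> /cliqueP cl g h gc hc e; apply/eqP; apply: contraT => gh.
by have /and3P[] := cl g h gc hc gh; rewrite !level_hi e eqxx.
Qed.

(** Rational positions leave room on both sides of any index. The two points allow a new index to
    pass [j] without passing any other. *)
Lemma separate (s : 'I_n -> rat) j : injective s -> exists x1 x2,
  [/\ x1 < s j, s j < x2, forall i, i != j -> (x1 < s i) = (x2 < s i) &
      forall i, x1 != s i /\ x2 != s i].
Proof.
move=> si; pose d := \big[Order.min/1%R]_(i | i != j) `|s i - s j|.
have d0 : 0 < d.
  apply/bigmin_gtP; split=> // i ij.
  by rewrite normr_gt0 subr_eq0 (inj_eq si).
have dle i : i != j -> d <= `|s i - s j|.
  by move=> ij; rewrite /d (bigD1 i) //= ge_min lexx.
exists (s j - d / 2), (s j + d / 2).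
have far i : i != j -> s i - s j <= - d \/ d <= s i - s j.
  move=> /dle; rewrite ler_normr => /orP[h|h]; first by right.
  by left; rewrite lerNr.
split=> [||i /far[] h|i].
- by lra.
- by lra.
- by apply/idP/idP; lra.
- by apply/idP/idP; lra.
have [->|/far[] h] := eqVneq i j.
- by split; apply/eqP; lra.
- by split; apply/eqP; lra.
- by split; apply/eqP; lra.
Qed.

Definition support_below m (a : {set X} -> rat) :=
  forall c, a c != 0 -> clique c /\ {in c, forall g, (hi g < m)%N}.

(** The equations that all models give at the monomial [nonmin t m], with the leading coefficients
    absorbed into [a]. *)
Definition vanishing m (a : {set X} -> rat) := forall s t, injective s ->
  \sum_c a c * (val_at s t c * (hi @: c == nonmin t m)%:R) = 0.

Section Step.
Variables (M : 'I_n) (a : {set X} -> rat).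
Hypothesis sa : support_below M.+1 a.
Hypothesis va : vanishing M.+1 a.
Hypothesis IH : forall b, support_below M b -> vanishing M b -> forall c, b c = 0.

Definition contract g (c : {set X}) := if g \in c then 0 else a (g |: c).

Lemma split_top (E : {set X} -> rat) : \sum_c a c * E c =
  \sum_(c : {set X} | ~~ [exists g in c, hi g == M]) a c * E c +
  \sum_(g | hi g == M) \sum_(c : {set X}) contract g c * E (g |: c).
Proof.
rewrite (bigID (fun c : {set X} => [exists g in c, hi g == M])) /= addrC.
congr (_ + _); symmetry.
transitivity (\sum_(g | hi g == M) \sum_(c : {set X} | g \in c) a c * E c).
  apply: eq_bigr => g _.
  rewrite (bigID (fun c : {set X} => g \in c)) /= big1 ?add0r => [|c gc].
    rewrite [RHS](reindex_onto (fun c : {set X} => g |: c) (fun c : {set X} => c :\ g)) => [|c gc].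
      apply: eq_big => c; last by rewrite /contract => /negPf->.
      rewrite setU11 /=; apply/idP/eqP => [gc|<-]; first exact: setU1K.
      by rewrite !inE eqxx.
    exact: setD1K.
  by rewrite /contract gc mul0r.
rewrite (exchange_big_dep (fun c : {set X} => [exists g in c, hi g == M])) /=.
  apply: eq_bigr => c /exists_inP[g gc gM].
  have [->|nz] := eqVneq (a c) 0; first by rewrite mul0r big1 // => ? _; rewrite mul0r.
  have [cl _] := sa nz.
  rewrite (bigD1 g) ?gM //= big1 ?addr0 // => h /andP[/andP[hM hc] hg].
  by case/eqP: hg; apply: (hi_inj_clique cl) => //; rewrite (eqP hM) (eqP gM).
by move=> g c gM gc; apply/exists_inP; exists g.
Qed.

(** Give [M] a class of its own, with a label above all values of [t]. Then every generator with
    larger index [M] vanishes and [M] is least in its class, so the equations reduce to those below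
    [M] for the remaining cliques. *)
Lemma no_top (c : {set X}) : ~~ [exists g in c, hi g == M] -> a c = 0.
Proof.
move=> nc; pose b (c : {set X}) := if [exists g in c, hi g == M] then 0 else a c.
have hb c' : a c' != 0 -> ~~ [exists g in c', hi g == M] ->
    clique c' /\ {in c', forall g, (hi g < M)%N}.
  move=> /sa[cl h] nx; split=> // g gc; have := h g gc; rewrite ltnS leq_eqVlt.
  case/predU1P=> // e; case/exists_inP: nx; exists g => //.
  by rewrite -val_eqE /= e.
suff : b c = 0 by rewrite /b (negPf nc).
clear nc; apply: IH => [{}c|s t si].
  rewrite /b; have [_|nx nz] := boolP [exists g in c, hi g == M].
    by rewrite eqxx.
  exact: hb.
pose t' i := if i == M then (\max_i t i).+1 else t i.
have := va t' si; rewrite split_top [X in _ + X]big1 ?addr0 => [h|g /eqP gM].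
  rewrite -[RHS]h [RHS]big_mkcond /=; apply: eq_bigr => {}c _.
  rewrite /b; case: ifP => /= [_|/negbT nx]; first by rewrite mul0r.
  have [->|nz] := eqVneq (a c) 0; first by rewrite !mul0r.
  have [_ lt] := hb c nz nx.
  rewrite (@val_at_eq s t s t' c M) //; last by move=> i /negPf; rewrite /t' => ->.
  congr (_ * (_ * (_ == _)%:R)); apply/setP => i; rewrite !inE ltnS.
  have [iM|iM|iM] := ltngtP i M; rewrite ?andbF //=.
    have /negPf inM : i != M by rewrite -val_eqE /=; lia.
    apply: eq_existsb => j; case: ltnP => //= ji; rewrite /t' inM.
    by have /negPf-> : j != M by rewrite -val_eqE /=; lia.
  symmetry; apply/existsP => -[j /andP[ji /eqP]].
  have -> : i = M by exact: ord_inj.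
  rewrite /t' eqxx; case: eqP => [e|_ e]; first by rewrite e iM ltnn in ji.
  by have := leq_bigmax (F := t) j; rewrite e ltnn.
apply: big1 => {}c _; rewrite /contract; case: ifP => gc; first by rewrite mul0r.
rewrite /val_at big_setU1 ?gc //= {1}/cond.
have -> : (t' (val g).1 == t' (val g).2) = false; last by rewrite andbF !mul0r mulr0.
have nle j : (t j == (\max_i t i).+1) = false.
  by apply/eqP => e; have := leq_bigmax (F := t) j; rewrite e ltnn.
move: gM (lo_hi g); rewrite /t' /hi /lo; case: ifP => _ <-; rewrite eqxx => lt.
  by have /negPf-> : (val g).1 != (val g).2 by rewrite -val_eqE neq_ltn lt.
have /negPf-> : (val g).2 != (val g).1 by rewrite -val_eqE neq_ltn lt.
by rewrite eq_sym.
Qed.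

Definition coef_at s t g :=
  \sum_(c : {set X}) contract g c * (val_at s t c * (hi @: c == nonmin t M)%:R).

Lemma contract_below g : hi g = M -> support_below M (contract g).
Proof.
move=> gM c; rewrite /contract; case: ifP => [_|gc nz]; first by rewrite eqxx.
have [cl lt] := sa nz; split; first by apply: clique_sub cl; exact: subsetUr.
move=> h hc; have := lt h (setU1r _ hc); rewrite ltnS leq_eqVlt => /predU1P[e|//].
have gh : g != h by apply: contraFneq gc => ->.
have /cliqueP/(_ g h (setU11 _ _) (setU1r _ hc) gh) := cl.
by rewrite /adj !level_hi e gM eqxx.
Qed.

Definition cond_top s t x i0 (g : X) :=
  cond (fun i => if i == M then x else s i)
       (fun i => if i == M then t i0 else t i) (val g).1 (val g).2.

(** Place [M] at position [x] of the order and in the class of [i0]. As [i0] is smaller, [M] joins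
    the non-minimal indices, and each generator over [M] contributes its own condition times an
    equation below [M]. *)
Lemma sum_top s t x (i0 : 'I_n) : injective s -> (i0 < M)%N ->
  (forall i, x != s i) ->
  \sum_(g | hi g == M) cond_top s t x i0 g * coef_at s t g = 0.
Proof.
move=> si lti xs; pose s' i := if i == M then x else s i.
pose t' i := if i == M then t i0 else t i.
have si' : injective s'.
  move=> i j; rewrite /s'; case: eqP => [->|_]; case: eqP => [->|_] //.
  - by move/eqP; rewrite (negPf (xs j)).
  - by move/esym/eqP; rewrite (negPf (xs i)).
  - exact: si.
have := va t' si'; rewrite split_top big1 ?add0r => [h|c nc]; last first.
  by rewrite no_top // mul0r.
rewrite -[RHS]h; apply: eq_bigr => g /eqP gM; rewrite /coef_at mulr_sumr.
apply: eq_bigr => c _; have [->|nz] := eqVneq (contract g c) 0.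
  by rewrite !mul0r mulr0.
have [_ lt] := contract_below gM nz.
have gc : g \notin c by move: nz; rewrite /contract; case: ifP => //; rewrite eqxx.
rewrite {2}/val_at big_setU1 //= -/(val_at s' t' c).
rewrite (@val_at_eq s t s' t' c M) //; last first.
- by move=> i /negPf; rewrite /t' => ->.
- by move=> i /negPf; rewrite /s' => ->.
have -> : nonmin t' M.+1 = M |: nonmin t M.
  apply/setP => i; rewrite !inE ltnS -val_eqE /=.
  have [iM|iM|iM] := ltngtP i M; rewrite ?andbF //=.
    have /negPf inM : i != M by rewrite -val_eqE /=; lia.
    apply: eq_existsb => j; case: ltnP => //= ji; rewrite /t' inM.
    by have /negPf-> : j != M by rewrite -val_eqE /=; lia.
  apply/existsP; exists i0; have -> : i = M by exact: ord_inj.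
  have /negPf n0 : i0 != M by rewrite -val_eqE /=; lia.
  by rewrite lti /t' eqxx n0 eqxx.
have MN : M \notin nonmin t M by rewrite inE ltnn.
have Mc : M \notin hi @: c.
  by apply/imsetP => -[h' hc e]; have := lt h' hc; rewrite -e ltnn.
rewrite imsetU1 gM; have -> : (M |: hi @: c == M |: nonmin t M) = (hi @: c == nonmin t M).
  apply/eqP/eqP => [e|->//].
  by rewrite -(setU1K Mc) e setU1K.
by rewrite /cond_top -/s' -/t' [LHS]mulrCA !mulrA.
Qed.

(** A clique containing r_iM has no member with larger index i, since that member would clash with
    r_iM. When [hi @: c] is the whole set of non-minimal indices, i must be least in its class. *)
Lemma coef_lo s t g : hi g = M -> (val g).2 = M -> coef_at s t g != 0 ->
  (val g).1 \notin nonmin t M.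
Proof.
move=> gM g2 /sum_neq0[c]; rewrite !mulf_eq0 !negb_or => /and3P[nz _].
rewrite pnatr_eq0 eqb0 negbK => /eqP <-.
apply/imsetP => -[h hc e]; move: nz; rewrite /contract.
case: ifP => [_|gc]; first by rewrite eqxx.
move/sa => [/cliqueP cl _].
have gh : g != h by apply: contraFneq gc => ->.
have /and3P[_ _ /negP] := cl g h (setU11 _ _) (setU1r _ hc) gh.
rewrite /clash level_hi e eqxx andbT -e g2; case.
by have := lo_hi g; rewrite gM /lo g2; case: ifP => // _; rewrite ltnn.
Qed.

Lemma hi_cases g : hi g = M ->
  ((val g).2 = M /\ ((val g).1 < M)%N) \/ ((val g).1 = M /\ ((val g).2 < M)%N).
Proof.
move=> gM; have := lo_hi g; rewrite gM; move: gM; rewrite /hi /lo.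
by case: ifP => _ ->; [left|right].
Qed.

(** Let [g] be r_iM, put [M] after all other indices and in the class of i. No r_Mj survives, and an
    r_jM survives only for j equivalent to i; by [coef_lo] both are least in the class, so j = i and
    one term remains. *)
Lemma coef_in s t g : injective s -> hi g = M -> (val g).2 = M ->
  coef_at s t g = 0.
Proof.
move=> si gM g2; apply/eqP/negPn/negP => nz; have gmin := coef_lo gM g2 nz.
have g1 : ((val g).1 < M)%N.
  by case: (hi_cases gM) => [[]//|[]]; have := valP g; rewrite g2 => + e; rewrite e eqxx.
pose x := 1 + \sum_i `|s i|.
have xs i : s i < x.
  rewrite /x (bigD1 i) //= addrCA; apply: (le_lt_trans (ler_norm _)).
  by rewrite ltrDl ltr_pwDl // sumr_ge0.
have xn i : x != s i by rewrite gt_eqF.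
have := sum_top (i0 := (val g).1) t si g1 xn.
have n1 : ((val g).1 == M) = false by apply/negP => /eqP e; rewrite e ltnn in g1.
rewrite (bigD1 g) ?gM //= big1 ?addr0.
  by rewrite /cond_top /cond n1 g2 eqxx xs eqxx mul1r => e; rewrite e eqxx in nz.
move=> h /andP[/eqP hM hg]; case: (hi_cases hM) => -[h2 h1]; last first.
  rewrite /cond_top /cond h2 eqxx.
  have /negPf-> : (val h).2 != M by rewrite -val_eqE neq_ltn h1.
  by rewrite ltNge (ltW (xs _)) mul0r.
have [->|nzh] := eqVneq (coef_at s t h) 0; first by rewrite mulr0.
have hmin := coef_lo hM h2 nzh.
rewrite /cond_top /cond h2 eqxx.
have /negPf-> : (val h).1 != M by rewrite -val_eqE neq_ltn h1.
case: eqP => [e|_]; last by rewrite andbF mul0r.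
have ne : (val h).1 <> (val g).1.
  move=> e1; case/eqP: hg; apply: val_inj.
  by rewrite [LHS]surjective_pairing [RHS]surjective_pairing e1 h2 g2.
move: gmin hmin; rewrite !inE g1 h1 /=.
have [lt|lt|e'] := ltngtP (val h).1 (val g).1.
- by move=> /existsP[]; exists (val h).1; rewrite lt e eqxx.
- by move=> _ /existsP[]; exists (val g).1; rewrite lt e eqxx.
- by case: ne; exact: ord_inj.
Qed.

(** The generators r_iM are settled by [coef_in]. For r_Mj, compare the equations with [M] just
    before and just after j: only the condition of r_Mj changes, so the difference isolates its
    coefficient. *)
Lemma coef_out s t g : injective s -> hi g = M -> coef_at s t g = 0.
Proof.
move=> si gM; case: (hi_cases gM) => -[g2 g1]; first exact: coef_in.
have [x1 [x2 [lt1 lt2 same ne]]] := separate (val g).2 si.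
have n1 : ((val g).2 == M) = false by apply/negP => /eqP e; rewrite e ltnn in g1.
have := sum_top t si g1 (fun i => (ne i).1).
have := sum_top t si g1 (fun i => (ne i).2).
rewrite (bigD1 g) ?gM // => e2; rewrite (bigD1 g) ?gM // => e1.
have rest : \sum_(i | (hi i == M) && (i != g)) cond_top s t x1 (val g).2 i * coef_at s t i =
    \sum_(i | (hi i == M) && (i != g)) cond_top s t x2 (val g).2 i * coef_at s t i.
  apply: eq_bigr => h /andP[/eqP hM hg]; case: (hi_cases hM) => -[h2 h1].
    by rewrite (coef_in t si hM h2) !mulr0.
  congr (_ * _); rewrite /cond_top /cond h2 eqxx.
  have /negPf-> : (val h).2 != M by rewrite -val_eqE neq_ltn h1.
  rewrite same //; apply: contraNneq hg => e; apply/eqP/val_inj.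
  by rewrite [LHS]surjective_pairing [RHS]surjective_pairing e h2 g2.
rewrite rest in e1; have := addIr _ (etrans e1 (esym e2)).
rewrite /cond_top /cond g2 eqxx n1 lt1 eqxx mul1r => ->.
by rewrite ltNge (ltW lt2) mul0r.
Qed.

Lemma peel_step (c : {set X}) : a c = 0.
Proof.
have [/exists_inP[g gc /eqP gM]|] := boolP [exists g in c, hi g == M]; last exact: no_top.
have := IH (contract_below gM) (fun s t si => coef_out t si gM) (c :\ g).
by rewrite /contract !inE eqxx /= setD1K.
Qed.
End Step.

Lemma peel m a : (m <= n)%N -> support_below m a -> vanishing m a ->
  forall c, a c = 0.
Proof.
elim: m a => [|m IHm] a mn sa va c; last first.
  by apply: (@peel_step (Ordinal mn)) => // b sb vb; apply: IHm => //; exact: ltnW.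
have c0 c' : c' != set0 -> a c' = 0.
  case/set0Pn=> g gc; apply/eqP/negPn/negP => /sa[_ /(_ g gc)].
  by [].
have [->|] := eqVneq c set0; last exact: c0.
pose s (i : 'I_n) : rat := (i : nat)%:R.
have si : injective s by move=> i j /eqP; rewrite eqr_nat => /eqP/ord_inj.
have := va s (fun=> 0%N) si; rewrite (bigD1 set0) //= big1 ?addr0 => [|c' /c0->].
  rewrite /val_at big_set0 mul1r imset0.
  have -> : set0 == nonmin (fun=> 0%N) 0 by apply/eqP/setP => i; rewrite !inE.
  by rewrite mulr1.
by rewrite mul0r.
Qed.

Lemma clique_words_free (k : {set X} -> rat) :
  (forall c, k c != 0 -> clique c) ->
  ideal_gen (@pvbd_rel n) (\sum_c k c *: word (enum c)) -> forall c, k c = 0.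
Proof.
move=> kc kI; pose lam (c : {set X}) : rat := omw (enum c) (hi @: c).
have lam0 c : clique c -> lam c != 0.
  move=> cl; rewrite /lam (_ : hi @: c = [set i in map hi (enum c)]).
    apply: omw_top; rewrite map_inj_in_uniq ?enum_uniq // => g h.
    rewrite !mem_enum; exact: hi_inj_clique.
  apply/setP => i; rewrite inE; apply/imsetP/mapP => -[g gc ->]; exists g => //.
    by rewrite mem_enum.
  by rewrite -mem_enum.
suff H c : k c * lam c = 0.
  move=> c; apply/eqP; have /eqP := H c; rewrite mulf_eq0 => /orP[//|l0].
  by apply/negPn/negP => /kc/lam0; rewrite l0.
apply: (peel (a := fun c => k c * lam c) (leqnn n)) c => [c|s t si].
  rewrite mulf_eq0 negb_or => /andP[/kc cl _]; split=> // g _; exact: ltn_ord.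
have /ffunP/(_ (nonmin t n)) := wop_ideal t si vac kI.
rewrite [RHS]ffunE /aop linear_sum sum_ffunE => h; rewrite -[RHS]h.
apply: eq_bigr => c _; rewrite linearZ /= lin_word wop_omw !ffunE.
have -> : \prod_(g <- enum c) cond s t (val g).1 (val g).2 = val_at s t c.
  by rewrite /val_at big_enum.
have [->|nz] := eqVneq (k c) 0; first by rewrite !mul0r scale0r.
have cl := kc c nz; rewrite -mulrA; congr (_ * _).
rewrite mulrCA -[RHS]/(val_at s t c * omw (enum c) (nonmin t n)).
case: (hi @: c =P nonmin t n) => [<-|ne]; first by rewrite mulr1.
(* A nonzero coefficient would give [nonmin t n] as many elements as [c], and nonzero conditions
   would put [hi @: c] inside it, so the two sets would agree. *)
rewrite !mulr0; symmetry; apply/eqP/negPn/negP; rewrite mulf_eq0 negb_or => /andP[v0 o0].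
have [cN _] := omw_neq0 o0; case: ne; apply/eqP; rewrite eqEcard.
rewrite cN -cardE (card_in_imset (hi_inj_clique cl)) leqnn andbT.
apply/subsetP => i /imsetP[g gc ->].
have : cond s t (val g).1 (val g).2 != 0.
  by apply: contraNneq v0 => e; rewrite /val_at (bigD1 g) //= e mul0r.
rewrite /cond pnatr_eq0 eqb0 negbK => /andP[_ /eqP et].
rewrite inE ltn_ord /=; apply/existsP; exists (lo g); rewrite lo_hi /lo /hi.
by case: ifP => _; rewrite et eqxx.
Qed.
End Independence.

(** * Orthogonality of the relations *)

Section SumPairs.
Variables (n : nat) (V : zmodType).

Lemma sum_gen (E : 'I_n * 'I_n -> V) :
  \sum_(g : gen n) E (val g) = \sum_(p | p.1 != p.2) E p.
Proof.
rewrite [RHS](reindex_omap (fun g : gen n => val g) insub) => [|p pP].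
  by apply: eq_big => // g; rewrite valK eqxx (valP g).
by rewrite insubT.
Qed.

Definition away (i j m : 'I_n) := (m != i) && (m != j).

Lemma sum_two (E : 'I_n -> V) i j : i != j ->
  \sum_k E k = E i + (E j + \sum_(m | away i j m) E m).
Proof.
by move=> ij; rewrite (bigD1 i) //= (bigD1 j) //= eq_sym.
Qed.

(** The terms are sorted by whether they share both, one or none of the indices [i] and [j]; each
    kind is treated by a different relation of the dual. *)
Lemma sum_pairs (G : 'I_n -> 'I_n -> V) i j : i != j ->
  (forall k, G k k = 0) ->
  \sum_k \sum_l G k l = (G i j + G j i) +
    \sum_(m | away i j m) (G i m + G j m + (G m i + G m j)) +
    \sum_(k | away i j k) \sum_(l | away i j l) G k l.
Proof.
move=> ij G0; rewrite (sum_two _ ij) !(sum_two (G _) ij) !G0 add0r.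
under [X in _ + (_ + X)]eq_bigr => k _ do rewrite (sum_two (G k) ij).
rewrite !big_split /= add0r.
set a := G i j; set b := G j i; set c := \sum_(m | _) _; set d := \sum_(m | _) _.
set e := \sum_(m | _) _; set f := \sum_(m | _) _; set h := \sum_(m | _) _.
rewrite -!addrA; congr (_ + _); rewrite addrCA; congr (_ + _).
Qed.

Definition distinct3 (p : 'I_n * 'I_n * 'I_n) := uniq [:: p.1.1; p.1.2; p.2].

Lemma distinct3E i j m : distinct3 (i, j, m) = (i != j) && away i j m.
Proof.
rewrite /distinct3 /away /= !inE negb_or andbT.
by rewrite (eq_sym m i) (eq_sym m j); case: eqP; case: eqP.
Qed.

Lemma sum_distinct3 (E : 'I_n -> 'I_n -> 'I_n -> V) :
  \sum_i \sum_(j | i != j) \sum_(m | away i j m) E i j m =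
  \sum_(p | distinct3 p) E p.1.1 p.1.2 p.2.
Proof.
under eq_bigr => i _ do rewrite pair_big_dep /=.
rewrite pair_big_dep /=.
rewrite (reindex (fun p : 'I_n * 'I_n * 'I_n => (p.1.1, (p.1.2, p.2)))) /=.
  by apply: eq_bigl => -[[i j] m]; rewrite distinct3E.
by exists (fun q => (q.1, q.2.1, q.2.2)) => [[[? ?] ?]|[? [? ?]]].
Qed.

Lemma distinct3_swap (E : 'I_n -> 'I_n -> 'I_n -> V) :
  \sum_(p | distinct3 p) E p.1.1 p.1.2 p.2 =
  \sum_(p | distinct3 p) E p.1.1 p.2 p.1.2.
Proof.
rewrite (reindex (fun p : 'I_n * 'I_n * 'I_n => (p.1.1, p.2, p.1.2))) /=.
  apply: eq_bigl => -[[i j] m]; apply: (@perm_uniq _ [:: i; _; _] [:: i; _; _]).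
  by rewrite perm_cons (perm_catC [:: _] [:: _]).
by exists (fun p => (p.1.1, p.2, p.1.2)) => -[[? ?] ?].
Qed.

Lemma distinct3_rot (E : 'I_n -> 'I_n -> 'I_n -> V) :
  \sum_(p | distinct3 p) E p.1.1 p.1.2 p.2 =
  \sum_(p | distinct3 p) E p.1.2 p.2 p.1.1.
Proof.
rewrite (reindex (fun p : 'I_n * 'I_n * 'I_n => (p.1.2, p.2, p.1.1))) /=.
  by apply: eq_bigl => -[[i j] m]; exact: (rot_uniq 1 [:: i; j; m]).
by exists (fun p => (p.2, p.1.1, p.1.2)) => -[[? ?] ?].
Qed.
End SumPairs.

Lemma r_gen n (g : gen n) : r (val g).1 (val g).2 = letter g.
Proof.
rewrite /r; case: insubP => [h _ e|]; last by rewrite (valP g).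
by congr letter; apply: val_inj; rewrite e -surjective_pairing.
Qed.

Lemma linear_bracket (A : algType rat) (W : lmodType rat)
    (psi : {linear A -> W}) x y :
  psi (bracket x y) = psi (x * y) - psi (y * x).
Proof. by rewrite /bracket linearB. Qed.

Lemma linear_triple (A : algType rat) (W : lmodType rat)
    (psi : {linear A -> W}) x y z :
  psi (bracket x (y + z) + bracket y z) =
  psi (x * y) + psi (x * z) - (psi (y * x) + psi (z * x)) +
  (psi (y * z) - psi (z * y)).
Proof. by rewrite linearD /bracket mulrDr mulrDl !linearB /= !linearD. Qed.

(* [Phi] is a form on pairs of generators that vanishes on the relations of
   [pvb n]; its coefficients then form a relation of the dual. *)
Section Orthogonal.
Variables (n : nat) (B : algType rat) (rd : 'I_n -> 'I_n -> B).
Hypothesis rel : dual_relations rd.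
Local Notation X := (gen n).
Variable Phi : 'I_n -> 'I_n -> 'I_n -> 'I_n -> rat.
Hypothesis Phi_diag : forall i j k, Phi i j k k = 0.
Hypothesis Phi_disjoint : forall i j k l, uniq [:: i; j; k; l] ->
  Phi i j k l = Phi k l i j.
Hypothesis Phi_triple : forall i j k, uniq [:: i; j; k] ->
  Phi i j i k + Phi i j j k - (Phi i k i j + Phi j k i j) +
  (Phi i k j k - Phi j k i k) = 0.

Lemma orthogonal_pairs :
  \sum_(g : X) \sum_(h : X)
    Phi (val g).1 (val g).2 (val h).1 (val h).2 *: bw rd [:: g; h] = 0.
Proof.
pose T i j k l : B := Phi i j k l *: (rd i j * rd k l).
have T0 i j k : T i j k k = 0.
  by rewrite /T Phi_diag scale0r.
transitivity (\sum_i \sum_(j | i != j) \sum_k \sum_l T i j k l).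
  rewrite [RHS]pair_big_dep /=.
  transitivity (\sum_(g : X) \sum_k \sum_l T (val g).1 (val g).2 k l); last first.
    exact: (sum_gen (fun p => \sum_k \sum_l T p.1 p.2 k l)).
  apply: eq_bigr => g _.
  transitivity (\sum_(h : X) T (val g).1 (val g).2 (val h).1 (val h).2).
    by apply: eq_bigr => h _; rewrite /T bw_cons !bw1.
  rewrite (sum_gen (fun p => T (val g).1 (val g).2 p.1 p.2)) pair_bigA /=.
  rewrite big_mkcond /=; apply: eq_bigr => -[k l] _ /=.
  by case: eqVneq => //= ->; rewrite T0.
pose c i j k := rd i j * rd j k.
have dist i j m : i != j -> away i j m -> uniq [:: i; j; m].
  by move=> ij am; rewrite -[uniq _]/(distinct3 (i, j, m)) distinct3E ij.
transitivity (\sum_i \sum_(j | i != j) (\sum_(m | away i j m)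
    (T i j i m + T i j j m + (T i j m i + T i j m j)) +
    \sum_(k | away i j k) \sum_(l | away i j l) T i j k l)).
  apply: eq_bigr => i _; apply: eq_bigr => j ij.
  have T1 : T i j i j = 0 by rewrite /T (rd_sq rel ij) scaler0.
  have T2 : T i j j i = 0 by rewrite /T (rd_opp rel ij) scaler0.
  by rewrite (sum_pairs ij (T0 i j)) T1 T2 addr0 add0r.
under eq_bigr => i _ do rewrite big_split /=.
(* For disjoint index pairs the form is symmetric and the product antisymmetric, so the sum equals
   its own negative. *)
rewrite big_split /= [X in _ + X](_ : _ = 0) ?addr0; last first.
  set Y := LHS.
  have YN : Y = - Y.
    pose P (q : 'I_n * ('I_n * ('I_n * 'I_n))) :=
      [&& q.1 != q.2.1, away q.1 q.2.1 q.2.2.1 & away q.1 q.2.1 q.2.2.2].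
    have YE : Y = \sum_(q | P q) T q.1 q.2.1 q.2.2.1 q.2.2.2.
      rewrite /Y; under eq_bigr => i _ do
        (under eq_bigr => j _ do rewrite pair_big_dep /=; rewrite pair_big_dep /=).
      by rewrite pair_big_dep /=; apply: eq_bigl => -[i [j [k l]]].
    rewrite YE [in RHS](bigID (fun q => q.2.2.1 == q.2.2.2)) /=.
    rewrite [in LHS](bigID (fun q => q.2.2.1 == q.2.2.2)) /=.
    have z q : P q && (q.2.2.1 == q.2.2.2) -> T q.1 q.2.1 q.2.2.1 q.2.2.2 = 0.
      by case/andP=> _ /eqP ->; exact: T0.
    rewrite (eq_bigr _ z) big1_eq !add0r.
    rewrite [in RHS](reindex (fun q => (q.2.2.1, (q.2.2.2, (q.1, q.2.1))))) /=.
      rewrite -sumrN; apply: eq_big => -[i [j [k l]]] /=.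
        rewrite /P /away /= (eq_sym k i) (eq_sym k j) (eq_sym l i) (eq_sym l j).
        by move: (i == j) (k == l) (i == k) (i == l) (j == k) (j == l) => [] [] [] [] [] [].
      rewrite /P /away /= => /andP[/and3P[ij /andP[ki kj] /andP[li lj]] kl].
      have u : uniq [:: i; j; k; l].
        by rewrite /= !inE !negb_or ij kl !(eq_sym i) !(eq_sym j) ki kj li lj.
      by rewrite /T (Phi_disjoint u) (rd_anti rel ij kl) scalerN.
    by exists (fun q => (q.2.2.1, (q.2.2.2, (q.1, q.2.1)))) => -[? [? [? ?]]].
  have : (1 + 1) *: Y = 0 by rewrite scalerDl scale1r {1}YN addNr.
  by move/eqP; rewrite scaler_eq0 => /orP[//|/eqP].
rewrite (sum_distinct3 (fun i j m => T i j i m + T i j j m + (T i j m i + T i j m j))).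
(* Products that share one index are all expressed through the paths [c i j k], which stand for r_ij
   r_jk. *)
transitivity (\sum_(p | distinct3 p)
    ((Phi p.1.1 p.1.2 p.1.1 p.2 + Phi p.1.1 p.1.2 p.1.2 p.2) *: c p.1.1 p.1.2 p.2
     - Phi p.1.1 p.1.2 p.1.1 p.2 *: c p.1.1 p.2 p.1.2
     - (Phi p.1.1 p.1.2 p.2 p.1.1 + Phi p.1.1 p.1.2 p.2 p.1.2) *: c p.2 p.1.1 p.1.2
     + Phi p.1.1 p.1.2 p.2 p.1.2 *: c p.1.1 p.2 p.1.2)).
  apply: eq_bigr => -[[i j] m] /= d; have := d; rewrite distinct3E.
  case/andP=> ij /andP[mi mj].
  have u : uniq [:: i; m; j].
    by rewrite /= !inE negb_or ij mj eq_sym mi.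
  rewrite /T (rd_out rel (d : uniq [:: i; j; m])) (rd_anti rel ij mi) (rd_in rel u).
  rewrite -![rd _ _ * rd _ _]/(c _ _ _).
  move: (Phi i j i m) (Phi i j j m) (Phi i j m i) (Phi i j m j) => x y z t.
  move: (c i j m) (c i m j) (c m i j) => A A' A''.
  rewrite !scalerBr !scalerDl scalerN [x *: A - _ + _]addrAC -[RHS]addrA opprD.
  by rewrite -[_ - _ + t *: A']addrA [_ + t *: A']addrC.
rewrite !big_split /= !sumrN.
(* Renaming the indices of each sum collects the coefficient of one fixed path; it is the expression
   in [Phi_triple]. *)
rewrite -(distinct3_swap (fun i m j => Phi i j i m *: c i m j)).
rewrite -(distinct3_swap (fun i m j => Phi i j m j *: c i m j)).
rewrite (distinct3_rot (fun i j m => (Phi i j m i + Phi i j m j) *: c m i j)).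
rewrite -!sumrN -!big_split big1 //= => -[[i j] m] /= u.
rewrite -!scalerBl -scalerDl (_ : _ - _ + _ = 0) ?scale0r //.
rewrite -[RHS](Phi_triple (u : uniq [:: i; j; m])).
ring.
Qed.
End Orthogonal.

Lemma r_word n (i j : 'I_n) (ij : i != j) : r i j = word [:: exist _ (i, j) ij : gen n].
Proof. by rewrite wordE -r_gen. Qed.

Lemma r_diag n (i : 'I_n) : r i i = 0.
Proof. by rewrite /r; case: insubP => //= g; rewrite eqxx. Qed.

(** The bilinear form for which the words are orthonormal. *)
Definition dot (X : choiceType) (a b : freealg X) : rat^o :=
  lin (fun w => a@_(FMonom w : {fmonom X}) : rat^o) b.

HB.instance Definition _ (X : choiceType) (a : freealg X) :=
  GRing.isZmodMorphism.Build (freealg X) rat^o (dot a) (lin_is_zmod_morphism _).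
HB.instance Definition _ (X : choiceType) (a : freealg X) :=
  GRing.isScalable.Build rat (freealg X) rat^o *:%R (dot a) (lin_is_scalable _).

Lemma dotC (X : choiceType) (a b : freealg X) : dot a b = dot b a.
Proof.
pose d := (msupp a `|` msupp b)%fset.
rewrite /dot (@linEw _ _ _ b d) ?fsubsetUr // (@linEw _ _ _ a d) ?fsubsetUl //.
by apply: eq_bigr => w _; rewrite fmK; exact: mulrC.
Qed.

Lemma linear_three (A : algType rat) (W : lmodType rat)
    (psi : {linear A -> W}) x1 y1 x2 y2 x3 y3 :
  psi (x1 * y1 - (x2 * y2 - x3 * y3)) =
  psi (x1 * y1) - (psi (x2 * y2) - psi (x3 * y3)).
Proof. by rewrite !linearB. Qed.

Lemma excl (T : eqType) (x y : T) : x != y -> forall i, (i == x) && (i == y) = false.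
Proof. by move=> xy i; case: eqP => // ->; exact: negPf. Qed.

Lemma excl' (T : eqType) (i j : T) : i != j -> forall x, (i == x) && (j == x) = false.
Proof. by move=> ij x; case: eqP => // <-; rewrite eq_sym; exact: negPf. Qed.

Section DotRelations.
Variable n : nat.
Local Notation X := (gen n).

Lemma dot_rr (x y z w i j k l : 'I_n) : x != y -> z != w ->
  dot (r x y * r z w) (r i j * r k l) =
  ((i == x) && (j == y) && ((k == z) && (l == w)))%:R.
Proof.
move=> xy zw; rewrite (r_word xy) (r_word zw).
have [->|ij] := eqVneq i j.
  by rewrite r_diag mul0r linear0 (excl xy).
have [->|kl] := eqVneq k l.
  by rewrite r_diag mulr0 linear0 (excl zw) andbF.
rewrite (r_word ij) (r_word kl) -!word_cat /dot lin_word mcoeff_word.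
have gE (a b c d : 'I_n) (ab : a != b) (cd : c != d) :
    (exist _ (a, b) ab == exist _ (c, d) cd :> X) = (c == a) && (d == b).
  by rewrite -val_eqE /= xpair_eqE (eq_sym a) (eq_sym b).
by rewrite fmP /= !eqseq_cons andbT !gE.
Qed.

Lemma dot_square (c : X -> rat) x y : x != y -> forall z w, z != w ->
  dot (r x y * r z w) ((\sum_g c g *: letter g) * (\sum_g c g *: letter g)) =
  dot (r z w * r x y) ((\sum_g c g *: letter g) * (\sum_g c g *: letter g)).
Proof.
move=> xy z w zw; rewrite (r_word xy) (r_word zw) -!word_cat /=.
have lS (h : seq X -> rat^o) : lin h (\sum_g c g *: letter g) = \sum_g c g *: h [:: g].
  by rewrite linear_sum; apply: eq_bigr => g _; rewrite linearZ /= -wordE lin_word.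
have dE g1 h1 : dot (word [:: g1; h1])
    ((\sum_g c g *: letter g) * (\sum_g c g *: letter g)) = c g1 * c h1.
  rewrite /dot lin_mul lS; under eq_bigr => g _ do rewrite lS.
  rewrite (bigD1 g1) //= [X in _ + X]big1 ?addr0 => [|g /negPf gg].
    rewrite (bigD1 h1) //= big1 ?addr0 => [|h /negPf hh].
      by rewrite mcoeff_word eqxx; congr (_ * _); exact: mulr1.
    by rewrite mcoeff_word fmP !eqseq_cons [h1 == h]eq_sym hh andbF; exact: mulr0.
  rewrite big1 ?scaler0 // => h _.
  by rewrite mcoeff_word fmP !eqseq_cons [g1 == g]eq_sym gg; exact: mulr0.
by rewrite !dE mulrC.
Qed.

(* Stated for an abstract [D]: comparing concrete products of generators is
   very expensive for unification. *)
Lemma dot_rel_of (b : freealg X) (D : 'I_n -> 'I_n -> 'I_n -> 'I_n -> rat) :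
  (forall x y z w, x != y -> z != w -> dot (r x y * r z w) b = D x y z w) ->
  (forall x y z w, uniq [:: x; y; z; w] -> D x y z w = D z w x y) ->
  (forall x y z, uniq [:: x; y; z] ->
    D x y x z + D x y y z - (D x z x y + D y z x y) +
    (D x z y z - D y z x z) = 0) ->
  forall a, pvb_rel a -> dot b a = 0.
Proof.
move=> DE D4 D3 a [x y z u|x y z w u].
  have [xy xz yz] : [/\ x != y, x != z & y != z].
    by move: u; rewrite /= !inE negb_or andbT => /andP[/andP[]].
  have E p q p' q' (pq : p != q) (pq' : p' != q') :=
    etrans (dotC b (r p q * r p' q')) (DE p q p' q' pq pq').
  apply: (etrans (linear_triple (dot b) (r x y) (r x z) (r y z))).
  rewrite -[RHS](D3 x y z u); congr (_ + _ - (_ + _) + (_ - _)); exact: E.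
have [xy zw] : x != y /\ z != w.
  by move: u; rewrite /= !inE !negb_or andbT => /and3P[/and3P[-> _ _] _ ->].
apply: (etrans (linear_bracket (dot b) (r x y) (r z w))).
apply: (etrans (y := D x y z w - D z w x y)); last by rewrite (D4 x y z w u) subrr.
by congr (_ - _);
  [exact: (etrans (dotC b _) (DE x y z w xy zw))
  |exact: (etrans (dotC b _) (DE z w x y zw xy))].
Qed.

Lemma dot_rel_sym (b : freealg X) (D : 'I_n -> 'I_n -> 'I_n -> 'I_n -> rat) :
  (forall x y z w, x != y -> z != w -> dot (r x y * r z w) b = D x y z w) ->
  (forall x y z w, x != y -> z != w -> D x y z w = D z w x y) ->
  forall a, pvb_rel a -> dot b a = 0.
Proof.
move=> DE DC; apply: dot_rel_of DE _ _ => [x y z w u|x y z u].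
  apply: DC.
    by move: u; rewrite /= !inE !negb_or => /andP[/and3P[]].
  by move: u; rewrite /= !inE !negb_or andbT => /and3P[].
have [xy xz yz] : [/\ x != y, x != z & y != z].
  by move: u; rewrite /= !inE negb_or andbT => /andP[/andP[]].
by rewrite (DC x y x z) // (DC x y y z) // (DC x z y z) //; ring.
Qed.

Definition dlt (i j k l x y z w : 'I_n) : rat :=
  ((i == x) && (j == y) && ((k == z) && (l == w)))%:R.

Lemma dlt_disjoint x y z w i j k l : uniq [:: x; y; z; w] ->
  ~~ uniq [:: i; j; k; l] -> dlt i j k l x y z w = 0.
Proof.
move=> u nu; rewrite /dlt.
case: (boolP (_ && _)) => // /andP[/andP[/eqP e1 /eqP e2]].
by case/andP=> /eqP e3 /eqP e4; move: nu; rewrite e1 e2 e3 e4 u.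
Qed.

(** The half of the duality opposite to [orthogonal_pairs]: together they show that the quadratic
    relations of each algebra are the full annihilator of those of the other. *)
Lemma dot_rel (a b : freealg X) : pvb_rel a -> pvbd_rel b -> dot b a = 0.
Proof.
move=> ra rb; move: a ra.
have neq3 (x y z : 'I_n) : uniq [:: x; y; z] -> [/\ x != y, x != z & y != z].
  by rewrite /= !inE negb_or andbT => /andP[/andP[]].
case: rb => [c|i j k /neq3[ij ik jk]|i j k /neq3[ij ik jk]|i j ij].
- apply: dot_rel_sym (fun x y z w _ _ => erefl) _ => x y z w xy zw.
  exact: dot_square.
- pose D x y z w := dlt i j i k x y z w - (dlt i j j k x y z w - dlt i k k j x y z w).
  apply: (@dot_rel_of _ D) => [x y z w xy zw|x y z w u|x y z /neq3[xy xz yz]].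
  + apply: (etrans (linear_three (dot _) (r i j) (r i k) (r i j) (r j k) (r i k) (r k j))).
    by congr (_ - (_ - _)); exact: dot_rr.
  + have u' : uniq [:: z; w; x; y] by rewrite -(rot_uniq 2).
    by rewrite /D !dlt_disjoint //= !inE !eqxx ?orbT ?andbF.
  rewrite /D /dlt.
  (* These facts discard the coincidences that would identify two distinct indices; the rest is a
     check over the truth values of the equalities. *)
  have [[e1 e2] e3] := (excl xy, excl xz, excl yz).
  move: (e1 i) (e2 i) (e3 i) (e1 j) (e2 j) (e3 j) (e1 k) (e2 k) (e3 k).
  move: (excl' ij x) (excl' ij y) (excl' ij z) (excl' ik x) (excl' ik y) (excl' ik z).
  move: (excl' jk x) (excl' jk y) (excl' jk z).
  by case: (i == x); case: (i == y); case: (i == z); case: (j == x) => //;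
     case: (j == y) => //; case: (j == z) => //; case: (k == x) => //;
     case: (k == y) => //; case: (k == z).
- pose D x y z w := dlt i k j k x y z w - (dlt i j j k x y z w - dlt j i i k x y z w).
  apply: (@dot_rel_of _ D) => [x y z w xy zw|x y z w u|x y z /neq3[xy xz yz]].
  + apply: (etrans (linear_three (dot _) (r i k) (r j k) (r i j) (r j k) (r j i) (r i k))).
    by congr (_ - (_ - _)); exact: dot_rr.
  + have u' : uniq [:: z; w; x; y] by rewrite -(rot_uniq 2).
    by rewrite /D !dlt_disjoint //= !inE !eqxx ?orbT ?andbF.
  rewrite /D /dlt.
  have [[e1 e2] e3] := (excl xy, excl xz, excl yz).
  move: (e1 i) (e2 i) (e3 i) (e1 j) (e2 j) (e3 j) (e1 k) (e2 k) (e3 k).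
  move: (excl' ij x) (excl' ij y) (excl' ij z) (excl' ik x) (excl' ik y) (excl' ik z).
  move: (excl' jk x) (excl' jk y) (excl' jk z).
  by case: (i == x); case: (i == y); case: (i == z); case: (j == x) => //;
     case: (j == y) => //; case: (j == z) => //; case: (k == x) => //;
     case: (k == y) => //; case: (k == z).
- apply: (@dot_rel_of _ (dlt i j j i)) => [x y z w xy zw|x y z w u|x y z /neq3[xy xz yz]].
  + exact: dot_rr.
  + have u' : uniq [:: z; w; x; y] by rewrite -(rot_uniq 2).
    by rewrite !dlt_disjoint //= !inE !eqxx ?orbT ?andbF.
  rewrite /dlt.
  have [[e1 e2] e3] := (excl xy, excl xz, excl yz).
  move: (e1 i) (e2 i) (e3 i) (e1 j) (e2 j) (e3 j).
  by case: (i == x); case: (i == y); case: (i == z); case: (j == x) => //;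
     case: (j == y) => //; case: (j == z).
Qed.
End DotRelations.

(** A dual relation multiplied by a nonempty word has degree above two, where [a] has no
    coefficients; only the relations themselves remain, and [dot_rel] applies. *)
Lemma dot_ideal n (a b : freealg (gen n)) :
  pvb_rel a -> ideal_gen (@pvbd_rel n) b -> dot a b = 0.
Proof.
move=> ra; apply: lin_ideal => u v c rc.
case: u => [|x u]; first case: v => [|x v].
- rewrite -[RHS](dot_rel ra rc) dotC; apply: eq_bigr => w _ /=.
  by rewrite cats0.
- rewrite /lin big_seq big1 // => w /(pvbd_rel_homog rc) sw.
  have /homog_coef -> := pvb_rel_homog ra; first exact: scaler0.
  by rewrite /fdeg /= size_cat -[size _]/(fdeg w) sw /= addnS.
- rewrite /lin big_seq big1 // => w /(pvbd_rel_homog rc) sw.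
  have /homog_coef -> := pvb_rel_homog ra; first exact: scaler0.
  rewrite /fdeg /= !size_cat -[size (fmonom_val w)]/(fdeg w) sw.
  by rewrite addnCA !addSn.
Qed.

Lemma orthogonal_word n (B : algType rat) (rd : 'I_n -> 'I_n -> B)
    (psi : {linear freealg (gen n) -> rat^o}) : dual_relations rd ->
  (forall a, pvb_rel a -> psi a = 0) ->
  \sum_(g : gen n) \sum_(h : gen n)
    (psi (word [:: g; h]) : rat) *: bw rd [:: g; h] = 0.
Proof.
move=> rel psi0; pose Phi i j k l : rat := psi (r i j * r k l).
rewrite -[RHS](orthogonal_pairs rel (Phi := Phi)).
- apply: eq_bigr => g _; apply: eq_bigr => h _; congr ((psi _ : rat) *: _).
  by rewrite !r_gen -!wordE -word_cat.
- by move=> i j k; rewrite /Phi r_diag mulr0 linear0.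
- move=> i j k l u; apply/eqP; rewrite -subr_eq0; apply/eqP.
  rewrite -[RHS](psi0 _ (pvb_rel_disjoint u)).
  exact/esym/(linear_bracket psi (r i j) (r k l)).
- move=> i j k u; rewrite -[RHS](psi0 _ (pvb_rel_triple u)).
  exact/esym/(linear_triple psi (r i j) (r i k) (r j k)).
Qed.

(** * The Koszul complex *)

Section Koszul.
Variables (n : nat) (B : algType rat) (rd : 'I_n -> 'I_n -> B).
Local Notation X := (gen n).
Local Notation clique := (clique (@adj n)).
Local Notation wt := (@wt n).
Local Notation bw := (bw rd).
Local Notation cm := (cm rd).

Hypothesis rel : dual_relations rd.
Hypothesis cm_free : forall k : {set X} -> rat,
  (forall c, k c != 0 -> clique c) -> \sum_c k c *: cm c = 0 ->
  forall c, k c = 0.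
Hypothesis bw_orth : forall (f : X -> X -> rat) a, pvb_rel a ->
  \sum_g \sum_h f g h *: bw [:: g; h] = 0 ->
  dot a (\sum_g \sum_h f g h *: word [:: g; h]) = 0.

Lemma cm_inj (k l : {set X} -> rat) : (forall c, k c != 0 -> clique c) ->
  (forall c, l c != 0 -> clique c) ->
  \sum_c k c *: cm c = \sum_c l c *: cm c -> k =1 l.
Proof.
move=> hk hl e c; apply/eqP; rewrite -subr_eq0; apply/eqP.
apply: (cm_free (k := fun c => k c - l c)) c => [c|].
  case: (eqVneq (k c) 0) => [->|/hk//]; rewrite sub0r oppr_eq0; exact: hl.
by under eq_bigr do rewrite scalerBl; rewrite sumrB e subrr.
Qed.

Lemma sum_delta (k : {set X} -> rat) c : (forall c', c' != c -> k c' = 0) ->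
  \sum_c' k c' *: cm c' = k c *: cm c.
Proof.
by move=> k0; rewrite (bigD1 c) //= big1 ?addr0 // => c' /k0->; rewrite scale0r.
Qed.

Lemma bw_rcons w g : bw (rcons w g) = bw w * bw [:: g].
Proof. by rewrite -cats1 bw_cat. Qed.

Lemma wtw_rcons_enum (c : {set X}) g : wtw wt (rcons (enum c) g) = (wtc wt c + wt g)%N.
Proof. by rewrite -cats1 wtw_cat wtw_cons /wtw big_nil addn0 /wtc big_enum. Qed.

Lemma mul_cm (c : {set X}) g : exists k : {set X} -> rat,
  cm c * bw [:: g] = \sum_c' k c' *: cm c' /\
  forall c', k c' != 0 ->
    [/\ clique c', #|c'| = #|c|.+1 & (wtc wt c' <= wtc wt c + wt g)%N].
Proof.
have [k [kE hk]] := bw_span rel (rcons (enum c) g).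
exists k; split=> [|c' /hk[]]; first by rewrite -kE bw_rcons.
by rewrite size_rcons -cardE ltnS wtw_rcons_enum.
Qed.

(** A choice of coefficients supported on cliques; [cm_free] makes it unique, so it can be compared
    with any other such expansion. *)
Definition mu (c : {set X}) g : {set X} -> rat := projT1 (cid (mul_cm c g)).

Lemma muE c g : cm c * bw [:: g] = \sum_c' mu c g c' *: cm c'.
Proof. by rewrite /mu; case: cid => k []. Qed.

Lemma mu_neq0 c g c' : mu c g c' != 0 ->
  [/\ clique c', #|c'| = #|c|.+1 & (wtc wt c' <= wtc wt c + wt g)%N].
Proof. by rewrite /mu; case: cid => k [_ h] /= /h. Qed.

Lemma mu_clique c g c' : mu c g c' != 0 -> clique c'.
Proof. by case/mu_neq0. Qed.

Definition sgn (c : {set X}) g : rat := mu c g (g |: c).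

Lemma mul_union (c : {set X}) g : g \notin c -> clique (g |: c) ->
  [/\ cm c * bw [:: g] = sgn c g *: cm (g |: c),
      forall c', c' != g |: c -> mu c g c' = 0 & sgn c g * sgn c g = 1].
Proof.
move=> gc cl.
have pe : perm_eq (rcons (enum c) g) (enum (g |: c)).
  apply: uniq_perm; first by rewrite rcons_uniq mem_enum gc enum_uniq.
    exact: enum_uniq.
  by move=> x; rewrite mem_rcons inE !mem_enum !inE.
have [e e1 eE] := bw_perm rel pe; rewrite bw_rcons -/(cm c) -/(cm (g |: c)) in eE.
pose k (c' : {set X}) := if c' == g |: c then e else 0.
have kE : mu c g =1 k.
  apply: cm_inj => [c'|c'|]; first exact: mu_clique.
    by rewrite /k; case: (c' =P _) => [->|_]; rewrite ?eqxx.
  rewrite -muE eE (sum_delta (c := g |: c)) => [|c' /negPf nc].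
    by rewrite /k eqxx.
  by rewrite /k nc.
by split=> [|c' /negPf nc|]; rewrite /sgn ?kE /k ?eqxx ?nc.
Qed.

Lemma mu_top (c : {set X}) g c' : clique c -> wtc wt c' = (wtc wt c + wt g)%N ->
  mu c g c' = if [&& g \notin c, clique (g |: c) & c' == g |: c]
              then sgn c g else 0.
Proof.
move=> cl wE; case: ifP => [/and3P[_ _ /eqP->]//|nc].
have [/andP[gc clg]|ngc] := boolP ((g \notin c) && clique (g |: c)).
  have [_ -> //] := mul_union gc clg.
  by apply: contraFneq nc => ->; rewrite gc clg eqxx.
have npw : ~~ pairwise (@adj n) (rcons (enum c) g).
  apply: contra ngc => /(pairwise_clique rel)[clg ug _ _ _].
  rewrite rcons_uniq mem_enum in ug; have [-> _] := andP ug.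
  rewrite (_ : g |: c = [set x in rcons (enum c) g]) //.
  by apply/setP => x; rewrite !inE mem_rcons inE mem_enum.
have [k [kE hk]] := bw_span_strict rel npw.
have -> : mu c g c' = k c'.
  apply: cm_inj => [x|x /hk[]//|]; first exact: mu_clique.
  by rewrite -muE -kE bw_rcons.
apply/eqP/negPn/negP => /hk[_ _]; by rewrite wtw_rcons_enum wE ltnn.
Qed.

Lemma sgn2 (c : {set X}) g : g \notin c -> clique (g |: c) -> sgn c g * sgn c g = 1.
Proof. by move=> gc cl; have [] := mul_union gc cl. Qed.

Lemma sgn_anti (c : {set X}) g h : g != h -> g \notin c -> h \notin c ->
  clique (g |: (h |: c)) -> sgn c g * sgn (g |: c) h = - (sgn c h * sgn (h |: c) g).
Proof.
move=> gh gc hc cl.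
have clh : clique (h |: c) by apply: clique_sub cl; exact: subsetUr.
have cl' : clique (h |: (g |: c)) by rewrite setUCA.
have clg : clique (g |: c) by apply: clique_sub cl'; exact: subsetUr.
have hgc : h \notin g |: c by rewrite !inE negb_or eq_sym gh hc.
have ghc : g \notin h |: c by rewrite !inE negb_or gh gc.
have [e1 _ _] := mul_union gc clg; have [e2 _ _] := mul_union hc clh.
have [e3 _ _] := mul_union hgc cl'; have [e4 _ _] := mul_union ghc cl.
have : cm c * bw [:: g] * bw [:: h] = - (cm c * bw [:: h] * bw [:: g]).
  by rewrite -!mulrA (bw_anti rel) mulrN.
rewrite e1 e2 -!scalerAl e3 e4 !scalerA setUCA -scaleNr => e.
pose k x (c' : {set X}) : rat := if c' == g |: (h |: c) then x else 0.
have kc x c' : k x c' != 0 -> clique c'.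
  by rewrite /k; case: (c' =P _) => [->|_]; rewrite ?eqxx.
have kE x : \sum_c' k x c' *: cm c' = x *: cm (g |: (h |: c)).
  rewrite (sum_delta (c := g |: (h |: c))) => [|c' /negPf nc]; rewrite /k ?eqxx //.
  by rewrite nc.
rewrite -!kE in e; have := cm_inj (kc _) (kc _) e (g |: (h |: c)).
by rewrite /k eqxx.
Qed.

Lemma cm0 : cm set0 = 1.
Proof. by rewrite /cm enum_set0 bw_nil. Qed.

Lemma cm1 g : cm [set g] = bw [:: g].
Proof. by rewrite /cm enum_set1. Qed.

Lemma mu0 g c' : mu set0 g c' = (c' == [set g])%:R.
Proof.
have cl : clique (g |: set0) by rewrite setU0; exact: clique1.
have [e h _] := mul_union (negbT (in_set0 g)) cl.
have [->|nc] := eqVneq c' [set g]; last by rewrite h ?setU0.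
move: e; rewrite setU0 cm0 mul1r cm1 -[LHS]scale1r -cm1 => e.
pose k x (c' : {set X}) : rat := if c' == [set g] then x else 0.
have kc x c : k x c != 0 -> clique c.
  by rewrite /k; case: (c =P _) => [->|_]; rewrite ?eqxx // => _; exact: clique1.
have kE x : \sum_c' k x c' *: cm c' = x *: cm [set g].
  rewrite (sum_delta (c := [set g])) => [|c /negPf n0]; rewrite /k ?eqxx //.
  by rewrite n0.
rewrite -!kE in e; have := cm_inj (kc _) (kc _) e [set g].
by rewrite /k eqxx /sgn setU0 => <-.
Qed.

Lemma mul_pair c g h : cm c * bw [:: g; h] =
  \sum_c'' (\sum_c' mu c g c' * mu c' h c'') *: cm c''.
Proof.
rewrite bw_cons mulrA muE mulr_suml.
under eq_bigr => c' _ do rewrite -scalerAl muE scaler_sumr.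
rewrite exchange_big; apply: eq_bigr => c'' _; rewrite scaler_suml.
by apply: eq_bigr => c' _; rewrite scalerA.
Qed.

Lemma sum_pair (f : X -> X -> rat) c :
  cm c * (\sum_g \sum_h f g h *: bw [:: g; h]) =
  \sum_c'' (\sum_g \sum_h f g h * (\sum_c' mu c g c' * mu c' h c'')) *: cm c''.
Proof.
rewrite mulr_sumr; under eq_bigr => g _ do rewrite mulr_sumr.
under eq_bigr => g _ do
  (under eq_bigr => h _ do rewrite -scalerAr mul_pair scaler_sumr;
   rewrite exchange_big).
rewrite exchange_big; apply: eq_bigr => c'' _; rewrite scaler_suml.
apply: eq_bigr => g _; rewrite scaler_suml; apply: eq_bigr => h _.
by rewrite scalerA.
Qed.

Lemma pair_coef_clique (f : X -> X -> rat) c c'' :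
  \sum_g \sum_h f g h * (\sum_c' mu c g c' * mu c' h c'') != 0 -> clique c''.
Proof.
case/sum_neq0=> g /sum_neq0[h]; rewrite mulf_eq0 negb_or => /andP[_ /sum_neq0[c']].
by rewrite mulf_eq0 negb_or => /andP[_ /mu_clique].
Qed.

Lemma rel2P (f : X -> X -> rat) :
  rel2 mu f <-> \sum_g \sum_h f g h *: bw [:: g; h] = 0.
Proof.
have E e : \sum_g \sum_h f g h * mu [set g] h e =
    \sum_g \sum_h f g h * (\sum_c' mu set0 g c' * mu c' h e).
  apply: eq_bigr => g _; apply: eq_bigr => h _; congr (_ * _).
  rewrite (bigD1 [set g]) //= mu0 eqxx mul1r big1 ?addr0 // => c' /negPf nc.
  by rewrite mu0 nc mul0r.
rewrite -[X in _ <-> X = 0]mul1r -cm0 sum_pair; split=> [h|h e].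
  by rewrite big1 // => e _; rewrite -E h scale0r.
by rewrite E; apply: cm_free h e => e; exact: pair_coef_clique.
Qed.

Lemma mu_rel (f : X -> X -> rat) c c'' : clique c -> rel2 mu f ->
  \sum_g \sum_h f g h * (\sum_c' mu c g c' * mu c' h c'') = 0.
Proof.
move=> cl /rel2P f0; have := sum_pair f c; rewrite f0 mulr0 => /esym h.
by apply: cm_free h c'' => e; exact: pair_coef_clique.
Qed.

Local Notation kosz := (kosz (@adj n) mu).
Local Notation dmu := (dmu mu).

Lemma kosz_exactB p q F : kosz p q.+1 F ->
  (forall u c, dmu F u c = 0) ->
  exists2 G, kosz p.+1 q G & forall u c, dmu G u c = F u c.
Proof.
apply: (kosz_exact (wt := wt) (@adj_sym n) (@adj_irr n) sgn2 sgn_anti mu0).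
- by move=> c g c' _; exact: mu_neq0.
- exact: mu_top.
- exact: mu_rel.
Qed.

Definition deg q (x : B) := exists k : {set X} -> rat,
  x = \sum_c k c *: cm c /\ forall c, k c != 0 -> clique c /\ #|c| = q.

Definition word_ideal p (f : {ffun p.-tuple X -> rat^o}) :=
  ideal_gen (@pvb_rel n) (\sum_(t : p.-tuple X) (f t : rat) *: word t).

Definition koszul_part p q : {ffun p.-tuple X -> B} -> Prop :=
  annih_in (@word_ideal p) (deg q).

Definition kd p (F : {ffun p.+1.-tuple X -> B}) : {ffun p.-tuple X -> B} :=
  [ffun u : p.-tuple X => \sum_g F [tuple of g :: u] * bw [:: g]].

(** At [p = 0] no letter is left for the differential, so every element is a cycle. *)
Definition koszul_cycle p : {ffun p.-tuple X -> B} -> Prop :=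
  match p with 0 => fun=> True | p'.+1 => fun F => kd F = 0 end.

Lemma sum_cm_eq0 (T : finType) (e : T -> {set X} -> rat) (b : T -> rat) :
  (forall t c, e t c != 0 -> clique c) ->
  \sum_t b t *: (\sum_c e t c *: cm c) = 0 -> forall c, \sum_t b t * e t c = 0.
Proof.
move=> ec h; apply: cm_free => [c /sum_neq0[t]|].
  by rewrite mulf_eq0 negb_or => /andP[_ /ec].
rewrite -[RHS]h; under [RHS]eq_bigr => t _ do rewrite scaler_sumr.
rewrite exchange_big; apply: eq_bigr => c _; rewrite scaler_suml.
by apply: eq_bigr => t _; rewrite scalerA.
Qed.

Lemma lin_rel2 (h : seq X -> rat^o) a : pvb_rel a ->
  rel2 mu (fun g k => h [:: g; k]) -> lin h a = 0.
Proof.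
move=> ra /rel2P h0; rewrite -[RHS](bw_orth ra h0) dotC.
rewrite /lin /dot /lin big_seq [RHS]big_seq; apply: eq_bigr => w wa.
have := pvb_rel_homog ra wa; rewrite /fdeg; case: w {wa} => w /= sw; congr (_ *: _).
case: w sw => [|g [|k [|]]] //= _.
exact/esym/mcoeff_pairs.
Qed.

Definition tens p (F : seq X -> {set X} -> rat) : {ffun p.-tuple X -> B} :=
  [ffun t : p.-tuple X => \sum_c F t c *: cm c].

Lemma tens_eq0 p q F : graded (@adj n) p q F -> tens p F = 0 -> forall u c, F u c = 0.
Proof.
move=> gF F0 u c; have [sz|/eqP sz] := eqVneq (size u) p; last first.
  by apply/eqP; apply: contra_notT sz => /gF[].
move: gF F0; rewrite -sz => gF /ffunP/(_ (in_tuple u)); rewrite !ffunE => F0.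
by apply: (cm_free (k := F u)) F0 c => c /gF[].
Qed.

(** From the ideal to the local conditions: for a relation [a] the product of [u], [a] and [v] lies
    in the ideal, so the coefficients of [F] kill it, and [orthogonal_word] turns vanishing on all
    relations into [rel2]. *)
Lemma koszul_coef p q F : koszul_part q F ->
  exists2 F', kosz p q F' & F = tens p F'.
Proof.
move=> [Fdeg Fann].
have /fin_all_exists[k kP] : forall t, exists k : {set X} -> rat,
  F t = \sum_c k c *: cm c /\ forall c, k c != 0 -> clique c /\ #|c| = q.
  exact: Fdeg.
pose F' (w : seq X) c := if insub w is Some t then k (t : p.-tuple X) c else 0.
have F'E (t : p.-tuple X) c : F' t c = k t c by rewrite /F' valK.
have F'0 w c : size w <> p -> F' w c = 0.
  by rewrite /F'; case: insubP => // t _ <- []; exact: size_tuple.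
have kc t c : k t c != 0 -> clique c by case/(kP t).2.
exists F'; last first.
  by apply/ffunP => t; rewrite ffunE (kP t).1; apply: eq_bigr => c _; rewrite F'E.
split=> [w c|c u v].
  rewrite /F'; case: insubP => [t _ <-|]; last by rewrite eqxx.
  by case/(kP t).2 => cl cq; rewrite size_tuple.
apply/rel2P.
pose h (w : seq X) : rat^o := if w is [:: g; x] then F' (u ++ g :: x :: v) c else 0.
rewrite -[RHS](orthogonal_word (psi := lin h) rel) => [|a ra].
  by apply: eq_bigr => g _; apply: eq_bigr => x _; rewrite /= lin_word.
have [sz|/eqP sz] := eqVneq (size u + size v).+2 p; last first.
  rewrite /= /lin big_seq big1 // => w _; rewrite /h.
  case: (fmonom_val w) => [|g [|x [|]]]; rewrite ?scaler0 // F'0 ?scaler0 //.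
  by rewrite size_cat /= !addnS.
have hom : homog p (word u * a * word v).
  rewrite -sz (_ : _.+2 = (size u + 2 + size v)%N); last by rewrite addn2 addSn.
  have hw (w : seq X) : homog (size w) (word w) by exact: homog_word.
  by apply: homogM (hw v); apply: homogM (pvb_rel_homog ra).
pose b : {ffun p.-tuple X -> rat^o} :=
  [ffun t : p.-tuple X => (word u * a * word v)@_(FMonom t : {fmonom X})].
have Ib : word_ideal b.
  rewrite /word_ideal; under eq_bigr do rewrite ffunE; rewrite -homog_words //.
  by apply: ideal_genMr; apply: ideal_genMl; exact: ideal_gen_in.
have := Fann b Ib; under eq_bigr => t _ do rewrite (kP t).1.
move/(sum_cm_eq0 kc)/(_ c) => e.
transitivity (lin (fun w => F' w c : rat^o) (word u * a * word v)).
  rewrite lin_shift /= /lin [LHS]big_seq [RHS]big_seq; apply: eq_bigr => w wa.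
  have := pvb_rel_homog ra wa; rewrite /fdeg /h.
  by case: (fmonom_val w) => [|g [|x [|]]].
rewrite (lin_tuple (p := p)) => [|w /F'0 //].
by rewrite -[RHS]e; apply: eq_bigr => t _; rewrite ffunE F'E.
Qed.

(** The way back: by [bw_orth] the local conditions kill every relation between two words, and these
    products span the ideal. *)
Lemma tens_koszul p q F : kosz p q F -> koszul_part q (tens p F).
Proof.
move=> [gF rF]; split=> [t|b Ib].
  by rewrite ffunE; exists (F t); split=> // c /gF[_ -> ->].
under eq_bigr => t _ do rewrite ffunE scaler_sumr.
rewrite exchange_big big1 //= => c _.
under eq_bigr => t _ do rewrite scalerA.
rewrite -scaler_suml (_ : \sum_t _ = 0) ?scale0r //.
have := lin_ideal (h := fun w => F w c : rat^o) _ Ib.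
rewrite linear_sum => h; rewrite -[RHS]h => [|u v a ra].
  by apply: eq_bigr => t _; rewrite linearZ /= lin_word.
exact: (lin_rel2 ra (rF c u v)).
Qed.

Lemma kd_tens p F : kd (tens p.+1 F) = tens p (dmu F).
Proof.
apply/ffunP => u; rewrite !ffunE.
under [RHS]eq_bigr => c _ do (rewrite /dmu scaler_suml;
  under eq_bigr => g _ do rewrite scaler_suml).
rewrite [RHS]exchange_big; apply: eq_bigr => g _.
rewrite ffunE mulr_suml [RHS]exchange_big; apply: eq_bigr => c1 _ /=.
rewrite -scalerAl muE scaler_sumr; apply: eq_bigr => c' _.
by rewrite scalerA.
Qed.

Lemma kosz_dmuB p q F : kosz p.+1 q F -> kosz p q.+1 (dmu F).
Proof. by apply: (kosz_dmu (wt := wt)) => c g c' _; exact: mu_neq0. Qed.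

Lemma kd_koszul_part p q (F : {ffun p.+1.-tuple X -> B}) :
  koszul_part q F -> koszul_part q.+1 (kd F).
Proof.
by move=> /koszul_coef[F' kF ->]; rewrite kd_tens; exact/tens_koszul/kosz_dmuB.
Qed.

Lemma kd_cycle p q (F : {ffun p.+1.-tuple X -> B}) :
  koszul_part q F -> koszul_cycle (kd F).
Proof.
case: p F => //= p F /koszul_coef[F' kF ->]; rewrite !kd_tens.
apply/ffunP => u; rewrite !ffunE big1 // => c _.
by rewrite (dmuK mu_rel u c kF) scale0r.
Qed.

Theorem koszul_part_exact p q F : koszul_part q.+1 F -> koszul_cycle F ->
  exists2 G : {ffun p.+1.-tuple X -> B}, koszul_part q G & kd G = F.
Proof.
move=> /koszul_coef[F' kF ->] Fcyc.
have dF u c : dmu F' u c = 0.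
  case: p F kF Fcyc => [|p] F kF Fcyc; last first.
    by apply: (tens_eq0 (kosz_dmuB kF).1); rewrite -kd_tens.
  apply: big1 => g _; apply: big1 => c' _.
  by have [->|/kF.1[]//] := eqVneq (F' (g :: u) c') 0; rewrite mul0r.
have [G kG dG] := kosz_exactB kF dF.
exists (tens p.+1 G); first exact: tens_koszul.
rewrite kd_tens; apply/ffunP => u; rewrite !ffunE.
by apply: eq_bigr => c _; rewrite dG.
Qed.

(** In dual degree zero nothing is lost: the value on a word with first letter [g] is the
    coefficient of [g] in the image. *)
Lemma kd_inj0 p (F : {ffun p.+1.-tuple X -> B}) :
  koszul_part 0 F -> kd F = 0 -> F = 0.
Proof.
move=> /koszul_coef[F' kF ->]; rewrite kd_tens.
move/(tens_eq0 (kosz_dmuB kF).1) => d0; apply/ffunP => t; rewrite !ffunE.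
apply: big1 => c _; have [->|nF] := eqVneq (F' t c) 0; first by rewrite scale0r.
have [_ _ /eqP] := kF.1 _ _ nF; rewrite cards_eq0 => /eqP c0; subst c.
case/negP: nF; have [g [u tE]] : exists g u, val t = g :: u.
  by case: t => -[|g u] //= _; exists g, u.
have := d0 u [set g]; rewrite /dmu (bigD1 g) //= [X in _ + X]big1 ?addr0 =>
    [|h /negPf hg].
  rewrite (bigD1 set0) //= big1 ?addr0 => [|c nc]; last first.
    have [->|/kF.1[_ _ /eqP]] := eqVneq (F' (g :: u) c) 0; first by rewrite mul0r.
    by rewrite cards_eq0 (negPf nc).
  by rewrite mu0 eqxx mulr1 /= tE => ->.
apply: big1 => c _; have [->|/kF.1[_ _ /eqP]] := eqVneq (F' (h :: u) c) 0.
  by rewrite mul0r.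
by rewrite cards_eq0 => /eqP->; rewrite mu0 (inj_eq set1_inj) eq_sym hg mulr0.
Qed.
End Koszul.

Section TraceFacts.
Variables (F : fieldType) (V : lmodType F).
Implicit Types (U : V -> Prop).

Lemma is_trace_subspace U f t : is_trace U f t -> subspace U.
Proof.
move=> [m [b [M [[bf bU] _ _]]]]; split.
  by apply/bU; exists (fun=> 0); rewrite big1 // => i _; rewrite scale0r.
move=> a u v /bU[c ->] /bU[d ->]; apply/bU; exists (fun i => a * c i + d i).
rewrite scaler_sumr -big_split; apply: eq_bigr => i _.
by rewrite scalerDl scalerA.
Qed.

Lemma is_trace_spanned U f t : is_trace U f t -> fin_spanned U.
Proof. by move=> [m [b [M [[bf bU] _ _]]]]; exists m, b => u /bU. Qed.

Lemma is_trace_stable U (f : {linear V -> V}) t u :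
  is_trace U f t -> U u -> U (f u).
Proof.
move=> trf; have sU := is_trace_subspace trf.
case: trf => m [b [M [[bf bU] bM _]]] /bU[c ->].
rewrite linear_sum; under eq_bigr do rewrite linearZ /=.
apply: subspace_sum => // i; rewrite bM; apply/bU.
by exists (fun k => M k i).
Qed.

Lemma is_trace_iff U U' f t : (forall u, U u <-> U' u) ->
  is_trace U f t -> is_trace U' f t.
Proof.
move=> UU' [m [b [M [[bf bU] bM tE]]]]; exists m, b, M; split=> //.
by split=> // v; rewrite -UU'.
Qed.

Lemma is_trace0 U f : (forall u, U u <-> u = 0) -> is_trace U f 0.
Proof.
move=> U0; exists 0%N, (fun=> 0), 0; split=> [|[]//|]; last by rewrite mxtrace0.
split=> [c _ []//|v]; rewrite U0; split=> [->|[c ->]]; last by rewrite big_ord0.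
by exists (fun=> 0); rewrite big_ord0.
Qed.
End TraceFacts.

Section Twist.
Variables (F : fieldType) (T : finType) (V : lmodType F).
Variables (rho : T -> T) (g : {linear V -> V}).

Definition twist (h : {ffun T -> V}) : {ffun T -> V} := [ffun w => g (h (rho w))].

Fact twist_is_linear : linear twist.
Proof. by move=> a h k; apply/ffunP => w; rewrite !ffunE linearP. Qed.

HB.instance Definition _ :=
  GRing.isLinear.Build F {ffun T -> V} {ffun T -> V} _ twist twist_is_linear.
End Twist.

(** * Equivariance and the Euler characteristic *)

Section KoszulTraces.
Variables (n : nat) (B : algType rat) (rd : 'I_n -> 'I_n -> B).
Local Notation X := (gen n).
Local Notation clique := (clique (@adj n)).
Local Notation bw := (bw rd).
Local Notation cm := (cm rd).
Local Notation deg := (deg rd).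
Local Notation kd := (kd rd).
Local Notation koszul_part := (koszul_part rd).
Local Notation koszul_cycle := (koszul_cycle rd).

Hypothesis rel : dual_relations rd.
Hypothesis cm_free : forall k : {set X} -> rat,
  (forall c, k c != 0 -> clique c) -> \sum_c k c *: cm c = 0 ->
  forall c, k c = 0.
Hypothesis bw_orth : forall (f : X -> X -> rat) a, pvb_rel a ->
  \sum_g \sum_h f g h *: bw [:: g; h] = 0 ->
  dot a (\sum_g \sum_h f g h *: word [:: g; h]) = 0.

Variables (sX sX' : X -> X) (act : {linear B -> B}).
Hypothesis sX'K : cancel sX' sX.
Hypothesis act_mul : forall x g, act (x * bw [:: g]) = act x * bw [:: sX g].

Fact kd_is_linear p : linear (@kd p).
Proof.
move=> a F G; apply/ffunP => u; rewrite !ffunE scaler_sumr -big_split /=.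
by apply: eq_bigr => g _; rewrite !ffunE mulrDl scalerAl.
Qed.

HB.instance Definition _ p := GRing.isLinear.Build rat
  {ffun p.+1.-tuple X -> B} {ffun p.-tuple X -> B} _ (@kd p) (@kd_is_linear p).

(** The inverse permutation appears because functions on words are pulled back. *)
Definition tact p : p.-tuple X -> p.-tuple X := map_tuple sX'.

Lemma kd_twist p (F : {ffun p.+1.-tuple X -> B}) :
  kd (twist (@tact p.+1) act F) = twist (@tact p) act (kd F).
Proof.
apply/ffunP => u; rewrite !ffunE linear_sum /= [RHS](reindex_inj (can_inj sX'K)).
apply: eq_bigr => g _; rewrite ffunE act_mul sX'K; congr (act (F _) * _).
exact: val_inj.
Qed.

Variables a b : nat -> rat.
Hypothesis a_trace : forall p, is_trace (@annih _ _ (@word_ideal n p) rat^o)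
  (fun h => [ffun w => h (tact w)]) (a p).
Hypothesis b_trace : forall q, is_trace (deg q) act (b q).

Lemma koszul_part_trace p q :
  is_trace (@koszul_part p q) (twist (@tact p) act) (a p * b q).
Proof. exact: is_trace_tensor. Qed.

Definition koszul_Z p q (F : {ffun p.-tuple X -> B}) :=
  koszul_part q F /\ koszul_cycle F.

Lemma koszul_Z_subspace p q : subspace (@koszul_Z p q).
Proof.
have sU := is_trace_subspace (koszul_part_trace p q).
split=> [|c u v [Uu Zu] [Uv Zv]]; split; [exact: sU.1| |exact: sU.2|].
  by case: {sU} p => //= p; exact: linear0.
case: {sU} p u v {Uu Uv} Zu Zv => //= p u v u0 v0.
by rewrite linearP /= u0 v0 scaler0 addr0.
Qed.

Lemma koszul_Z_trace p q : exists t,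
  is_trace (@koszul_Z p q) (twist (@tact p) act) t.
Proof.
have trU := koszul_part_trace p q.
apply: is_trace_ex (koszul_Z_subspace p q) _ _.
  by have [m [e eU]] := is_trace_spanned trU; exists m, e => u [/eU].
move=> u [Uu Zu]; split; first exact: is_trace_stable trU Uu.
case: {trU} p u Zu {Uu} => //= p u u0; rewrite kd_twist u0; exact: linear0.
Qed.

(** Let [t p q] be the trace on cycles. Kernel and image of the differential, with exactness, give
    [tS]; so the alternating sum telescopes. Its ends cancel because every element is a cycle at
    [p = 0] and no nonzero one is at [q = 0] with [p] positive. *)
Lemma koszul_euler k : \sum_(q < k.+2) (-1) ^+ q * (a (k.+1 - q) * b q) = 0.
Proof.
have /choice[t' t'P] : forall pq : nat * nat, exists t,
    is_trace (@koszul_Z pq.1 pq.2) (twist (@tact pq.1) act) t.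
  by move=> pq; exact: koszul_Z_trace.
pose t p q := t' (p, q).
have tP p q : is_trace (@koszul_Z p q) (twist (@tact p) act) (t p q).
  exact: (t'P (p, q)).
have t0 q : a 0 * b q = t 0 q.
  apply: is_trace_uniq (koszul_part_trace 0 q) _.
  by apply: is_trace_iff (tP 0 q) => u; split=> [[]//|Uu]; split.
have tS p q : a p.+1 * b q = t p.+1 q + t p q.+1.
  apply: is_trace_uniq (koszul_part_trace p.+1 q) _.
  apply: (is_trace_exact (p := @kd p) (g := twist (@tact p) act)).
  - exact: is_trace_subspace (koszul_part_trace p.+1 q).
  - by move=> u _; exact: kd_twist.
  - exact: tP.
  - apply: is_trace_iff (tP p q.+1) => w; split=> [[Uw Zw]|[u Uu <-]].
      by have [u Uu uw] := koszul_part_exact rel cm_free bw_orth Uw Zw; exists u.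
    exact: (conj (kd_koszul_part rel cm_free bw_orth Uu) (kd_cycle rel cm_free Uu)).
  - by move=> u; exact: is_trace_stable (koszul_part_trace p.+1 q).
have tp0 p : t p.+1 0 = 0.
  apply: is_trace_uniq (tP p.+1 0) _; apply: is_trace0 => u.
  split=> [[Uu u0]|->]; first exact: kd_inj0 u0.
  exact: (koszul_Z_subspace p.+1 0).1.
rewrite big_ord_recr /= subnn t0.
pose T q := t (k.+1 - q)%N q.
rewrite (eq_bigr (fun q : 'I_k.+1 => (-1) ^+ q * T q - (-1) ^+ q.+1 * T q.+1)).
  rewrite -(big_mkord xpredT (fun q => (-1) ^+ q * T q - (-1) ^+ q.+1 * T q.+1)).
  rewrite (telescope_sumr_eq (fun q => - ((-1) ^+ q * T q))) // => [|q _].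
    by rewrite /T subnn subn0 tp0 mulr0 oppr0 subr0 addNr.
  by rewrite opprK addrC.
move=> q _; rewrite /T subSS subSn -1?ltnS // tS mulrDr exprS mulN1r mulNr opprK.
by [].
Qed.
End KoszulTraces.

(** * Graded characters *)

Lemma relabel_word_map (X : choiceType) (f : X -> X) w :
  relabel f (word w) = word (map f w).
Proof.
elim: w => [|g w IHw]; first by rewrite !word_nil rmorph1.
rewrite -cat1s word_cat map_cat word_cat -IHw -[in RHS]/(map f _) /=.
by rewrite !wordE -relabel_letter; exact: rmorphM.
Qed.

(** * Graded pieces of a quotient of the free algebra *)

Section GradedQuotient.
Variables (X : finType) (Q : algType rat) (pi : {lrmorphism freealg X -> Q}).

Definition qdeg k (x : Q) := exists2 a : freealg X, homog k a & x = pi a.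

Lemma qdegP k x : qdeg k x <->
  exists c : k.-tuple X -> rat, x = \sum_t c t *: pi (word t).
Proof.
split=> [[a ha ->]|[c ->]].
  exists (fun t => a@_(FMonom t : {fmonom X})); rewrite {1}(homog_words ha).
  by rewrite linear_sum; apply: eq_bigr => t _; rewrite linearZ.
exists (\sum_t c t *: word t).
  by apply: homog_sum => t _; apply: homogZ; rewrite -{1}(size_tuple t); exact: homog_word.
by rewrite linear_sum; apply: eq_bigr => t _; rewrite linearZ.
Qed.

Lemma qdeg_subspace k : subspace (qdeg k).
Proof.
split=> [|c _ _ [a ha ->] [b hb ->]]; first by exists 0; rewrite ?linear0 //; exact: homog0.
by exists (c *: a + b); rewrite ?linearP //; apply: homogD; first exact: homogZ.
Qed.

Lemma qdeg_spanned k : fin_spanned (qdeg k).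
Proof.
exists #|{: k.-tuple X}|, (fun i => pi (word (enum_val i : k.-tuple X))) => x /qdegP[c ->].
exists (fun i => c (enum_val i)).
exact: (reindex _ (onW_bij _ (@enum_val_bij {: k.-tuple X}))).
Qed.

Variables (f : X -> X) (act : {linear Q -> Q}).
Hypothesis actE : forall a, act (pi a) = pi (relabel f a).

Lemma qdeg_act k x : qdeg k x -> qdeg k (act x).
Proof.
case/qdegP=> c ->; rewrite linear_sum; under eq_bigr do rewrite linearZ /=.
apply: subspace_sum => [|t]; first exact: qdeg_subspace.
rewrite actE relabel_word_map; exists (word (map f t)) => //.
by rewrite -{1}(size_tuple t) -(size_map f); exact: homog_word.
Qed.

Lemma qdeg_trace k : is_trace (qdeg k) act (trace (qdeg k) act).
Proof.
have [t tP] := is_trace_ex (@qdeg_subspace k) (qdeg_spanned k) (@qdeg_act k).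
by rewrite (traceE tP).
Qed.

Lemma qdeg0_trace : trace (qdeg 0) act = 1.
Proof.
apply: traceE.
exists 1%N, (fun=> 1), 1%:M; split=> [|j|]; last by rewrite mxtrace1.
2: by rewrite big_ord1 (ord1 j) !mxE eqxx scale1r -{1}(rmorph1 pi) actE !rmorph1.
split=> [c|x].
  rewrite big_ord1 => /eqP; rewrite scaler_eq0 oner_eq0 orbF => /eqP c0 i.
  by rewrite (ord1 i).
rewrite qdegP; split=> -[c ->].
  exists (fun=> c [tuple]); rewrite big_ord1 (bigD1 [tuple]) //= word_nil rmorph1.
  by rewrite big1 ?addr0 // => t; rewrite tuple0.
exists (fun=> c ord0); rewrite big_ord1 (bigD1 [tuple]) //= word_nil rmorph1.
by rewrite big1 ?addr0 // => t; rewrite tuple0.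
Qed.
End GradedQuotient.

(** Polarization: the hypothesis is applied to a single generator and to the sum of two. *)
Lemma square_zero_anti (X : finType) (Q : algType rat) (l : X -> Q) :
  (forall c : X -> rat, (\sum_g c g *: l g) * (\sum_g c g *: l g) = 0) ->
  forall g h, l g * l g = 0 /\ l g * l h = - (l h * l g).
Proof.
move=> lsq g h.
have delta g1 : \sum_g0 (g0 == g1)%:R *: l g0 = l g1.
  by rewrite (bigD1 g1) //= eqxx scale1r big1 ?addr0 // => x /negPf->; rewrite scale0r.
have sq g1 : l g1 * l g1 = 0 by rewrite -{1 2}(delta g1) lsq.
split=> //; have := lsq (fun x => (x == g)%:R + (x == h)%:R).
have -> : \sum_x ((x == g)%:R + (x == h)%:R) *: l x = l g + l h.
  by rewrite -(delta g) -(delta h) -big_split; apply: eq_bigr => x _; rewrite scalerDl.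
by rewrite mulrDl !mulrDr !sq add0r addr0 => /eqP; rewrite addr_eq0 => /eqP.
Qed.

Section DualQuotient.
Variables (n : nat) (Q : algType rat) (pi : {lrmorphism freealg (gen n) -> Q}).
Local Notation X := (gen n).
Hypothesis piP : forall a, pi a = 0 <-> ideal_gen (@pvbd_rel n) a.

Let rd (i j : 'I_n) : Q := pi (r i j).

Lemma pi_letter_square (c : X -> rat) :
  (\sum_g c g *: pi (letter g)) * (\sum_g c g *: pi (letter g)) = 0.
Proof.
have e : pi (\sum_g c g *: letter g) = \sum_g c g *: pi (letter g).
  by rewrite linear_sum; apply: eq_bigr => g _; rewrite linearZ.
rewrite -e -rmorphM; apply/piP/ideal_gen_in; exact: pvbd_rel_square.
Qed.

Lemma pi_letter_anti (g h : X) : pi (letter g) * pi (letter g) = 0 /\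
  pi (letter g) * pi (letter h) = - (pi (letter h) * pi (letter g)).
Proof. exact: (@square_zero_anti X Q (fun g => pi (letter g)) pi_letter_square). Qed.

Lemma dual_rel : dual_relations rd.
Proof.
have rL (i j : 'I_n) : i != j -> exists g : X, rd i j = pi (letter g).
  by move=> ij; exists (exist _ (i, j) ij); rewrite /rd (r_word ij) wordE.
split=> [i j /rL[g ->]|i j k l /rL[g ->] /rL[h ->]|i j ij|i j k u|i j k u].
- by have [] := pi_letter_anti g g.
- by have [] := pi_letter_anti g h.
- rewrite /rd -rmorphM; apply/piP/ideal_gen_in; exact: pvbd_rel_opp.
- apply/eqP; rewrite -subr_eq0; apply/eqP.
  rewrite -(rmorph_three pi (r i j) (r i k) (r i j) (r j k) (r i k) (r k j)).
  apply/piP/ideal_gen_in; exact: pvbd_rel_out.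
- apply/eqP; rewrite -subr_eq0; apply/eqP.
  rewrite -(rmorph_three pi (r i k) (r j k) (r i j) (r j k) (r j i) (r i k)).
  apply/piP/ideal_gen_in; exact: pvbd_rel_in.
Qed.

Lemma bw_pi w : bw rd w = pi (word w).
Proof.
elim: w => [|g w IHw]; first by rewrite bw_nil word_nil rmorph1.
rewrite bw_cons bw1 IHw -cat1s word_cat rmorphM; congr (_ * _).
by rewrite wordE -r_gen.
Qed.

Lemma cm_pi_free (k : {set X} -> rat) : (forall c, k c != 0 -> clique (@adj n) c) ->
  \sum_c k c *: cm rd c = 0 -> forall c, k c = 0.
Proof.
move=> kc e; apply: clique_words_free => //; apply/piP; rewrite linear_sum -[RHS]e.
by apply: eq_bigr => c _; rewrite linearZ /cm bw_pi.
Qed.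

Lemma bw_pi_orth (f : X -> X -> rat) a : pvb_rel a ->
  \sum_g \sum_h f g h *: bw rd [:: g; h] = 0 ->
  dot a (\sum_g \sum_h f g h *: word [:: g; h]) = 0.
Proof.
move=> ra e; apply: dot_ideal ra _; apply/piP; rewrite linear_sum -[RHS]e.
apply: eq_bigr => g _; rewrite linear_sum; apply: eq_bigr => h _.
by rewrite linearZ bw_pi.
Qed.

Lemma deg_qdeg q x : qdeg pi q x <-> deg rd q x.
Proof.
split=> [/qdegP[c ->]|[k [-> hk]]]; last first.
  exists (\sum_c k c *: word (enum c)).
    apply: homog_sum => c _; have [->|/hk[_ <-]] := eqVneq (k c) 0.
      by rewrite scale0r; exact: homog0.
    by apply: homogZ; rewrite cardE; exact: homog_word.
  by rewrite linear_sum; apply: eq_bigr => c _; rewrite linearZ /cm bw_pi.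
have /fin_all_exists[k kP] (t : q.-tuple X) : exists k : {set X} -> rat,
    pi (word t) = \sum_c k c *: cm rd c /\ forall c, k c != 0 -> clique (@adj n) c /\ #|c| = q.
  have [k [kE hk]] := bw_span dual_rel t; exists k; rewrite -bw_pi; split=> // d /hk[].
  by rewrite size_tuple.
exists (fun d => \sum_t c t * k t d); split=> [|d /sum_neq0[t]]; last first.
  by rewrite mulf_eq0 negb_or => /andP[_ /(kP t).2].
under eq_bigr => t _ do rewrite (kP t).1 scaler_sumr.
rewrite exchange_big; apply: eq_bigr => d _; rewrite scaler_suml.
by apply: eq_bigr => t _; rewrite scalerA.
Qed.
End DualQuotient.

Lemma gen_actK n (s : 'S_n) : cancel (gen_act s) (gen_act s^-1%g).
Proof.
by move=> g; apply: val_inj; rewrite /= !permK -surjective_pairing.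
Qed.

Section Orthogonals.
Variables (n : nat) (p : nat).
Local Notation X := (gen n).
Local Notation V := {ffun p.-tuple X -> rat^o}.

Definition wsum (h : V) : freealg X := \sum_(t : p.-tuple X) (h t : rat) *: word t.

Fact wsum_is_linear : linear wsum.
Proof.
move=> a h k; rewrite /wsum scaler_sumr -big_split; apply: eq_bigr => t _.
by rewrite !ffunE scalerDl scalerA.
Qed.

HB.instance Definition _ := GRing.isLinear.Build rat V (freealg X) _ wsum wsum_is_linear.

Definition wact (s : 'S_n) : V -> V := twist (@tact n (gen_act s^-1%g) p) idfun.

Lemma tact_inj (f : X -> X) : injective f -> injective (@tact n f p).
Proof. by move=> fi t u /(congr1 val) /(inj_map fi) /val_inj. Qed.

Lemma tactK s : cancel (@tact n (gen_act s) p) (@tact n (gen_act s^-1%g) p).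
Proof. by move=> t; apply: val_inj; rewrite /= (mapK (gen_actK s)). Qed.

Lemma wsum_act s h : wsum (wact s h) = relabel (gen_act s) (wsum h).
Proof.
rewrite linear_sum /wsum (reindex_inj (tact_inj (@gen_act_inj n s))) /=.
by apply: eq_bigr => t _; rewrite ffunE tactK linearZ /= relabel_word_map.
Qed.

Lemma word_ideal_act s h : word_ideal h -> word_ideal (wact s h).
Proof.
move=> Ih; rewrite /word_ideal -/(wsum _) wsum_act.
exact: ideal_gen_map (@pvb_rel_act n s) _ Ih.
Qed.

Lemma word_ideal_subspace : subspace (@word_ideal n p).
Proof.
split=> [|c u v Iu Iv]; rewrite /word_ideal -/(wsum _).
  by rewrite linear0; exact: ideal_gen0.
have -> : wsum (c *: u + v) = c%:A * wsum u + wsum v by rewrite linearP mulr_algl.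
by apply: ideal_genD Iv; apply: ideal_genMl; exact: Iu.
Qed.

(** A permutation of words is orthogonal for the standard form, so the annihilator is stable under
    [s] because the ideal is stable under its inverse. *)
Lemma annih_act s (h : V) : annih (@word_ideal n p) h ->
  annih (@word_ideal n p) (wact s h).
Proof.
move=> ah b Ib; rewrite -[RHS](ah _ (word_ideal_act s^-1%g Ib)).
rewrite (reindex_inj (tact_inj (@gen_act_inj n s))); apply: eq_bigr => t _ /=.
by rewrite !ffunE tactK invgK.
Qed.

Variables (Q : algType rat) (pi : {lrmorphism freealg (gen n) -> Q}) (s : 'S_n).
Hypothesis piP : forall a, pi a = 0 <-> ideal_gen (@pvb_rel n) a.
Variable act : {linear Q -> Q}.
Hypothesis actE : forall a, act (pi a) = pi (relabel (gen_act s) a).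

(* Both traces are the difference of those on the space of all combinations of
   words and on the ideal. *)
Lemma annih_trace : is_trace (@annih _ _ (@word_ideal n p) rat^o) (wact s)
  (trace (qdeg pi p) act).
Proof.
have sV : subspace (fun _ : V => True) by [].
have sA := @annih_subspace _ _ (@word_ideal n p) rat^o.
have [i iP] := is_trace_ex word_ideal_subspace (ffun_spanned _) (@word_ideal_act s).
have [a aP] := is_trace_ex sA (ffun_spanned _) (@annih_act s).
suff <- : a = trace (qdeg pi p) act by [].
apply: (addrI i).
have v1 : is_trace (fun _ : V => True) (wact s) (i + a).
  apply: is_trace_direct sV _ _ word_ideal_subspace sA iP aP.
    by move=> v; exact: annih_disjoint.
  by move=> u; split=> // _; exact: (annih_complement u word_ideal_subspace).
apply: is_trace_uniq v1 _.
apply: (is_trace_exact (p := pi \o wsum) (g := act)) => //.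
- by move=> u _ /=; rewrite actE wsum_act.
- by apply: is_trace_iff iP => u; rewrite /word_ideal -piP; split=> // -[].
- apply: is_trace_iff (qdeg_trace actE p) => x; rewrite qdegP.
  split=> [[c ->]|[u _ <-]].
    exists [ffun t => c t : rat^o] => //=; rewrite linear_sum.
    by apply: eq_bigr => t _; rewrite linearZ /= ffunE.
  exists u; rewrite /= linear_sum; apply: eq_bigr => t _; exact: linearZ.
Qed.
End Orthogonals.

Lemma fps_inv_uniq (f g : fps) : f 0%N != 0 ->
  fps_mul f g =1 fps_one -> g =1 fps_inv f.
Proof.
move=> f0 fg k; elim/ltn_ind: k => k IHk.
have := fg k; rewrite -(fps_mul_inv f0) /fps_mul !big_ord_recl /= !subn0.
rewrite (eq_bigr (fun i : 'I_k => f (bump 0 i) * fps_inv f (k - bump 0 i)%N)).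
  by move/addIr/(mulfI f0).
by move=> i _; rewrite IHk // /bump /= add1n ltn_subrL; case: k i {IHk} => // -[].
Qed.

Section GradedCharacters.
Variables (n : nat) (s : 'S_n) (A B : algType rat).
Variables (pi : {lrmorphism freealg (gen n) -> A}) (act : {linear A -> A}).
Hypothesis piP : forall a, pi a = 0 <-> ideal_gen (@pvb_rel n) a.
Hypothesis actE : forall a, act (pi a) = pi (relabel (gen_act s) a).
Variables (pid : {lrmorphism freealg (gen n) -> B}) (actd : {linear B -> B}).
Hypothesis pidP : forall a, pid a = 0 <-> ideal_gen (@pvbd_rel n) a.
Hypothesis actdE : forall a, actd (pid a) = pid (relabel (gen_act s) a).
Hypothesis actdM : forall x y, actd (x * y) = actd x * actd y.

Lemma koszul_char :
  trace (qdeg pi 0) act = 1 /\ trace (qdeg pid 0) actd = 1 /\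
  forall k, \sum_(q < k.+2)
    (-1) ^+ q * (trace (qdeg pi (k.+1 - q)) act * trace (qdeg pid q) actd) = 0.
Proof.
do 2?split; [exact: qdeg0_trace actE|exact: qdeg0_trace actdE|] => k.
have bw_act x g : actd (x * bw (fun i j => pid (r i j)) [:: g]) =
    actd x * bw (fun i j => pid (r i j)) [:: gen_act s g].
  rewrite actdM; congr (_ * _).
  by rewrite 2!bw_pi actdE relabel_word_map.
have sK : cancel (gen_act s^-1%g) (gen_act s).
  by move=> g; have := gen_actK s^-1%g g; rewrite invgK.
apply: (koszul_euler (dual_rel pidP) (cm_pi_free pidP) (bw_pi_orth pidP)
  sK bw_act
  (a := fun p => trace (qdeg pi p) act) (b := fun q => trace (qdeg pid q) actd)).
- by move=> p; exact: annih_trace.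
- by move=> q; exact: (is_trace_iff (deg_qdeg pidP q) (qdeg_trace actdE q)).
Qed.

Lemma pvb_char_eq (f g : fps) :
  f =1 (fun k => trace (qdeg pi k) act) ->
  g =1 (fun k => trace (qdeg pid k) actd) ->
  f =1 fps_inv (fps_negz g).
Proof.
have [a0 [b0 e]] := koszul_char => fE gE.
apply: fps_inv_uniq => [|[|k]]; rewrite /fps_negz ?gE ?b0 ?mulr1 ?oner_eq0 //.
  by rewrite /fps_mul big_ord1 gE b0 fE a0 !mulr1.
rewrite /fps_one -[RHS](e k); apply: eq_bigr => i _.
by rewrite gE fE -mulrA [_ * trace _ act]mulrC.
Qed.
End GradedCharacters.

Theorem corollary2 (n : nat) (hn : (0 < n)%N) (s : 'S_n) :
  pvb_char s =1 fps_inv (fps_negz (pvbd_char s)).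
Proof.
pose pi : {lrmorphism freealg (gen n) -> pvb n} :=
  @qclass _ _ _ (quadratic_ideal_proper (@pvb_rel_homog n)).
pose pid : {lrmorphism freealg (gen n) -> pvbd n} :=
  @qclass _ _ _ (quadratic_ideal_proper (@pvbd_rel_homog n)).
apply: (@pvb_char_eq n s (pvb n) (pvbd n) pi (pvb_act s) _ _ pid (pvbd_act s)).
- by move=> a; exact: qclass_eq0.
- by move=> a; apply: qmapE; exact: pvb_rel_act.
- by move=> a; exact: qclass_eq0.
- by move=> a; apply: qmapE; exact: pvbd_rel_act.
- exact: rmorphM.
- by [].
- by [].
Qed.
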